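(* Let $\mathcal{X}=\{x_1,\dots,x_5\}$ and $\mathcal{Y}=\{y_1,\dots,y_5\}$ be two generic sets of five ordered points in $\mathbb{P}^3$. (1) The centers-variety of $(\mathcal{X},\mathcal{Y})$ is the degeneracy locus of a vector bundle map on $\mathbb{P}^3\times\mathbb{P}^3$ $$\mathcal{O}(-1,0)\oplus\mathcal{O}(0,-1)\oplus\mathcal{O}(-1,-1)\to\mathcal{O}^4 .$$ (2) The multidegree (class) of the centers-variety is $3a^2+5ab+3b^2$ in the Chow ring $\mathbb{Z}[a,b]/(a^4,b^4)$ of $\mathbb{P}^3\times\mathbb{P}^3$, where $a$ and $b$ are the hyperplane classes of the two factors. The centers-variety is a rational $4$-fold. (3) If $\mathcal{X}=\mathcal{Y}$ consists of the five standard points $(1:0:0:0),(0:1:0:0),(0:0:1:0),(0:0:0:1),(1:1:1:1)$ of $\mathbb{P}^3$, then the ideal of the centers-variety is the ideal of maximal minors of the matrix $$\begin{pmatrix} a_0&b_0&a_0b_0\\ a_1&b_1&a_1b_1\\ a_2&b_2&a_2b_2\\ a_3&b_3&a_3b_3\end{pmatrix},$$ where $(a_0:\dots:a_3)$ and $(b_0:\dots:b_3)$ are the homogeneous coordinates on the two factors. This matrix represents the bundle map in (1), its three columns corresponding to the three summands $\mathcal{O}(-1,0)$, $\mathcal{O}(0,-1)$, $\mathcal{O}(-1,-1)$ respectively.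
   Context: All projective spaces are over $\mathbb{C}$. A projective camera is a linear map $A:\mathbb{P}^3\dashrightarrow\mathbb{P}^2$ represented (up to scale) by a $3\times 4$ matrix of rank three. Its center is the unique $a\in\mathbb{P}^3$ with $Aa=0$, and the image $Ax$ of $x\in\mathbb{P}^3$ is defined if and only if $x\ne a$. For cameras $A,B$ whose centers do not lie in $\mathcal{X}$, $\mathcal{Y}$ respectively, write $(Ax_i)_{i=1}^5\sim(By_i)_{i=1}^5$ if there is $H\in \mathrm{SL}(3)$ such that $Ax_i=HBy_i$ in $\mathbb{P}^2$ for all $i$. This condition depends on $A,B$ only through their centers. Let $2\mathcal{X}$ denote the union of all lines joining two distinct points of $\mathcal{X}$. For five-point sets $\mathcal{X},\mathcal{Y}$, the centers-variety is the Zariski closure in $\mathbb{P}^3\times\mathbb{P}^3$ of the locus of pairs of camera centers $(a,b)\in(\mathbb{P}^3\setminus 2\mathcal{X})\times(\mathbb{P}^3\setminus 2\mathcal{Y})$ such that cameras $A,B$ with centers $a,b$ satisfy $(Ax_i)_{i=1}^5\sim(By_i)_{i=1}^5$. The degeneracy locus of a bundle map from a rank $3$ bundle to a rank $4$ bundle is the locus where it has rank at most $2$. ''Generic'' means: for all $(\mathcal{X},\mathcal{Y})$ in some nonempty Zariski open subset of $(\mathbb{P}^3)^5\times(\mathbb{P}^3)^5$. *)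

(* Defs.v *)
From HB Require Import structures.
From mathcomp Require Import all_boot all_order all_algebra.
From mathcomp Require Import reals.
From mathcomp Require Import complex mpoly.

Set Implicit Arguments.
Unset Strict Implicit.
Unset Printing Implicit Defensive.

Import GRing.Theory.
Local Open Scope ring_scope.

(* A point of P^n is a line through 0 in K^(n+1), so that Leibniz equality of *)
(* points is equality in projective space.                                    *)
Record pspace (K : fieldType) (n : nat) := PSpace {
  pline :> {vspace 'cV[K]_n.+1};
  _ : \dim pline == 1%N }.

HB.instance Definition _ (K : fieldType) (n : nat) :=
  [isSub for @pline K n].
HB.instance Definition _ (K : fieldType) (n : nat) :=
  [Choice of pspace K n by <:].

Lemma ppoint_subproof (K : fieldType) (n : nat) (v : 'cV[K]_n.+1) :
  v != 0 -> \dim <[v]> == 1%N.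
Proof. by move=> v0; rewrite dim_vline v0. Qed.

Definition ppoint (K : fieldType) (n : nat) (v : 'cV[K]_n.+1) (v0 : v != 0) :
  pspace K n := PSpace (ppoint_subproof v0).

(* The product of m copies of P^n.                                            *)
Definition multiproj (K : fieldType) (m n : nat) := {ffun 'I_m -> pspace K n}.

Section Multiprojective.
Variables (K : fieldType) (m n : nat).
Implicit Types (p : multiproj K m n) (r : 'I_m -> 'cV[K]_n.+1).
Implicit Types (f : {mpoly K[m * n.+1]}) (Z S U : multiproj K m n -> Prop).

Definition hcoords r p : Prop := forall i, p i = <[r i]>%VS :> {vspace _}.

(* The coordinate ring is K[z_(i,j)] with 'X_(mxvec_index i j) standing for   *)
(* the j-th homogeneous coordinate on the i-th factor.                        *)
Definition evalvec r (k : 'I_(m * n.+1)) : K :=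
  mxvec (\matrix_(i < m, j < n.+1) r i j 0) 0 k.

Definition multihomog (d : 'I_m -> nat) f : Prop :=
  forall mon, mon \in msupp f ->
  forall i, (\sum_(j < n.+1) mon (mxvec_index i j))%N = d i.

Definition vanishes_at f p : Prop :=
  forall r, hcoords r p -> f.@[evalvec r] = 0.

Definition zariski_closed Z : Prop :=
  exists F : {mpoly K[m * n.+1]} -> Prop,
    (forall f, F f -> exists d, multihomog d f) /\
    (forall p, Z p <-> forall f, F f -> vanishes_at f p).

Definition zariski_open U : Prop := zariski_closed (fun p => ~ U p).

Definition zariski_closure S : multiproj K m n -> Prop := fun p =>
  forall Z, zariski_closed Z -> (forall q, S q -> Z q) -> Z p.

Definition generically (P : multiproj K m n -> Prop) : Prop :=
  exists U, zariski_open U /\ (exists p, U p) /\ (forall p, U p -> P p).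

Definition irreducible Z : Prop :=
  (exists p, Z p) /\
  forall Z1 Z2, zariski_closed Z1 -> zariski_closed Z2 ->
    (forall p, Z p -> Z1 p \/ Z2 p) ->
    (forall p, Z p -> Z1 p) \/ (forall p, Z p -> Z2 p).

(* Over an infinite field a polynomial vanishes at all systems of homogeneous *)
(* coordinates of all points of Z iff each of its multihomogeneous components *)
(* vanishes on Z, so this is the multigraded ideal of Z.                      *)
Definition vanishing_ideal Z f : Prop := forall p, Z p -> vanishes_at f p.

(* Since Hom(O(-e), O) = H^0(O(e)) is the space of forms of multidegree e, a  *)
(* map O(-e_1) + ... + O(-e_s) -> O^t is a t x s matrix whose j-th column     *)
(* consists of forms of multidegree e_j.                                      *)
Definition bundle_map (s t : nat) (e : 'I_s -> 'I_m -> nat)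
  (M : 'M[{mpoly K[m * n.+1]}]_(t, s)) : Prop :=
  forall i j, multihomog (e j) (M i j).

Definition degeneracy_locus (s t : nat) (k : nat)
  (M : 'M[{mpoly K[m * n.+1]}]_(t, s)) : multiproj K m n -> Prop := fun p =>
  forall r, hcoords r p ->
    (\rank (map_mx (meval (evalvec r)) M) <= k)%N.

End Multiprojective.

(* The maximal minors of a (t+1) x t matrix are obtained by deleting a row.   *)
Definition maximal_minor_ideal (A : comNzRingType) (t : nat)
  (M : 'M[A]_(t.+1, t)) (f : A) : Prop :=
  exists g : 'I_t.+1 -> A, f = \sum_(k < t.+1) g k * \det (row' k M).

Section Birational.
Variables (K : fieldType) (m n m' n' : nat).

(* A rational map to a product of projective spaces is given on each factor   *)
(* by a vector of forms of one common multidegree; it is defined at p when    *)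
(* none of these vectors vanishes at p, as is forced by the existence of q in *)
(* [ratmap_at].                                                               *)
Definition ratmap (phi : 'I_m' -> 'cV[{mpoly K[m * n.+1]}]_n'.+1) : Prop :=
  forall i, exists d, forall j, multihomog d (phi i j 0).

Definition ratmap_at (phi : 'I_m' -> 'cV[{mpoly K[m * n.+1]}]_n'.+1)
  (p : multiproj K m n) (q : multiproj K m' n') : Prop :=
  forall r, hcoords r p ->
    hcoords (fun i => map_mx (meval (evalvec r)) (phi i)) q.

End Birational.

(* Mutually inverse rational maps restricting to bijections between nonempty  *)
(* relatively open subsets.                                                   *)
Definition birational (K : fieldType) (m n m' n' : nat)
  (Z : multiproj K m n -> Prop) (W : multiproj K m' n' -> Prop) : Prop :=
  exists (phi : 'I_m' -> 'cV[{mpoly K[m * n.+1]}]_n'.+1)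
         (psi : 'I_m -> 'cV[{mpoly K[m' * n'.+1]}]_n.+1)
         (U : multiproj K m n -> Prop) (U' : multiproj K m' n' -> Prop),
    [/\ ratmap phi /\ ratmap psi,
        zariski_open U /\ (exists p, Z p /\ U p),
        zariski_open U' /\ (exists q, W q /\ U' q),
        (forall p, Z p -> U p -> exists q,
           [/\ W q, U' q, ratmap_at phi p q & ratmap_at psi q p]) &
        (forall q, W q -> U' q -> exists p,
           [/\ Z p, U p, ratmap_at psi q p & ratmap_at phi p q])].

Definition rational_fold (K : fieldType) (m n d : nat)
  (Z : multiproj K m n -> Prop) : Prop :=
  [/\ zariski_closed Z, irreducible Z &
      birational Z (fun _ : multiproj K 1 d => True)].

(* Hyperplanes are points of the dual projective space.                       *)
Definition on_hyperplane (K : fieldType) (n : nat) (h x : pspace K n) : Prop :=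
  forall u v, u \in (h : {vspace _}) -> v \in (x : {vspace _}) ->
    u^T *m v = 0.

(* r generic hyperplanes in the first factor and s in the second one meet Z   *)
(* in exactly N points.                                                       *)
Definition intersection_number (K : fieldType) (Z : multiproj K 2 3 -> Prop)
  (r s N : nat) : Prop :=
  generically (fun h : multiproj K (r + s) 3 =>
    exists L : seq (multiproj K 2 3),
      [/\ uniq L, size L = N &
          forall p, p \in L <->
            [/\ Z p, forall i, on_hyperplane (h (lshift s i)) (p 0) &
                     forall j, on_hyperplane (h (rshift r j)) (p 1)]]).

(* Equality in the Chow ring Z[a,b]/(a^4,b^4) of P^3 x P^3, with a = 'X_0 and *)
(* b = 'X_1.                                                                  *)
Definition chow_eq (P Q : {mpoly int[2]}) : Prop :=
  exists u v : {mpoly int[2]}, P - Q = u * 'X_0 ^+ 4 + v * 'X_1 ^+ 4.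

(* P is the multidegree of the subvariety Z of codimension c.  As a^3 b^3 is  *)
(* the class of a point, the coefficient of a^i b^j in the class of Z is the  *)
(* degree of [Z] a^(3-i) b^(3-j); in characteristic 0 this is the number of   *)
(* points of Z on 3-i generic hyperplanes of the first factor and 3-j generic *)
(* hyperplanes of the second one.                                             *)
Definition multidegree (K : fieldType) (Z : multiproj K 2 3 -> Prop) (c : nat)
  (P : {mpoly int[2]}) : Prop :=
  exists N : 'I_4 -> 'I_4 -> nat,
    (forall i j : 'I_4, (i + j)%N = c ->
       intersection_number Z (3 - i) (3 - j) (N i j)) /\
    chow_eq P (\sum_(i < 4) \sum_(j < 4 | (i + j == c)%N)
                 'X_0 ^+ i * 'X_1 ^+ j *+ N i j).

Section Cameras.
Variable K : fieldType.
Implicit Types (A B : 'M[K]_(3, 4)) (X Y : 'I_5 -> pspace K 3).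

Definition camera A : Prop := \rank A = 3%N.

(* The image of x as a subspace of K^3: a point of P^2, or 0 if the image of  *)
(* x is undefined.                                                            *)
Definition camera_image A (x : pspace K 3) : {vspace 'cV[K]_3} :=
  (linfun (mulmx A) @: x)%VS.

Definition center A (a : pspace K 3) : Prop := camera_image A a = 0%VS.

Definition image_equiv A B X Y : Prop :=
  [/\ forall i, ~ center A (X i), forall i, ~ center B (Y i) &
      exists H : 'M[K]_3, \det H = 1 /\
        forall i, camera_image A (X i) = camera_image (H *m B) (Y i)].

Definition secants X (a : pspace K 3) : Prop :=
  exists i j, X i <> X j /\ (a <= X i + X j)%VS.

Definition centers_locus X Y : multiproj K 2 3 -> Prop := fun p =>
  [/\ ~ secants X (p 0), ~ secants Y (p 1) &
      exists A B, [/\ camera A /\ center A (p 0), camera B /\ center B (p 1) &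
                      image_equiv A B X Y]].

Definition centers_variety X Y : multiproj K 2 3 -> Prop :=
  zariski_closure (centers_locus X Y).

(* The multidegrees of the duals of O(-1,0), O(0,-1), O(-1,-1).               *)
Definition summand_degrees (j : 'I_3) (l : 'I_2) : nat :=
  nth 0%N (nth [::] [:: [:: 1; 0]; [:: 0; 1]; [:: 1; 1]]%N j) l.

Definition std_vec (i : 'I_5) : 'cV[K]_4 :=
  \col_(k < 4) (if (i < 4)%N then (k == i :> nat)%:R else 1).

Lemma std_vec_neq0 (i : 'I_5) : std_vec i != 0.
Proof.
apply/eqP => /matrixP /(_ (inord i) 0) /eqP; rewrite !mxE.
case: ifP => [lti|_]; last by rewrite oner_eq0.
by rewrite inordK // eqxx oner_eq0.
Qed.

Definition std_points (i : 'I_5) : pspace K 3 := ppoint (std_vec_neq0 i).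

(* Row i is (a_i, b_i, a_i b_i).                                              *)
Definition std_matrix : 'M[{mpoly K[2 * 4]}]_(4, 3) :=
  \matrix_(i < 4, j < 3)
    let a : {mpoly K[2 * 4]} := 'X_(mxvec_index 0 i) in
    let b : {mpoly K[2 * 4]} := 'X_(mxvec_index 1 i) in
    nth 0 [:: a; b; a * b] j.

End Cameras.

(* Main.v *)
From HB Require Import structures.
Require Import Defs.
From mathcomp Require Import all_boot all_order all_algebra.
From mathcomp Require Import reals.
From mathcomp Require Import boolp separable.
From mathcomp Require Import complex mpoly.
From mathcomp Require Import ring.

(** Five general points are carried to the five standard points by a projective
transformation. Applying one to each factor reduces the statement about general
X and Y to the standard configuration; forms, closed sets, bundle maps, rational
maps and intersection numbers are transported along such a change of coordinates
([closed_preimage], [variety_transport], [intersection_transport]).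

For the standard points, cameras A and B with equal images satisfy
A e_i = c_i B e_i for i = 1, .., 5, after B is replaced by H B. Since e_5 is the
sum of the other e_i, the vector (c_i - c_5) lies in the kernel of B, so
c_i = x + y b_i with x = c_5, and A a = 0 gives (x + y b_i) a_i = z b_i. This is a
linear dependency between the columns a, b and (a_i b_i) of the standard matrix,
and conversely any such pair with x <> 0 and with a, b off the secants comes from
two cameras ([std_locus_relation], [moebius_std_locus]). Such pairs are called
Moebius pairs here.

The heart of the proof is that a polynomial vanishing on all Moebius pairs is in
the ideal of maximal minors, and that this ideal is prime ([moebius_prime]). The
minor of the rows 0, 1, k has the form a_k D_k - E_k, with D_k and E_k free of
a_2 and a_3; multiplication by a power of D_2 D_3 eliminates a_2 and a_3 modulo
the minors, and the remaining coordinates are algebraically independent on the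
Moebius pairs. It remains to see that D_2 and D_3 are nonzerodivisors modulo the
minors. As a_k D_k = a_0 a_1 (b_1 - b_0) b_k modulo the minors, this reduces to
the linear forms a_0, a_1, b_2, b_3 and b_1 - b_0. For a linear form p, the ring
modulo p is again a domain, in which two of the four minors stay coprime; the
syzygies of the minors modulo p are then generated by the columns of the matrix
([syzygy_minors]), hence lift, and p is a nonzerodivisor
([minor_ideal_nonzerodivisor]). The equality of the centers-variety and the
degeneracy locus, its ideal and its irreducibility follow.

Solving the dependency for a gives a_i = b_i / (c + b_i) up to a scalar, with
c = x / y, and c is a rational function of (a, b): this is the birational map to
P^4 with coordinates (b, c) ([degeneracy_birational]).

The multidegree is computed by counting points. With b fixed by three hyperplanes,
the points a form a twisted cubic, which a plane meets in 3 points
([intersection13]). With a and b on two lines, elimination of the parameter of b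
leaves a quintic for the parameter of a ([intersection22]). In both cases the
points correspond to the roots of one polynomial, whose discriminant is a form in
the hyperplanes, nonzero at an explicit example. The third number follows from the
symmetry between the two factors. *)

Set Implicit Arguments.
Unset Strict Implicit.
Unset Printing Implicit Defensive.

Import GRing.Theory.
Local Open Scope ring_scope.

(** * Polynomials as functions *)

Section Mpoly.
Variable K : numFieldType.

Lemma mpoly_ring_ind (n : nat) (P : {mpoly K[n]} -> Prop) :
  (forall c, P c%:MP) -> (forall i, P 'X_i) ->
  (forall p q, P p -> P q -> P (p + q)) ->
  (forall p q, P p -> P q -> P (p * q)) -> forall p, P p.
Proof.
move=> PC PX PD PM; elim/mpolyind => [|c m p _ _ Pp]; first exact: (PC 0).
apply: PD Pp; rewrite -mul_mpolyC; apply: (PM) => //; rewrite mpolyXE_id.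
elim/big_ind: _ => [|p1 p2 | i _]; [exact: (PC 1) | exact: PM |].
by elim: (m i) => [|k IHk]; rewrite ?expr0 ?exprS; [exact: (PC 1) | exact: PM].
Qed.

Lemma mpoly_last_var (n : nat) (p : {mpoly K[n.+1]}) :
  exists q : {poly {mpoly K[n]}},
    p = (map_poly (@mwiden n K) q).['X_ord_max].
Proof.
elim/mpoly_ring_ind: p => [c|i|p1 p2 [q1 ->] [q2 ->]|p1 p2 [q1 ->] [q2 ->]].
- by exists (c%:MP)%:P; rewrite map_polyC hornerC /= mwidenC.
- case: (unliftP ord_max i) => [j|] ->; last first.
    by exists 'X; rewrite map_polyX hornerX.
  exists ('X_j)%:P; rewrite map_polyC hornerC /= mwidenX mnmwiden1.
  by congr ('X_ _); apply: val_inj; rewrite /= /bump leqNgt ltn_ord.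
- by exists (q1 + q2); rewrite rmorphD hornerD.
- by exists (q1 * q2); rewrite rmorphM hornerM.
Qed.

Lemma mwiden_meval (n : nat) (p : {mpoly K[n]}) (v : 'I_n.+1 -> K) :
  (mwiden p).@[v] = p.@[fun i => v (widen_ord (leqnSn n) i)].
Proof.
elim/mpoly_ring_ind: p => [c|i|p q IHp IHq|p q IHp IHq].
- by rewrite mwidenC !mevalC.
- by rewrite mwidenX mnmwiden1 !mevalXU.
- by rewrite mwidenD !mevalD IHp IHq.
- by rewrite mwidenM !mevalM IHp IHq.
Qed.

Lemma poly_fun_eq0 (p : {poly K}) : (forall t, p.[t] = 0) -> p = 0.
Proof.
move=> p0; pose rs : seq K := [seq i%:R | i <- iota 0 (size p)].
apply: (@roots_geq_poly_eq0 _ p rs); last by rewrite size_map size_iota.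
  by apply/allP => t _; apply/eqP; apply: p0.
by rewrite map_inj_uniq ?iota_uniq // => i j /eqP; rewrite Num.Theory.eqr_nat => /eqP.
Qed.

(** Induction on the number of variables: the coefficients with respect to the
last variable vanish as functions, because a univariate polynomial over an
infinite field is determined by its values. *)
Lemma mpoly_fun_eq0 (n : nat) (p : {mpoly K[n]}) :
  (forall v, p.@[v] = 0) -> p = 0.
Proof.
elim: n p => [|n IHn] p p0.
  apply/mpolyP => m; rewrite mcoeff0 -(p0 (fun=> 0)) mevalE.
  have E (m' : 'X_{1..0}) : m' = m by apply/mnmP => -[].
  rewrite [in LHS](mpolyE p) raddf_sum /=; apply: eq_bigr => m' _.
  by rewrite mcoeffZ mcoeffX (E m') eqxx big_ord0.
have [q pE] := mpoly_last_var p.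
suff q0 : q = 0 by rewrite pE q0 rmorph0 horner0.
apply/polyP => k; rewrite coef0; apply: IHn => v.
suff q0 : map_poly (meval v) q = 0 by rewrite -coef_map q0 coef0.
apply: poly_fun_eq0 => t.
pose w (i : 'I_n.+1) := if unlift ord_max i is Some j then v j else t.
rewrite -(p0 w) pE -horner_map /= mevalXU.
have -> : w ord_max = t by rewrite /w unlift_none.
rewrite -map_poly_comp; congr (_.[t]); apply: eq_map_poly => r /=.
rewrite mwiden_meval; apply: meval_eq => i; rewrite /w.
have -> : widen_ord (leqnSn n) i = lift ord_max i.
  by apply: val_inj; rewrite /= /bump leqNgt ltn_ord.
by rewrite liftK.
Qed.

(** Equalities of polynomials may be checked off a hypersurface: multiply by its
equation. *)
Lemma mpoly_dense_eq0 (n : nat) (w p : {mpoly K[n]}) :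
  w != 0 -> (forall v, w.@[v] != 0 -> p.@[v] = 0) -> p = 0.
Proof.
move=> w0 p0; have : w * p = 0.
  apply: mpoly_fun_eq0 => v; rewrite mevalM.
  by have [->|/p0 ->] := eqVneq w.@[v] 0; rewrite ?mul0r ?mulr0.
by move/eqP; rewrite mulf_eq0 (negPf w0) => /eqP.
Qed.

Lemma meval_neq0 (n : nat) (w : {mpoly K[n]}) v : w.@[v] != 0 -> w != 0.
Proof. by apply: contra_neq => ->; rewrite meval0. Qed.

End Mpoly.

(** * Points and their homogeneous coordinates *)

Section Points.
Variables (K : fieldType) (n : nat).

Lemma eq_vlineP (u v : 'cV[K]_n.+1) :
  v != 0 -> <[u]>%VS = <[v]>%VS -> exists2 c, c != 0 & u = c *: v.
Proof.
move=> v0 uv; have /vlineP [c uE] : u \in <[v]>%VS by rewrite -uv memv_line.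
exists c => //; apply: contra_neq v0 => c0; apply/eqP.
by rewrite -memv0 -[0%VS]/(<[0]>%VS) -(scale0r v) -c0 -uE uv memv_line.
Qed.

Lemma pspace_line (x : pspace K n) :
  vpick x != 0 /\ x = <[vpick x]>%VS :> {vspace _}.
Proof.
have v0 : vpick x != 0.
  by rewrite vpick0; case: x => /= U; rewrite -dimv_eq0 => /eqP ->.
split=> //; apply/esym/eqP; rewrite eqEdim.
rewrite [X in X && _](_ : _ = true); last exact: memv_pick.
by rewrite dim_vline v0; case: {v0} x => /= U /eqP ->.
Qed.

Lemma pspace_inj (x y : pspace K n) : x = y :> {vspace _} -> x = y.
Proof. exact: val_inj. Qed.

Lemma pline_neq0 (x : pspace K n) (v : 'cV[K]_n.+1) :
  x = <[v]>%VS :> {vspace _} -> v != 0.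
Proof.
case: x => /= U /eqP dU UE; move: dU; rewrite UE dim_vline.
by case: (v != 0).
Qed.

End Points.

Lemma mxvec_index_eq (m n : nat) (i k : 'I_m) (j l : 'I_n) :
  (mxvec_index i j == mxvec_index k l) = (i == k) && (j == l).
Proof. by rewrite /mxvec_index (inj_eq (@cast_ord_inj _ _ _)) (inj_eq enum_rank_inj). Qed.

Section Coordinates.
Variables (K : fieldType) (m n : nat).
Implicit Types (p q : multiproj K m n) (r s : 'I_m -> 'cV[K]_n.+1).

Lemma hcoords_exist p : exists r, hcoords r p.
Proof. by exists (fun i => vpick (p i)) => i; case: (pspace_line (p i)). Qed.

Lemma hcoords_neq0 r p i : hcoords r p -> r i != 0.
Proof. by move=> /(_ i); apply: pline_neq0. Qed.

Lemma hcoords_inj r p q : hcoords r p -> hcoords r q -> p = q.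
Proof.
by move=> rp rq; apply/ffunP => i; apply: pspace_inj; rewrite rp rq.
Qed.

Definition mpoint r (r0 : forall i, r i != 0) : multiproj K m n :=
  [ffun i => ppoint (r0 i)].

Lemma hcoords_mpoint r (r0 : forall i, r i != 0) : hcoords r (mpoint r0).
Proof. by move=> i; rewrite ffunE. Qed.

Lemma hcoords_scale r p (c : 'I_m -> K) :
  (forall i, c i != 0) -> hcoords r p -> hcoords (fun i => c i *: r i) p.
Proof.
move=> c0 rp i; rewrite rp; apply/eqP; rewrite eqEsubv -!memvE.
rewrite memvZ ?memv_line // andbT; apply/vlineP; exists (c i)^-1.
by rewrite scalerA mulVf ?scale1r.
Qed.

Lemma hcoords_unique r s p : hcoords r p -> hcoords s p ->
  exists c : 'I_m -> K, forall i, c i != 0 /\ s i = c i *: r i.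
Proof.
move=> rp sp; have H i : {c | (c != 0) && (s i == c *: r i)}.
  apply: sigW; case: (@eq_vlineP _ _ (s i) (r i)).
  - exact: hcoords_neq0 rp.
  - by rewrite -sp -rp.
  by move=> c c0 ->; exists c; rewrite c0 eqxx.
by exists (fun i => sval (H i)) => i; case: (H i) => c /= /andP [c0 /eqP].
Qed.

Lemma evalvecE r i j : evalvec r (mxvec_index i j) = r i j 0.
Proof. by rewrite /evalvec mxvecE mxE. Qed.

Lemma eq_evalvec r s : (forall i, r i = s i) -> evalvec r =1 evalvec s.
Proof. by move=> rs k; case/mxvec_indexP: k => i j; rewrite !evalvecE rs. Qed.

End Coordinates.

(** * Multihomogeneous polynomials *)

Section Multihomogeneous.
Variables (K : fieldType) (m n : nat).
Implicit Types (d e : 'I_m -> nat) (f g : {mpoly K[m * n.+1]}).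

Lemma multihomog_ext d e f : d =1 e -> multihomog d f -> multihomog e f.
Proof. by move=> de df mon /df dm i; rewrite dm de. Qed.

Lemma multihomog0 d : multihomog d (0 : {mpoly K[m * n.+1]}).
Proof. by move=> mon; rewrite msupp0. Qed.

Lemma multihomogC c : multihomog (fun=> 0%N) (c%:MP : {mpoly K[m * n.+1]}).
Proof.
move=> mon; rewrite msuppC; case: eqP => //= _; rewrite inE => /eqP -> i.
by apply: big1 => j _; rewrite mnm0E.
Qed.

Lemma multihomogX i j :
  multihomog (fun l => l == i : nat) ('X_(mxvec_index i j) : {mpoly K[m * n.+1]}).
Proof.
move=> mon; rewrite msuppX inE => /eqP -> l.
under eq_bigr => j' _ do rewrite mnm1E.
under eq_bigr => j' _ do rewrite mxvec_index_eq.
have [_|_] := eqVneq l i; last by rewrite big1.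
rewrite (bigD1 j) //= eqxx big1 // => j' /negPf.
by rewrite eq_sym => ->.
Qed.

Lemma multihomogD d f g :
  multihomog d f -> multihomog d g -> multihomog d (f + g).
Proof. by move=> df dg mon /msuppD_le; rewrite mem_cat => /orP [/df|/dg]. Qed.

Lemma multihomogN d f : multihomog d f -> multihomog d (- f).
Proof. by move=> df mon; rewrite (perm_mem (msuppN f)) => /df. Qed.

Lemma multihomogB d f g :
  multihomog d f -> multihomog d g -> multihomog d (f - g).
Proof. by move=> df /multihomogN; apply: multihomogD. Qed.

Lemma multihomogM d e f g : multihomog d f -> multihomog e g ->
  multihomog (fun l => d l + e l)%N (f * g).
Proof.
move=> df eg mon /msuppM_le /allpairsP [[m1 m2] /= [/df d1 /eg e2 ->]] i.
by rewrite -d1 -e2 -big_split; apply: eq_bigr => j _; rewrite mnmDE.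
Qed.

Lemma multihomog_sum (I : Type) (s : seq I) (P : pred I) d F :
  (forall i, P i -> multihomog d (F i)) ->
  multihomog d (\sum_(i <- s | P i) F i : {mpoly K[m * n.+1]}).
Proof.
by move=> dF; elim/big_ind: _ => //; [exact: multihomog0 | exact: multihomogD].
Qed.

Lemma multihomogMn d f k : multihomog d f -> multihomog d (f *+ k).
Proof.
move=> df; elim: k => [|k IHk]; first exact: multihomog0.
by rewrite mulrS; apply: multihomogD.
Qed.

Lemma multihomog_sign d f k : multihomog d f -> multihomog d ((-1) ^+ k * f).
Proof.
by rewrite -signr_odd; case: odd => df; rewrite ?mul1r ?mulN1r //; exact: multihomogN.
Qed.

Lemma multihomog_prod (N : nat) (D : 'I_N -> 'I_m -> nat) F :
  (forall i, multihomog (D i) (F i)) ->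
  multihomog (fun l => \sum_i D i l)%N (\prod_i F i : {mpoly K[m * n.+1]}).
Proof.
elim: N D F => [|N IHN] D F dF.
  apply: (@multihomog_ext (fun=> 0%N)) => [l|]; first by rewrite big_ord0.
  by rewrite big_ord0; apply: multihomogC.
rewrite big_ord_recl.
apply: (multihomog_ext _ (multihomogM (dF ord0) (IHN _ _ (fun i => dF (lift ord0 i))))).
by move=> l; rewrite big_ord_recl.
Qed.

Lemma multihomog_det (N : nat) (D : 'I_N -> 'I_m -> nat)
    (M : 'M[{mpoly K[m * n.+1]}]_N) :
  (forall i j, multihomog (D i) (M i j)) ->
  multihomog (fun l => \sum_i D i l)%N (\det M).
Proof.
move=> dM; apply: multihomog_sum => s _; apply: multihomog_sign.
by apply: multihomog_prod => i; apply: dM.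
Qed.

Lemma multihomog_scale d f (c : 'I_m -> K) r : multihomog d f ->
  f.@[evalvec (fun i => c i *: r i)] = (\prod_i c i ^+ d i) * f.@[evalvec r].
Proof.
move=> df; rewrite !mevalE mulr_sumr [LHS]big_seq [RHS]big_seq; apply: eq_bigr => mon /df dmon.
rewrite mulrCA; congr (_ * _).
have R F : \prod_(k < m * n.+1) F k = \prod_i \prod_j F (mxvec_index i j) :> K.
  rewrite pair_bigA (reindex _ (@curry_mxvec_bij m n.+1)) /=.
  by apply: eq_bigr => -[].
rewrite !R -big_split; apply: eq_bigr => i _ /=.
under eq_bigr => j _ do rewrite evalvecE mxE exprMn -(evalvecE r).
by rewrite big_split /= -expr_sum dmon.
Qed.

(** Changing the homogeneous coordinates of a point multiplies the value of a
form by a nonzero constant. *)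
Lemma multihomog_vanish d f r s p : multihomog d f -> hcoords r p ->
  hcoords s p -> f.@[evalvec r] = 0 -> f.@[evalvec s] = 0.
Proof.
move=> df rp sp fr; have [c cE] := hcoords_unique rp sp.
rewrite (meval_eq _ (eq_evalvec (fun i => (cE i).2))).
by rewrite (multihomog_scale _ _ df) fr mulr0.
Qed.

End Multihomogeneous.

(** * Closed sets and generic properties *)

Section Zariski.
Variables (K : numFieldType) (m n : nat).
Implicit Types (p q : multiproj K m n) (w : {mpoly K[m * n.+1]}).

Definition nonvanishing w p := exists2 r, hcoords r p & w.@[evalvec r] != 0.

Lemma nonvanishing_open w d : multihomog d w -> zariski_open (nonvanishing w).
Proof.
move=> dw; exists (fun f => f = w); split=> [f ->|p]; first by exists d.
split=> [nw f -> r rp|w0 [r rp]]; last by rewrite (w0 w erefl r rp) eqxx.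
by apply/eqP; apply/negP => /negP wr; apply: nw; exists r.
Qed.

(** Generic statements are proved on the complement of one hypersurface, which
is nonempty as soon as its equation is nonzero at one system of coordinates. *)
Lemma generic_nonvanishing w d (P : multiproj K m n -> Prop) r :
  multihomog d w -> (forall i, r i != 0) -> w.@[evalvec r] != 0 ->
  (forall p r, hcoords r p -> w.@[evalvec r] != 0 -> P p) -> generically P.
Proof.
move=> dw r0 wr wP; exists (nonvanishing w); split; first exact: nonvanishing_open dw.
split; first by exists (mpoint r0), r => //; apply: hcoords_mpoint.
by move=> p [s sp ws]; apply: wP ws.
Qed.

Lemma closureS (S : multiproj K m n -> Prop) p : S p -> zariski_closure S p.
Proof. by move=> Sp Z _; apply. Qed.

End Zariski.

(** * Projective transformations of a product of projective spaces *)

Section ProjectiveMap.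
Variables (K : fieldType) (n : nat).
Implicit Types (G H : 'M[K]_n.+1) (x : pspace K n).

(** The default value x of insubd is taken only for a singular G. *)
Definition pmap G x : pspace K n := insubd x (linfun (mulmx G) @: x)%VS.

Lemma lin_image_line (k : nat) (A : 'M[K]_(k, n.+1)) (v : 'cV[K]_n.+1) :
  (linfun (mulmx A) @: <[v]>)%VS = <[A *m v]>%VS.
Proof. by rewrite limg_line lfunE. Qed.

Lemma unitmx_mulmx_neq0 G (v : 'cV[K]_n.+1) : G \in unitmx -> v != 0 -> G *m v != 0.
Proof.
move=> uG; apply: contra_neq => Gv; by rewrite -(mulKmx uG v) Gv mulmx0.
Qed.

Lemma pmapE G x : G \in unitmx -> pmap G x = (linfun (mulmx G) @: x)%VS :> {vspace _}.
Proof.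
move=> uG; rewrite [LHS](@insubdK _ _ (pspace K n)) // -topredE /=.
have [v0 ->] := pspace_line x.
by rewrite lin_image_line dim_vline unitmx_mulmx_neq0.
Qed.

Lemma pmap_line G x v : G \in unitmx -> x = <[v]>%VS :> {vspace _} ->
  pmap G x = <[G *m v]>%VS :> {vspace _}.
Proof. by move=> uG xE; rewrite pmapE // xE lin_image_line. Qed.

Lemma pmapM G H x : G \in unitmx -> H \in unitmx -> pmap G (pmap H x) = pmap (G *m H) x.
Proof.
move=> uG uH; have [_ xE] := pspace_line x; apply: pspace_inj.
rewrite (pmap_line uG (pmap_line uH xE)) (pmap_line _ xE) ?mulmxA //.
by rewrite unitmx_mul uG.
Qed.

Lemma pmap1 x : pmap 1%:M x = x.
Proof.
have [_ xE] := pspace_line x; apply: pspace_inj.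
by rewrite (pmap_line _ xE) ?unitmx1 // mul1mx -xE.
Qed.

Lemma pmapK G x : G \in unitmx -> pmap (invmx G) (pmap G x) = x.
Proof. by move=> uG; rewrite pmapM ?unitmx_inv // mulVmx // pmap1. Qed.

Lemma pmapVK G x : G \in unitmx -> pmap G (pmap (invmx G) x) = x.
Proof. by move=> uG; rewrite pmapM ?unitmx_inv // mulmxV // pmap1. Qed.

End ProjectiveMap.

Section Transport.
Variables (K : fieldType) (m m' n : nat).
Variables (sigma : 'I_m' -> 'I_m) (G : 'I_m' -> 'M[K]_n.+1).
Hypothesis uG : forall i, G i \in unitmx.

Definition transport (p : multiproj K m n) : multiproj K m' n :=
  [ffun i => pmap (G i) (p (sigma i))].

Lemma transport_coords r p : hcoords r p ->
  hcoords (fun i => G i *m r (sigma i)) (transport p).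
Proof. by move=> rp i; rewrite ffunE; apply: pmap_line. Qed.

Definition linear_form i j : {mpoly K[m * n.+1]} :=
  \sum_l G i j l *: 'X_(mxvec_index (sigma i) l).

(** Composition with the transport, on coordinate rings. *)
Definition pullback (f : {mpoly K[m' * n.+1]}) : {mpoly K[m * n.+1]} :=
  f \mPo [tuple mxvec (\matrix_(i, j) linear_form i j) 0 k | k < m' * n.+1].

Lemma pullback_eval f r :
  (pullback f).@[evalvec r] = f.@[evalvec (fun i => G i *m r (sigma i))].
Proof.
rewrite comp_mpoly_meval; apply: meval_eq => k; rewrite tnth_mktuple.
case/mxvec_indexP: k => i j; rewrite mxvecE evalvecE !mxE raddf_sum /=.
by apply: eq_bigr => l _; rewrite mevalZ mevalXU evalvecE.
Qed.

Lemma multihomog_linear_form i j :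
  multihomog (fun l => l == sigma i : nat) (linear_form i j).
Proof.
apply: multihomog_sum => l _; rewrite -mul_mpolyC.
apply: (multihomog_ext _ (multihomogM (@multihomogC K m n _) (@multihomogX K m n _ _))).
by move=> k; rewrite add0n.
Qed.

Lemma multihomog_exp (d : 'I_m -> nat) (f : {mpoly K[m * n.+1]}) k :
  multihomog d f -> multihomog (fun l => k * d l)%N (f ^+ k).
Proof.
move=> df; elim: k => [|k IHk]; first exact: multihomogC.
by rewrite exprS; apply: multihomog_ext (multihomogM df IHk) => l; rewrite mulSn.
Qed.

Lemma multihomog_pullback d f : multihomog d f ->
  multihomog (fun l => \sum_i d i * (l == sigma i))%N (pullback f).
Proof.
move=> df; rewrite /pullback comp_mpolyEX big_seq; apply: multihomog_sum => mon mf.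
rewrite comp_mpolyX -mul_mpolyC.
pose D (k : 'I_(m' * n.+1)) l :=
  (mon k * mxvec (\matrix_(i < m', j < n.+1) (l == sigma i : nat)) 0%R k)%N.
apply: (multihomog_ext _ (multihomogM (@multihomogC K m n _) (@multihomog_prod _ _ _ _ D _ _))).
  move=> l; rewrite add0n.
  transitivity (\sum_i \sum_j D (mxvec_index i j) l)%N.
    rewrite pair_bigA (reindex _ (@curry_mxvec_bij m' n.+1)) /=.
    by apply: eq_bigr => -[].
  apply: eq_bigr => i _; under eq_bigr => j _ do rewrite /D mxvecE mxE.
  by rewrite -big_distrl /= df.
move=> k; rewrite tnth_mktuple.
apply: (@multihomog_ext _ _ _ (fun l =>
  mon k * mxvec (\matrix_(i < m', j < n.+1) (l == sigma i : nat)) 0%R k)%N) => //.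
apply: (@multihomog_exp (fun l => mxvec (\matrix_(i < m', j < n.+1) (l == sigma i : nat)) 0%R k)).
case/mxvec_indexP: k => i j; rewrite mxvecE mxE.
by apply: (multihomog_ext _ (@multihomog_linear_form i j)) => l; rewrite mxvecE mxE.
Qed.

Lemma pullback_vanish d f p : multihomog d f ->
  vanishes_at (pullback f) p <-> vanishes_at f (transport p).
Proof.
move=> df; split=> [V s sp|V r rp]; last first.
  by rewrite pullback_eval; apply: V; apply: transport_coords.
have [r rp] := hcoords_exist p.
apply: (multihomog_vanish df (transport_coords rp) sp).
by rewrite -pullback_eval; apply: V.
Qed.

Lemma closed_preimage (Z : multiproj K m' n -> Prop) :
  zariski_closed Z -> zariski_closed (fun p => Z (transport p)).
Proof.
move=> [F [dF ZF]]; exists (fun g => exists2 f, F f & g = pullback f); split.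
  by move=> g [f /dF [d df] ->]; eexists; apply: multihomog_pullback df.
move=> p; rewrite ZF; split=> [V g [f Ff ->]|V f Ff].
  by have [d df] := dF f Ff; apply/(pullback_vanish _ df)/V.
by have [d df] := dF f Ff; apply/(pullback_vanish _ df)/V; exists f.
Qed.

Lemma generically_preimage (P : multiproj K m' n -> Prop) :
  (forall q, exists p, transport p = q) ->
  generically P -> generically (fun p => P (transport p)).
Proof.
move=> surj [U [openU [[q Uq] UP]]]; exists (fun p => U (transport p)); split.
  exact: closed_preimage openU.
split; last by move=> p /UP.
by have [p pq] := surj q; exists p; rewrite pq.
Qed.

End Transport.

Lemma transportK (K : fieldType) (m m' n : nat)
    (s : 'I_m' -> 'I_m) (s' : 'I_m -> 'I_m') (G : 'I_m' -> 'M[K]_n.+1) p :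
  (forall i, G i \in unitmx) -> cancel s' s ->
  transport s' (fun i => invmx (G (s' i))) (transport s G p) = p.
Proof. by move=> uG ss; apply/ffunP => i; rewrite !ffunE ss pmapK. Qed.

Lemma transportVK (K : fieldType) (m m' n : nat)
    (s : 'I_m' -> 'I_m) (s' : 'I_m -> 'I_m') (G : 'I_m' -> 'M[K]_n.+1) q :
  (forall i, G i \in unitmx) -> cancel s s' ->
  transport s G (transport s' (fun i => invmx (G (s' i))) q) = q.
Proof. by move=> uG ss; apply/ffunP => i; rewrite !ffunE ss pmapVK. Qed.

(** * Syzygies of maximal minors *)

Section Syzygies.
Variables (R : idomainType) (t : nat).
Implicit Types (M : 'M[R]_(t.+1, t)) (g w : 'cV[R]_t.+1).

(** The Laplace expansion of the determinant of (w | M) along w; a syzygy of the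
signed maximal minors is a zero w of this linear form. *)
Definition laplace M w : R := \sum_k w k 0 * ((-1) ^+ k * \det (row' k M)).

Lemma laplace_det M w : laplace M w = \det (row_mx w M : 'M_(1 + t)).
Proof.
rewrite (expand_det_col _ (lshift t 0)); apply: eq_bigr => k _.
rewrite (@row_mxEl _ t.+1 1 t); congr (_ * _); rewrite /cofactor /= addn0.
congr (_ * \det _); apply/matrixP => i j; rewrite !mxE.
case: splitP => [j' /= E|j' /= E].
  by move: (ltn_ord j'); rewrite -E.
by congr (M _ _); apply: val_inj; move: E => /= [].
Qed.

Lemma laplaceZD M (c : R) w1 w2 :
  laplace M (c *: w1 + w2) = c * laplace M w1 + laplace M w2.
Proof.
rewrite /laplace mulr_sumr -big_split; apply: eq_bigr => k _ /=.
by rewrite !mxE; ring.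
Qed.

(** A column of M repeated in front of M gives a zero determinant. *)
Lemma laplace_mul M (h : 'cV_t) : laplace M (M *m h) = 0.
Proof.
rewrite (_ : laplace M (M *m h) = \sum_j h j 0 * laplace M (col j M)).
  apply: big1 => j _; rewrite laplace_det -det_tr.
  rewrite (@determinant_alternate _ _ _ (lshift t 0) (rshift 1 j)) ?mulr0 //.
  by move=> k; rewrite !mxE (unsplitK (inl _)) (unsplitK (inr _)) mxE.
rewrite /laplace; under [RHS]eq_bigr => j _ do rewrite mulr_sumr.
rewrite exchange_big /=; apply: eq_bigr => k _; rewrite mxE mulr_suml.
by apply: eq_bigr => j _; rewrite !mxE; ring.
Qed.

Lemma minor_inj M (h : 'cV_t) i :
  \det (row' i M) != 0 -> M *m h = 0 -> h = 0.
Proof.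
move=> d0 Mh; have : \adj (row' i M) *m row' i (M *m h) = \det (row' i M) *: h.
  by rewrite !row'Esub -mul_rowsub_mx mulmxA mul_adj_mx mul_scalar_mx.
rewrite Mh !row'Esub (_ : rowsub _ 0 = 0) ?mulmx0; last first.
  by apply/matrixP => ? ?; rewrite !mxE.
by move/esym/eqP; rewrite scalemx_eq0 (negPf d0) => /eqP.
Qed.

(** Cramer's rule solves the system after multiplication by a nonzero minor;
the equation of the deleted row follows from the syzygy. *)
Lemma cramer_syzygy M g i : laplace M g = 0 -> \det (row' i M) != 0 ->
  M *m (\adj (row' i M) *m row' i g) = \det (row' i M) *: g.
Proof.
move=> gM d0; apply/eqP; rewrite -subr_eq0; set w := _ - _.
have wi k : k != i -> w k 0 = 0.
  rewrite eq_sym => /unlift_some [j -> _].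
  have : row' i w = 0.
    rewrite /w !row'Esub linearB linearZ /= -mul_rowsub_mx mulmxA mul_mx_adj.
    by rewrite mul_scalar_mx subrr.
  by move/matrixP/(_ j 0); rewrite !mxE.
have : laplace M w = 0.
  rewrite /w addrC -scaleNr laplaceZD gM laplace_mul mulr0 addr0 //.
rewrite /laplace (bigD1 i) //= big1 => [|k ki]; last by rewrite wi ?mul0r.
move/eqP; rewrite addr0 !mulf_eq0 signr_eq0 (negPf d0) !orbF => /eqP wi0.
by apply/eqP/colP => k; rewrite [RHS]mxE; have [->|/wi] := eqVneq k i.
Qed.

(** Coprimality in the form used for cancellation: b is a nonzerodivisor modulo a. *)
Definition coprime_to (a b : R) : Prop :=
  forall h q, b * h = a * q -> exists q', h = a * q'.

(** The Cramer solutions M h_i = m_i g and M h_j = m_j g, for two minors m_i and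
m_j, satisfy m_j h_i = m_i h_j because M is injective. As m_i and m_j are
coprime, m_i divides h_i, and the quotient solves M h = g. This is the
exactness in the middle of the Hilbert-Burch complex. *)
Lemma syzygy_minors M g i j : laplace M g = 0 ->
  \det (row' i M) != 0 -> \det (row' j M) != 0 ->
  coprime_to (\det (row' i M)) (\det (row' j M)) ->
  exists h : 'cV_t, g = M *m h.
Proof.
move=> gM di dj cop.
have hi := cramer_syzygy gM di; have hj := cramer_syzygy gM dj.
move: hi hj; set hi := _ *m row' i g; set hj := _ *m row' j g => Ei Ej.
have hij : \det (row' j M) *: hi = \det (row' i M) *: hj.
  apply/eqP; rewrite -subr_eq0; apply/eqP; apply: (minor_inj di).
  by rewrite mulmxBr -!scalemxAr Ei Ej !scalerA mulrC subrr.
have hi_div k : exists q, hi k 0 = \det (row' i M) * q.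
  by apply: (cop _ (hj k 0)); move/matrixP: hij => /(_ k 0); rewrite !mxE.
have [q qE] := fin_all_exists hi_div.
exists (\col_k q k); apply/eqP; rewrite -subr_eq0.
have : \det (row' i M) *: (g - M *m \col_k q k) = 0.
  rewrite scalerBr -Ei scalemxAr [X in _ - M *m X](_ : _ = hi) ?subrr //.
  by apply/colP => k; rewrite qE [LHS]mxE mxE.
by move/eqP; rewrite scalemx_eq0 (negPf di).
Qed.

(** If the ring modulo the prime p is the image of an idempotent endomorphism
phi, then a relation p f = sum of g_k m_k becomes a syzygy modulo p, which
lifts to a syzygy of the m_k that can be subtracted from g. *)
Lemma minor_ideal_nonzerodivisor M (phi : {rmorphism R -> R}) (p f : R) i j :
  p != 0 -> phi p = 0 -> (forall r, phi (phi r) = phi r) ->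
  (forall r, phi r = 0 -> exists q, r = p * q) ->
  \det (row' i (map_mx phi M)) != 0 -> \det (row' j (map_mx phi M)) != 0 ->
  coprime_to (\det (row' i (map_mx phi M))) (\det (row' j (map_mx phi M))) ->
  maximal_minor_ideal M (p * f) -> maximal_minor_ideal M f.
Proof.
move=> p0 phip phiK phi_div di dj cop [g pfE].
pose G : 'cV[R]_t.+1 := \col_k ((-1) ^+ k * g k).
have lapE : laplace M G = p * f.
  rewrite pfE; apply: eq_bigr => k _; rewrite mxE.
  by rewrite -[RHS]mul1r -(signrMK k (g k * _)) -signr_odd; case: odd; ring.
have gM : laplace (map_mx phi M) (map_mx phi G) = 0.
  have <- : phi (laplace M G) = 0 by rewrite lapE rmorphM phip mul0r.
  rewrite rmorph_sum; apply: eq_bigr => k _; rewrite !rmorphM rmorph_sign mxE.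
  by rewrite -det_map_mx; congr (_ * (_ * \det _)); apply/matrixP => ? ?; rewrite !mxE.
have [h hE] := syzygy_minors gM di dj cop.
have G_div k : exists q, (G - M *m h) k 0 = p * q.
  apply: phi_div.
  have /matrixP/(_ k 0) : map_mx phi (G - M *m h) = 0.
    rewrite map_mxB map_mxM -[map_mx phi G](_ : map_mx phi (map_mx phi G) = _).
      by rewrite hE map_mxM -map_mx_comp (eq_map_mx _ phiK) subrr.
    by apply/matrixP => ? ?; rewrite !mxE phiK.
  by rewrite !mxE.
have [q qE] := fin_all_exists G_div.
exists (fun k => q k * (-1) ^+ k); apply: (mulfI p0).
have GE : G = p *: (\col_k q k) + M *m h.
  by apply/eqP; rewrite -subr_eq; apply/eqP/colP => k; rewrite qE !mxE.
rewrite -lapE GE laplaceZD laplace_mul addr0; congr (p * _).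
by apply: eq_bigr => k _; rewrite mxE mulrA.
Qed.
End Syzygies.

(** * Matrices with rows (a_i, b_i, a_i b_i) *)

Notation o0 := (@Ordinal 4 0 isT).
Notation o1 := (@Ordinal 4 1 isT).
Notation o2 := (@Ordinal 4 2 isT).
Notation o3 := (@Ordinal 4 3 isT).

Section TripleMatrix.
Variables (R : comNzRingType).
Implicit Types a b : 'I_4 -> R.

Definition triple_matrix a b : 'M[R]_(4, 3) :=
  \matrix_(i < 4, j < 3) nth 0 [:: a i; b i; a i * b i] j.

Definition triple_minor a b i j k : R :=
  a i * (b j * (a k * b k) - b k * (a j * b j))
  - b i * (a j * (a k * b k) - a k * (a j * b j))
  + a i * b i * (a j * b k - a k * b j).

Lemma det_mx33 (A : 'M[R]_3) (i := @Ordinal 3 0 isT) (j := @Ordinal 3 1 isT)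
    (k := @Ordinal 3 2 isT) :
  \det A = A i i * (A j j * A k k - A j k * A k j)
         - A i j * (A j i * A k k - A j k * A k i)
         + A i k * (A j i * A k j - A j j * A k i).
Proof.
(* Indexing by natural numbers lets the lifted ordinals compute. *)
pose F p q := A (inord p) (inord q).
have AE p q : A p q = F p q by rewrite /F !inord_val.
rewrite (expand_det_row _ i) !big_ord_recl big_ord0 /cofactor.
rewrite !(expand_det_row _ ord0) !big_ord_recl !big_ord0 /cofactor !det_mx11 !mxE.
by rewrite !AE /= /bump /=; ring.
Qed.

Lemma det_triple_minor a b k :
  \det (row' k (triple_matrix a b)) =
  triple_minor a b (lift k (@Ordinal 3 0 isT)) (lift k (@Ordinal 3 1 isT))
    (lift k (@Ordinal 3 2 isT)).
Proof. by rewrite det_mx33 !mxE /triple_minor /=; ring. Qed.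

Lemma triple_minorE a b :
  [/\ \det (row' o0 (triple_matrix a b)) = triple_minor a b o1 o2 o3,
      \det (row' o1 (triple_matrix a b)) = triple_minor a b o0 o2 o3,
      \det (row' o2 (triple_matrix a b)) = triple_minor a b o0 o1 o3 &
      \det (row' o3 (triple_matrix a b)) = triple_minor a b o0 o1 o2].
Proof.
by split; rewrite det_triple_minor; congr triple_minor; apply: val_inj.
Qed.

End TripleMatrix.

Lemma map_triple_matrix (R S : comNzRingType) (phi : {rmorphism R -> S}) a b :
  map_mx phi (triple_matrix a b) = triple_matrix (phi \o a) (phi \o b).
Proof.
by apply/matrixP => i [[|[|[|//]]] ?]; rewrite !mxE //= rmorphM.
Qed.

(** * Linear prime elements of a polynomial ring *)

Section Substitution.
Variables (K : numFieldType) (N : nat).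
Implicit Types (f g c : {mpoly K[N]}) (l : 'I_N).

(** Reduction modulo the linear form X_l - c, as an endomorphism; it is
idempotent when c does not involve X_l. *)
Definition msubst l c f : {mpoly K[N]} :=
  f \mPo [tuple if i == l then c else 'X_i | i < N].

HB.instance Definition _ l c := GRing.RMorphism.copy (msubst l c) (msubst l c).

Lemma msubstX l c i : msubst l c 'X_i = if i == l then c else 'X_i.
Proof. by rewrite /msubst comp_mpolyXU -tnth_nth tnth_mktuple. Qed.

Lemma msubst_meval l c f v :
  (msubst l c f).@[v] = f.@[fun i => if i == l then c.@[v] else v i].
Proof.
rewrite /msubst comp_mpoly_meval; apply: meval_eq => i.
by rewrite tnth_mktuple; case: ifP; rewrite ?mevalXU.
Qed.

Lemma msubst_mod l c f : exists q, f = ('X_l - c) * q + msubst l c f.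
Proof.
elim/mpoly_ring_ind: f => [a|i|f g [q fE] [r gE]|f g [q fE] [r gE]].
- by exists 0; rewrite mulr0 add0r /msubst comp_mpolyC.
- rewrite msubstX; case: eqP => [->|_]; last by exists 0; rewrite mulr0 add0r.
  by exists 1; ring.
- by exists (q + r); rewrite rmorphD {1}fE {1}gE; ring.
- exists (q * g + msubst l c f * r); rewrite rmorphM.
  have fE' : f - msubst l c f = ('X_l - c) * q by rewrite {1}fE addrK.
  have gE' : g - msubst l c g = ('X_l - c) * r by rewrite {1}gE addrK.
  rewrite mulrDr mulrA -fE' mulrCA -gE' /=; ring.
Qed.

Lemma msubst_div l c f : msubst l c f = 0 -> exists q, f = ('X_l - c) * q.
Proof. by have [q fE] := msubst_mod l c f => f0; exists q; rewrite {1}fE f0 addr0. Qed.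

Lemma msubst_idem l c f : msubst l c c = c -> msubst l c (msubst l c f) = msubst l c f.
Proof.
move=> cc; elim/mpoly_ring_ind: f => [a|i|f g fE gE|f g fE gE].
- by rewrite /msubst !comp_mpolyC.
- by rewrite msubstX; case: eqP => [//|/eqP/negPf il]; rewrite msubstX il.
- by rewrite !rmorphD /= fE gE.
- by rewrite !rmorphM /= fE gE.
Qed.

End Substitution.

Section Coprime.
Variables (K : numFieldType) (N : nat).
Implicit Types (f g c b : {mpoly K[N]}) (l : 'I_N).

Lemma coprime_toM (a1 a2 b : {mpoly K[N]}) : a1 != 0 ->
  coprime_to a1 b -> coprime_to a2 b -> coprime_to (a1 * a2) b.
Proof.
move=> a0 c1 c2 h q; rewrite -mulrA => E; have [h1 h1E] := c1 _ _ E.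
have [|h2 h2E] := c2 h1 q; last by exists h2; rewrite h1E h2E mulrA.
by apply: (mulfI a0); rewrite -E h1E; ring.
Qed.

Lemma coprime_to_opp (a b : {mpoly K[N]}) : coprime_to a b -> coprime_to (- a) b.
Proof.
by move=> ab h q; rewrite mulNr -mulrN => /ab [r ->]; exists (- r); rewrite mulrNN.
Qed.

(** A linear form X_l - c is prime, and does not divide b when b has a nonzero
value at a point of the hyperplane X_l = c. *)
Lemma coprime_to_linear l c b v : msubst l c c = c -> v l = c.@[v] ->
  b.@[v] != 0 -> coprime_to ('X_l - c) b.
Proof.
move=> cc vl bv h q E; apply: msubst_div; move/(congr1 (msubst l c)): E.
rewrite !rmorphM rmorphB /= msubstX eqxx cc subrr mul0r => /eqP.
rewrite mulf_eq0 => /orP [/eqP b0|/eqP //]; case/eqP: bv.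
rewrite -[RHS](meval0 v) -b0 msubst_meval; apply: meval_eq => i.
by case: eqP => [->|].
Qed.

End Coprime.

(** * Nonzerodivisors modulo the minors of the standard matrix *)

Lemma map_triple_minor (R S : comNzRingType) (phi : {rmorphism R -> S}) a b i j k :
  phi (triple_minor a b i j k) = triple_minor (phi \o a) (phi \o b) i j k.
Proof. by rewrite /triple_minor !(rmorphB, rmorphD, rmorphM) /=. Qed.

Lemma eq_triple_minor (R : comNzRingType) (a b a' b' : 'I_4 -> R) i j k :
  a =1 a' -> b =1 b' -> triple_minor a b i j k = triple_minor a' b' i j k.
Proof. by move=> aa bb; rewrite /triple_minor !aa !bb. Qed.

Section StandardIdeal.
Variable K : numFieldType.

Definition avar i : {mpoly K[2 * 4]} := 'X_(mxvec_index 0 i).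
Definition bvar i : {mpoly K[2 * 4]} := 'X_(mxvec_index 1 i).

Lemma std_matrixE : std_matrix K = triple_matrix avar bvar.
Proof. by apply/matrixP => i j; rewrite !mxE. Qed.

Definition nat_point (ra rb : seq nat) (i : 'I_2) : 'cV[K]_4 :=
  \col_j (nth 0%N (if i == 0 then ra else rb) j)%:R.

Lemma avar_nat_point ra rb i :
  (avar i).@[evalvec (nat_point ra rb)] = (nth 0%N ra i)%:R.
Proof. by rewrite mevalXU evalvecE mxE. Qed.

Lemma bvar_nat_point ra rb i :
  (bvar i).@[evalvec (nat_point ra rb)] = (nth 0%N rb i)%:R.
Proof. by rewrite mevalXU evalvecE mxE. Qed.

Definition int_minor (ra rb : seq nat) i j k : int :=
  triple_minor (fun i : 'I_4 => (nth 0%N ra i)%:Z)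
               (fun i : 'I_4 => (nth 0%N rb i)%:Z) i j k.

Section Reduction.
Variables (l0 : 'I_(2 * 4)) (c0 : {mpoly K[2 * 4]}).
Hypothesis c0_fixed : msubst l0 c0 c0 = c0.

(** A minor of the standard matrix modulo the linear form X_l0 - c0. *)
Definition red_minor i j k :=
  triple_minor (msubst l0 c0 \o avar) (msubst l0 c0 \o bvar) i j k.

Lemma red_minor_nat_point ra rb i j k (v := evalvec (nat_point ra rb)) :
  v l0 = c0.@[v] -> (red_minor i j k).@[v] = (int_minor ra rb i j k)%:~R.
Proof.
move=> v0; rewrite /red_minor (map_triple_minor (meval v)).
rewrite /int_minor (map_triple_minor (intmul (1 : K))).
have E f : (msubst l0 c0 f).@[v] = f.@[v].
  by rewrite msubst_meval; apply: meval_eq => n; case: eqP => [->|].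
by apply: eq_triple_minor => n /=; rewrite E ?avar_nat_point ?bvar_nat_point.
Qed.

Lemma coprime_red_minor l c ra rb i j k (v := evalvec (nat_point ra rb)) :
  msubst l c c = c -> v l0 = c0.@[v] -> v l = c.@[v] ->
  int_minor ra rb i j k != 0 -> coprime_to ('X_l - c) (red_minor i j k).
Proof.
move=> cc v0 vl n0; apply: (coprime_to_linear cc vl).
by rewrite red_minor_nat_point // intr_eq0.
Qed.

Lemma coprime_red_minor_var l ra rb i j k (v := evalvec (nat_point ra rb)) :
  v l0 = c0.@[v] -> v l = 0 ->
  int_minor ra rb i j k != 0 -> coprime_to 'X_l (red_minor i j k).
Proof.
move=> v0 vl; rewrite -['X_l]subr0; apply: coprime_red_minor => //.
  exact: rmorph0.
by rewrite meval0.
Qed.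

Lemma red_minor_neq0 ra rb i j k (v := evalvec (nat_point ra rb)) :
  v l0 = c0.@[v] -> int_minor ra rb i j k != 0 -> red_minor i j k != 0.
Proof.
move=> v0 n0; apply: (@meval_neq0 _ _ _ v).
by rewrite red_minor_nat_point // intr_eq0.
Qed.

Lemma linear_nonzerodivisor i j f :
  'X_l0 - c0 != 0 ->
  let M := triple_matrix (msubst l0 c0 \o avar) (msubst l0 c0 \o bvar) in
  \det (row' i M) != 0 -> \det (row' j M) != 0 ->
  coprime_to (\det (row' i M)) (\det (row' j M)) ->
  maximal_minor_ideal (std_matrix K) (('X_l0 - c0) * f) ->
  maximal_minor_ideal (std_matrix K) f.
Proof.
move=> p0 M.
have -> : M = map_mx (msubst l0 c0) (std_matrix K) by rewrite std_matrixE map_triple_matrix.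
move=> di dj cop; apply: minor_ideal_nonzerodivisor di dj cop => //.
- by rewrite rmorphB /= msubstX eqxx c0_fixed subrr.
- by move=> r; apply: msubst_idem.
- by move=> r; apply: msubst_div.
Qed.

(** For each linear form used below, one minor splits modulo it into four linear
forms, so that coprimality to another minor is checked factor by factor. *)
Lemma linear_nonzerodivisor4 i j q1 q2 q3 q4 f :
  'X_l0 - c0 != 0 ->
  let M := triple_matrix (msubst l0 c0 \o avar) (msubst l0 c0 \o bvar) in
  \det (row' i M) = - (q1 * (q2 * (q3 * q4))) ->
  \det (row' i M) != 0 -> \det (row' j M) != 0 ->
  [/\ coprime_to q1 (\det (row' j M)), coprime_to q2 (\det (row' j M)),
      coprime_to q3 (\det (row' j M)) & coprime_to q4 (\det (row' j M))] ->
  maximal_minor_ideal (std_matrix K) (('X_l0 - c0) * f) ->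
  maximal_minor_ideal (std_matrix K) f.
Proof.
move=> p0 M dE di dj [c1 c2 c3 c4]; apply: (linear_nonzerodivisor p0 di dj).
move: di; rewrite dE oppr_eq0 !mulf_eq0 !negb_or => /andP [q10 /andP [q20 /andP [q30 _]]].
by apply: coprime_to_opp; do 3! apply: coprime_toM => //.
Qed.

End Reduction.

Lemma msubst0 (l : 'I_(2 * 4)) : msubst l 0 0 = 0 :> {mpoly K[2 * 4]}.
Proof. exact: rmorph0. Qed.

Lemma msubstXX (l k : 'I_(2 * 4)) : k != l ->
  msubst l 'X_k 'X_k = 'X_k :> {mpoly K[2 * 4]}.
Proof. by move=> /negPf kl; rewrite msubstX kl. Qed.

Local Ltac simp_var :=
  rewrite ?(meval0, mevalXU, evalvecE, mxE) //=.
Local Ltac num_eval :=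
  rewrite ?(mevalB, meval0, mevalXU, evalvecE, mxE) /= ?subr0 ?oner_eq0.
Local Ltac red_neq0 ra rb := apply: (@red_minor_neq0 _ _ ra rb); simp_var.
Local Ltac cop_var ra rb :=
  apply: (@coprime_red_minor_var _ _ _ ra rb); [simp_var | simp_var | by []].
Local Ltac cop_diff ra rb :=
  apply: (@coprime_red_minor _ _ _ _ ra rb);
  [apply: msubstXX; rewrite mxvec_index_eq // | simp_var | simp_var | by []].

(** Each numerical point lies on the hyperplane of the linear form, and also on
that of a factor of the split minor; the value of the second minor there is
nonzero, hence the factor does not divide it. *)
Lemma avar0_nonzerodivisor f :
  maximal_minor_ideal (std_matrix K) (avar o0 * f) ->
  maximal_minor_ideal (std_matrix K) f.
Proof.
rewrite -[avar o0]subr0.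
pose phi := msubst (mxvec_index 0 o0) (0 : {mpoly K[2 * 4]}).
have [E0 E1 E2 E3] := triple_minorE (phi \o avar) (phi \o bvar).
apply: (@linear_nonzerodivisor4 _ _ (msubst0 _) o1 o0
  (bvar o0) (avar o2) (avar o3) (bvar o3 - bvar o2)) => /=.
- by apply: (@meval_neq0 _ _ _ (evalvec (nat_point [:: 1; 0; 0; 0]%N [:: 0; 0; 0; 0]%N))); num_eval.
- rewrite E1 /triple_minor /phi /= !msubstX !mxvec_index_eq /= /avar /bvar.
  by ring.
- by rewrite E1; red_neq0 ([:: 0; 1; 1; 1]%N) ( [:: 1; 1; 1; 2]%N).
- by rewrite E0; red_neq0 ([:: 0; 1; 1; 2]%N) ( [:: 0; 1; 2; 1]%N).
rewrite E0; split.
- cop_var ([:: 0; 1; 1; 2]%N) ([:: 0; 1; 2; 1]%N).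
- cop_var ([:: 0; 1; 0; 1]%N) ([:: 1; 1; 1; 2]%N).
- cop_var ([:: 0; 1; 1; 0]%N) ([:: 1; 1; 2; 1]%N).
- cop_diff ([:: 0; 1; 1; 2]%N) ([:: 1; 1; 2; 2]%N).
Qed.

Lemma avar1_nonzerodivisor f :
  maximal_minor_ideal (std_matrix K) (avar o1 * f) ->
  maximal_minor_ideal (std_matrix K) f.
Proof.
rewrite -[avar o1]subr0.
pose phi := msubst (mxvec_index 0 o1) (0 : {mpoly K[2 * 4]}).
have [E0 E1 E2 E3] := triple_minorE (phi \o avar) (phi \o bvar).
apply: (@linear_nonzerodivisor4 _ _ (msubst0 _) o0 o1
  (bvar o1) (avar o2) (avar o3) (bvar o3 - bvar o2)) => /=.
- by apply: (@meval_neq0 _ _ _ (evalvec (nat_point [:: 0; 1; 0; 0]%N [:: 0; 0; 0; 0]%N))); num_eval.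
- rewrite E0 /triple_minor /phi /= !msubstX !mxvec_index_eq /= /avar /bvar.
  by ring.
- by rewrite E0; red_neq0 ([:: 1; 0; 1; 1]%N) ( [:: 1; 1; 1; 2]%N).
- by rewrite E1; red_neq0 ([:: 1; 0; 1; 2]%N) ( [:: 1; 0; 2; 1]%N).
rewrite E1; split.
- cop_var ([:: 1; 0; 1; 2]%N) ([:: 1; 0; 2; 1]%N).
- cop_var ([:: 1; 0; 0; 1]%N) ([:: 1; 1; 1; 2]%N).
- cop_var ([:: 1; 0; 1; 0]%N) ([:: 1; 1; 2; 1]%N).
- cop_diff ([:: 1; 0; 1; 2]%N) ([:: 1; 1; 2; 2]%N).
Qed.

Lemma bvar2_nonzerodivisor f :
  maximal_minor_ideal (std_matrix K) (bvar o2 * f) ->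
  maximal_minor_ideal (std_matrix K) f.
Proof.
rewrite -[bvar o2]subr0.
pose phi := msubst (mxvec_index 1 o2) (0 : {mpoly K[2 * 4]}).
have [E0 E1 E2 E3] := triple_minorE (phi \o avar) (phi \o bvar).
apply: (@linear_nonzerodivisor4 _ _ (msubst0 _) o0 o2
  (avar o2) (bvar o1) (bvar o3) (avar o3 - avar o1)) => /=.
- by apply: (@meval_neq0 _ _ _ (evalvec (nat_point [:: 0; 0; 0; 0]%N [:: 0; 0; 1; 0]%N))); num_eval.
- rewrite E0 /triple_minor /phi /= !msubstX !mxvec_index_eq /= /avar /bvar.
  by ring.
- by rewrite E0; red_neq0 ([:: 1; 1; 1; 2]%N) ( [:: 1; 1; 0; 1]%N).
- by rewrite E2; red_neq0 ([:: 1; 1; 0; 2]%N) ( [:: 1; 2; 0; 1]%N).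
rewrite E2; split.
- cop_var ([:: 1; 1; 0; 2]%N) ([:: 1; 2; 0; 1]%N).
- cop_var ([:: 1; 1; 1; 2]%N) ([:: 1; 0; 0; 1]%N).
- cop_var ([:: 1; 2; 1; 1]%N) ([:: 1; 1; 0; 0]%N).
- cop_diff ([:: 1; 2; 1; 2]%N) ([:: 1; 1; 0; 2]%N).
Qed.

Lemma bvar3_nonzerodivisor f :
  maximal_minor_ideal (std_matrix K) (bvar o3 * f) ->
  maximal_minor_ideal (std_matrix K) f.
Proof.
rewrite -[bvar o3]subr0.
pose phi := msubst (mxvec_index 1 o3) (0 : {mpoly K[2 * 4]}).
have [E0 E1 E2 E3] := triple_minorE (phi \o avar) (phi \o bvar).
apply: (@linear_nonzerodivisor4 _ _ (msubst0 _) o0 o3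
  (avar o3) (bvar o1) (bvar o2) (avar o1 - avar o2)) => /=.
- by apply: (@meval_neq0 _ _ _ (evalvec (nat_point [:: 0; 0; 0; 0]%N [:: 0; 0; 0; 1]%N))); num_eval.
- rewrite E0 /triple_minor /phi /= !msubstX !mxvec_index_eq /= /avar /bvar.
  by ring.
- by rewrite E0; red_neq0 ([:: 1; 1; 2; 1]%N) ( [:: 1; 1; 1; 0]%N).
- by rewrite E3; red_neq0 ([:: 1; 1; 2; 0]%N) ( [:: 1; 2; 1; 0]%N).
rewrite E3; split.
- cop_var ([:: 1; 1; 2; 0]%N) ([:: 1; 2; 1; 0]%N).
- cop_var ([:: 1; 1; 2; 1]%N) ([:: 1; 0; 1; 0]%N).
- cop_var ([:: 1; 2; 1; 1]%N) ([:: 1; 1; 0; 0]%N).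
- cop_diff ([:: 1; 2; 2; 1]%N) ([:: 1; 1; 2; 0]%N).
Qed.

Lemma bvar_diff_nonzerodivisor f :
  maximal_minor_ideal (std_matrix K) ((bvar o1 - bvar o0) * f) ->
  maximal_minor_ideal (std_matrix K) f.
Proof.
have fixed : msubst (mxvec_index 1 o1) 'X_(mxvec_index 1 o0) 'X_(mxvec_index 1 o0) = 'X_(mxvec_index 1 o0) :> {mpoly K[2 * 4]}.
  by apply: msubstXX; rewrite mxvec_index_eq.
pose phi := msubst (mxvec_index 1 o1) ('X_(mxvec_index 1 o0) : {mpoly K[2 * 4]}).
have [E0 E1 E2 E3] := triple_minorE (phi \o avar) (phi \o bvar).
apply: (@linear_nonzerodivisor4 _ _ fixed o3 o1
  (avar o0 - avar o1) (bvar o0) (avar o2) (bvar o0 - bvar o2)) => /=.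
- by apply: (@meval_neq0 _ _ _ (evalvec (nat_point [:: 0; 0; 0; 0]%N [:: 0; 1; 0; 0]%N))); num_eval.
- rewrite E3 /triple_minor /phi /= !msubstX !mxvec_index_eq /= /avar /bvar.
  by ring.
- by rewrite E3; red_neq0 ([:: 1; 2; 1; 1]%N) ( [:: 1; 1; 2; 1]%N).
- by rewrite E1; red_neq0 ([:: 1; 1; 1; 2]%N) ( [:: 1; 1; 2; 1]%N).
rewrite E1; split.
- cop_diff ([:: 1; 1; 1; 2]%N) ([:: 1; 1; 2; 1]%N).
- cop_var ([:: 1; 2; 1; 2]%N) ([:: 0; 0; 1; 1]%N).
- cop_var ([:: 1; 2; 0; 1]%N) ([:: 1; 1; 1; 2]%N).
- cop_diff ([:: 1; 2; 2; 1]%N) ([:: 1; 1; 1; 2]%N).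
Qed.

End StandardIdeal.

(** * The ideal of minors is prime *)

Section MinorIdeal.
Variables (R : comNzRingType) (t : nat) (M : 'M[R]_(t.+1, t)).

Lemma minor_idealD f g : maximal_minor_ideal M f -> maximal_minor_ideal M g ->
  maximal_minor_ideal M (f + g).
Proof.
move=> [u ->] [v ->]; exists (fun k => u k + v k); rewrite -big_split.
by apply: eq_bigr => k _; rewrite mulrDl.
Qed.

Lemma minor_idealMl r f : maximal_minor_ideal M f -> maximal_minor_ideal M (r * f).
Proof.
move=> [u ->]; exists (fun k => r * u k); rewrite mulr_sumr.
by apply: eq_bigr => k _; rewrite mulrA.
Qed.

Lemma minor_idealB f g : maximal_minor_ideal M f -> maximal_minor_ideal M g ->
  maximal_minor_ideal M (f - g).
Proof. by move=> If Ig; rewrite -mulN1r; apply: minor_idealD => //; apply: minor_idealMl. Qed.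

Lemma minor_ideal0 : maximal_minor_ideal M 0.
Proof. by exists (fun=> 0); rewrite big1 // => k _; rewrite mul0r. Qed.

Lemma minor_ideal_minor k : maximal_minor_ideal M (\det (row' k M)).
Proof.
exists (fun l => (l == k)%:R); rewrite (bigD1 k) //= eqxx mul1r big1 ?addr0 //.
by move=> l /negPf ->; rewrite mul0r.
Qed.

End MinorIdeal.

(** The pairs (a, b) in general position for which b_i |-> a_i is the
restriction of a Moebius transformation fixing 0. *)
Definition moebius_pair (K : fieldType) (a b : 'I_4 -> K) : Prop :=
  [/\ forall i, a i != 0, forall i, b i != 0, injective b &
      exists x y z : K, x != 0 /\
        forall i, x + y * b i != 0 /\ (x + y * b i) * a i = z * b i].

(** The relation x a_i = z b_i - y a_i b_i is a linear dependency between the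
three columns in which the first one has the nonzero coefficient x. *)
Lemma moebius_minor_eq0 (K : fieldType) (a b : 'I_4 -> K) i j k :
  moebius_pair a b -> triple_minor a b i j k = 0.
Proof.
case=> _ _ _ [x [y [z [x0 E]]]]; apply: (mulfI x0); rewrite mulr0.
have {}E l : x * a l = z * b l - y * (a l * b l).
  by rewrite -(E l).2; ring.
rewrite /triple_minor; transitivity
  ((x * a i) * (b j * (a k * b k) - b k * (a j * b j))
  - b i * ((x * a j) * (a k * b k) - (x * a k) * (a j * b j))
  + a i * b i * ((x * a j) * b k - (x * a k) * b j)); first by ring.
by rewrite !E; ring.
Qed.

Section Elimination.
Variable K : numFieldType.
Local Notation S := {mpoly K[2 * 4]}.
Local Notation I := (maximal_minor_ideal (std_matrix K)).
Local Notation avar := (avar K).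
Local Notation bvar := (bvar K).

(** The minor of the rows 0, 1, k is a_k times the first form minus the second,
so it expresses a_k through the other variables. *)
Definition elim_den k : S :=
  bvar o0 * bvar o1 * (avar o1 - avar o0)
  + bvar k * (avar o0 * bvar o1 - avar o1 * bvar o0).
Definition elim_num k : S :=
  avar o0 * (avar o1 * ((bvar o1 - bvar o0) * bvar k)).

Lemma elim_mod k : k = o2 \/ k = o3 -> I (avar k * elim_den k - elim_num k).
Proof.
have [_ _ E2 E3] := triple_minorE avar bvar.
have E : avar k * elim_den k - elim_num k = triple_minor avar bvar o0 o1 k.
  by rewrite /triple_minor /elim_den /elim_num; ring.
rewrite E std_matrixE => -[] ->; rewrite -?E2 -?E3; exact: minor_ideal_minor.
Qed.

(** Modulo the minors, a_k times elim_den k is a_0 a_1 (b_1 - b_0) b_k, a product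
of nonzerodivisors. *)
Lemma elim_den_nonzerodivisor k f : k = o2 \/ k = o3 -> I (elim_den k * f) -> I f.
Proof.
move=> k23 If; have Inum : I (elim_num k * f).
  have -> : elim_num k * f =
    avar k * (elim_den k * f) - f * (avar k * elim_den k - elim_num k) by ring.
  by apply: minor_idealB; apply: minor_idealMl => //; apply: elim_mod.
move: Inum; rewrite /elim_num -!mulrA => /avar0_nonzerodivisor /avar1_nonzerodivisor.
move=> /bvar_diff_nonzerodivisor; case: k23 => ->.
  exact: bvar2_nonzerodivisor.
exact: bvar3_nonzerodivisor.
Qed.

(** Independence of a_2 and a_3, expressed on values. *)
Definition free_of_a23 (g : S) : Prop := forall v v',
  (forall k, k != mxvec_index 0 o2 -> k != mxvec_index 0 o3 -> v k = v' k) ->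
  g.@[v] = g.@[v'].

Lemma free_bvar k : free_of_a23 (bvar k).
Proof. by move=> v v' E; rewrite !mevalXU E // mxvec_index_eq. Qed.

Lemma free_avar k : k != o2 -> k != o3 -> free_of_a23 (avar k).
Proof. by move=> k2 k3 v v' E; rewrite !mevalXU E // mxvec_index_eq. Qed.

Lemma freeD f g : free_of_a23 f -> free_of_a23 g -> free_of_a23 (f + g).
Proof. by move=> ff fg v v' E; rewrite !mevalD (ff v v') // (fg v v'). Qed.

Lemma freeM f g : free_of_a23 f -> free_of_a23 g -> free_of_a23 (f * g).
Proof. by move=> ff fg v v' E; rewrite !mevalM (ff v v') // (fg v v'). Qed.

Lemma freeC c : free_of_a23 c%:MP.
Proof. by move=> v v' E; rewrite !mevalC. Qed.

Lemma freeB f g : free_of_a23 f -> free_of_a23 g -> free_of_a23 (f - g).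
Proof. by move=> ff fg v v' E; rewrite !mevalB (ff v v') // (fg v v'). Qed.

Lemma freeX f n : free_of_a23 f -> free_of_a23 (f ^+ n).
Proof. by move=> ff v v' E; rewrite !rmorphXn /= (ff v v'). Qed.

Lemma free_elim k : free_of_a23 (elim_den k) /\ free_of_a23 (elim_num k).
Proof.
have [f0 f1] : free_of_a23 (avar o0) /\ free_of_a23 (avar o1).
  by split; apply: free_avar.
have fb := free_bvar; split.
  apply: freeD; apply: freeM => //; [exact: freeM | exact: freeB |].
  by apply: freeB; apply: freeM.
by do 3! apply: freeM => //; apply: freeB.
Qed.

Let D := elim_den o2 * elim_den o3.

Lemma elimination f : exists N g, I (D ^+ N * f - g) /\ free_of_a23 g.
Proof.
have fD : free_of_a23 D by apply: freeM; apply: (free_elim _).1.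
elim/mpoly_ring_ind: f => [c|l|f1 f2 [n1 [g1 [I1 F1]]] [n2 [g2 [I2 F2]]]
    |f1 f2 [n1 [g1 [I1 F1]]] [n2 [g2 [I2 F2]]]].
- exists 0%N, c%:MP; split; last exact: freeC.
  by rewrite expr0 mul1r subrr; apply: minor_ideal0.
- case/mxvec_indexP: l => i k.
  have triv : free_of_a23 ('X_(mxvec_index i k)) -> exists N g,
      I (D ^+ N * 'X_(mxvec_index i k) - g) /\ free_of_a23 g.
    move=> F; exists 0%N, 'X_(mxvec_index i k); split => //.
    by rewrite expr0 mul1r subrr; apply: minor_ideal0.
  case: (eqVneq i 0) => [i0|i1]; last first.
    by apply: triv; move=> v v' E; rewrite !mevalXU E // mxvec_index_eq (negPf i1).
  rewrite {i}i0 in triv *.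
  have [k2|k2] := eqVneq k o2.
    exists 1%N, (elim_den o3 * elim_num o2); split; last first.
      by apply: freeM; [exact: (free_elim _).1 | exact: (free_elim _).2].
    have -> : D ^+ 1 * 'X_(mxvec_index 0 k) - elim_den o3 * elim_num o2 =
        elim_den o3 * (avar o2 * elim_den o2 - elim_num o2).
      by rewrite expr1 k2 -/(avar o2) /D; ring.
    by apply: minor_idealMl; apply: elim_mod; left.
  have [k3|k3] := eqVneq k o3.
    exists 1%N, (elim_den o2 * elim_num o3); split; last first.
      by apply: freeM; [exact: (free_elim _).1 | exact: (free_elim _).2].
    have -> : D ^+ 1 * 'X_(mxvec_index 0 k) - elim_den o2 * elim_num o3 =
        elim_den o2 * (avar o3 * elim_den o3 - elim_num o3).
      by rewrite expr1 k3 -/(avar o3) /D; ring.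
    by apply: minor_idealMl; apply: elim_mod; right.
  by apply: triv; apply: free_avar.
- exists (n1 + n2)%N, (D ^+ n2 * g1 + D ^+ n1 * g2); split.
    have -> : D ^+ (n1 + n2) * (f1 + f2) - (D ^+ n2 * g1 + D ^+ n1 * g2) =
      D ^+ n2 * (D ^+ n1 * f1 - g1) + D ^+ n1 * (D ^+ n2 * f2 - g2).
      by rewrite exprD; ring.
    by apply: minor_idealD; apply: minor_idealMl.
  by apply: freeD; apply: freeM => //; apply: freeX.
- exists (n1 + n2)%N, (g1 * g2); split; last exact: freeM.
  have -> : D ^+ (n1 + n2) * (f1 * f2) - g1 * g2 =
     (D ^+ n2 * f2) * (D ^+ n1 * f1 - g1) + g1 * (D ^+ n2 * f2 - g2).
    by rewrite exprD; ring.
  by apply: minor_idealD; apply: minor_idealMl.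
Qed.

Definition pair_point (a b : 'I_4 -> K) (i : 'I_2) : 'cV[K]_4 :=
  \col_j (if i == 0 then a j else b j).

Lemma avar_pair_point a b i : (avar i).@[evalvec (pair_point a b)] = a i.
Proof. by rewrite mevalXU evalvecE mxE. Qed.

Lemma bvar_pair_point a b i : (bvar i).@[evalvec (pair_point a b)] = b i.
Proof. by rewrite mevalXU evalvecE mxE. Qed.

Lemma minor_ideal_eval a b f : I f ->
  (forall i j k, triple_minor a b i j k = 0) -> f.@[evalvec (pair_point a b)] = 0.
Proof.
move=> [g ->] m0; rewrite raddf_sum big1 // => k _ /=; rewrite mevalM.
rewrite std_matrixE det_triple_minor map_triple_minor.
rewrite (@eq_triple_minor _ _ _ a b) ?m0 ?mulr0 // => i /=.
  exact: avar_pair_point.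
exact: bvar_pair_point.
Qed.

(** Off the hypersurface of this form, a_0, a_1 and b extend to a Moebius pair. *)
Definition elim_discr : S :=
  avar o0 * avar o1 * (bvar o0 * bvar o1 * bvar o2 * bvar o3) *
  ((bvar o0 - bvar o1) * (bvar o0 - bvar o2) * (bvar o0 - bvar o3) *
   (bvar o1 - bvar o2) * (bvar o1 - bvar o3) * (bvar o2 - bvar o3)) *
  (avar o1 - avar o0) * (elim_den o2 * elim_den o3).

Lemma elim_discr_neq0 : elim_discr != 0.
Proof.
apply: (@meval_neq0 _ _ _ (evalvec (pair_point (fun i => i.+1%:R) (fun i => i.+1%:R)))).
rewrite /elim_discr /elim_den.
rewrite !(mevalM, mevalB, mevalD) !avar_pair_point !bvar_pair_point /=.
(* The value at a_i = b_i = i + 1. *)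
rewrite [X in X != 0](_ : _ = 2304%:R) ?Num.Theory.pnatr_eq0 //.
by rewrite /=; ring.
Qed.

Lemma elim_moebius_pair v : elim_discr.@[v] != 0 -> exists a b,
  moebius_pair a b /\ forall k, k != mxvec_index 0 o2 -> k != mxvec_index 0 o3 ->
    v k = evalvec (pair_point a b) k.
Proof.
pose a0 i := v (mxvec_index 0 i); pose b i := v (mxvec_index 1 i).
rewrite /elim_discr /elim_den !(mevalM, mevalB, mevalD) !mevalXU.
rewrite -!/(a0 _) -!/(b _) !mulf_eq0 !negb_or !subr_eq0 -!andbA.
set P := b o0 * b o1 * (a0 o1 - a0 o0); set S := a0 o0 * b o1 - a0 o1 * b o0.
case/and5P=> a00 a10 b0 b1 /and5P [b2 b3 b01 b02 /and5P [b03 b12 b13 b23]].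
case/and3P=> a01 D2 D3.
have bn0 i : b i != 0 by case: i => [[|[|[|[|//]]]] h]; rewrite (bool_irrelevance h isT).
(* (P, - Q, S) is the cross product of the rows 0 and 1. *)
pose Q := a0 o0 * a0 o1 * (b o1 - b o0).
have b10 : b o1 - b o0 != 0 by rewrite subr_eq0 eq_sym.
have E0 : P + b o0 * S = a0 o1 * b o0 * (b o1 - b o0) by rewrite /P /S; ring.
have E1 : P + b o1 * S = a0 o0 * b o1 * (b o1 - b o0) by rewrite /P /S; ring.
have Dn0 i : P + b i * S != 0.
  case: i => [[|[|[|[|//]]]] h]; rewrite (bool_irrelevance h isT) ?E0 ?E1 //;
    by rewrite !mulf_neq0.
pose a i := Q * b i / (P + b i * S).
exists a, b; split; first split => //.
- by move=> i; rewrite /a !mulf_neq0 ?invr_eq0.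
- move=> [[|[|[|[|//]]]] h] [[|[|[|[|//]]]] h'] /eqP; rewrite (bool_irrelevance h isT)
    (bool_irrelevance h' isT) ?eqxx // => E; apply: val_inj => //=; exfalso; move: E;
    rewrite ?(negPf b01) ?(negPf b02) ?(negPf b03) ?(negPf b12) ?(negPf b13) ?(negPf b23) //;
    by rewrite eq_sym ?(negPf b01) ?(negPf b02) ?(negPf b03) ?(negPf b12) ?(negPf b13) ?(negPf b23).
- exists P, S, Q; split; first by rewrite !mulf_neq0 // subr_eq0.
  move=> i; rewrite [S * _]mulrC; split => //.
  by rewrite /a mulrCA mulfV ?mulr1.
move=> k; case/mxvec_indexP: k => i j; rewrite evalvecE mxE !mxvec_index_eq.
have [->|i1] := eqVneq i 0; last first.
  by move=> _ _; rewrite /b; congr (v (mxvec_index _ _)); case: i i1 => [[|[|//]]] //= h _; apply: val_inj.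
rewrite /= => j2 j3.
case: j j2 j3 => [[|[|[|[|//]]]] h] //= _ _; rewrite (bool_irrelevance h isT) /a ?E0 ?E1 -/(a0 _) /Q.
  by field; rewrite ?a10 ?b10 ?bn0.
by field; rewrite ?a00 ?b10 ?bn0.
Qed.

(** Up to the nonzerodivisor D, every polynomial is congruent to a polynomial in
a_0, a_1 and b. These six coordinates are algebraically independent on the
Moebius pairs, so a product vanishing there reduces to zero. *)
Theorem moebius_prime f1 f2 :
  (forall a b, moebius_pair a b -> (f1 * f2).@[evalvec (pair_point a b)] = 0) ->
  I f1 \/ I f2.
Proof.
move=> f0; have [N1 [g1 [I1 F1]]] := elimination f1.
have [N2 [g2 [I2 F2]]] := elimination f2.
have saturated N f : I (D ^+ N * f) -> I f.
  elim: N => [|N IHN]; first by rewrite expr0 mul1r.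
  rewrite exprS /D -!mulrA => If; apply: IHN.
  apply: (@elim_den_nonzerodivisor o3); first by right.
  by apply: (@elim_den_nonzerodivisor o2); first by left.
have : g1 * g2 = 0.
  apply: (mpoly_dense_eq0 elim_discr_neq0) => v /elim_moebius_pair [a [b [ab E]]].
  have gE N f g : free_of_a23 g -> I (D ^+ N * f - g) ->
      g.@[v] = (D ^+ N * f).@[evalvec (pair_point a b)].
    move=> Fg Ig; rewrite (Fg v _ E); apply/eqP; rewrite eq_sym -subr_eq0 -mevalB.
    by rewrite (minor_ideal_eval Ig (fun i j k => moebius_minor_eq0 i j k ab)).
  rewrite mevalM (gE _ _ _ F1 I1) (gE _ _ _ F2 I2) !mevalM mulrACA -[f1.@[_] * _]mevalM.
  by rewrite f0 // mulr0.
move/eqP; rewrite mulf_eq0 => /orP [/eqP g0|/eqP g0]; [left|right].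
  by apply: (saturated N1); move: I1; rewrite g0 subr0.
by apply: (saturated N2); move: I2; rewrite g0 subr0.
Qed.

Corollary moebius_ideal f :
  (forall a b, moebius_pair a b -> f.@[evalvec (pair_point a b)] = 0) -> I f.
Proof.
by move=> f0; case: (@moebius_prime f f) => // a b /f0; rewrite mevalM => ->; rewrite mul0r.
Qed.

End Elimination.

(** * The degeneracy locus of the standard matrix *)

Section Rank.
Variable K : fieldType.

Lemma rank_ltP (m t : nat) (M : 'M[K]_(m, t)) :
  (\rank M < t)%N <-> exists2 v : 'cV_t, v != 0 & M *m v = 0.
Proof.
rewrite -mxrank_tr; split=> [rk|[v v0 Mv]].
  have : kermx M^T != 0 by rewrite kermx_eq0 /row_free neq_ltn rk.
  case/rowV0Pn => u /sub_kermxP uM u0; exists u^T.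
    by apply: contra_neq u0 => u0; rewrite -[u]trmxK u0 trmx0.
  by apply: trmx_inj; rewrite trmx_mul trmxK uM trmx0.
rewrite ltn_neqAle rank_leq_row andbT; apply: contra_neqN v0 => fr.
apply: trmx_inj; apply: (row_free_inj (A := M^T)) => //.
by rewrite -trmx_mul Mv !trmx0 mul0mx.
Qed.

(** A left kernel vector with a nonzero k-th entry shows that deleting the row
k does not lower the rank. *)
Lemma rank_minorsP (t : nat) (M : 'M[K]_(t.+1, t)) :
  (\rank M < t)%N <-> forall k, \det (row' k M) = 0.
Proof.
split=> [/rank_ltP [v v0 Mv] k|M0].
  apply/eqP; rewrite -det_tr; apply/det0P; exists v^T.
    by apply: contra_neq v0 => v0; rewrite -[v]trmxK v0 trmx0.
  by rewrite -trmx_mul row'Esub mul_rowsub_mx Mv; apply/matrixP => ? ?; rewrite !mxE.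
have : kermx M != 0.
  by rewrite kermx_eq0 /row_free neq_ltn ltnS rank_leq_col.
case/rowV0Pn => u /sub_kermxP uM /rV0Pn [k uk].
have /eqP := M0 k; rewrite -det_tr => /det0P [w w0 wM].
apply/rank_ltP; exists w^T; first by apply: contra_neq w0 => w0; rewrite -[w]trmxK w0 trmx0.
have Mw l : l != k -> (M *m w^T) l 0 = 0.
  rewrite eq_sym => /unlift_some [j -> _].
  have : row' k M *m w^T = 0 by rewrite -[row' k M]trmxK -trmx_mul wM trmx0.
  by rewrite row'Esub mul_rowsub_mx => /matrixP/(_ j 0); rewrite !mxE.
apply/colP => l; rewrite [RHS]mxE; have [->|/Mw //] := eqVneq l k.
have /matrixP/(_ 0 0) : u *m (M *m w^T) = 0 by rewrite mulmxA uM mul0mx.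
rewrite mxE (bigD1 k) //= big1 => [|j /Mw ->]; last by rewrite mulr0.
by rewrite addr0 [RHS]mxE => /eqP; rewrite mulf_eq0 (negPf uk) => /eqP.
Qed.

(** A dependency of the columns, with coefficients (x, - z, y). *)
Lemma triple_rankP (a b : 'I_4 -> K) :
  (\rank (triple_matrix a b) < 3)%N <->
  exists x y z, [|| x != 0, y != 0 | z != 0] /\
    forall i, (x + y * b i) * a i = z * b i.
Proof.
rewrite rank_ltP; split=> [[v v0 Mv]|[x [y [z [xyz E]]]]].
  exists (v (@Ordinal 3 0 isT) 0), (v (@Ordinal 3 2 isT) 0), (- v (@Ordinal 3 1 isT) 0).
  split.
    apply: contraNT v0; rewrite !negb_or !negbK oppr_eq0 => /and3P [/eqP v0 /eqP v2 /eqP v1].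
    by apply/eqP/colP => -[[|[|[|//]]] h]; rewrite (bool_irrelevance h isT) mxE.
  move=> i; move/matrixP: Mv => /(_ i 0); rewrite !mxE !big_ord_recl big_ord0 !mxE /=.
  rewrite (_ : lift _ _ = Ordinal (isT : 1 < 3)%N); last exact: val_inj.
  rewrite (_ : lift _ _ = Ordinal (isT : 2 < 3)%N); last exact: val_inj.
  rewrite (_ : ord0 = Ordinal (isT : 0 < 3)%N); last exact: val_inj.
  by move=> E; apply/eqP; rewrite -subr_eq0 -[X in _ == X]E addr0; apply/eqP; ring.
exists (\col_j nth 0 [:: x; - z; y] j).
  apply/negP => /eqP/colP v0; move: xyz.
  move: (v0 (@Ordinal 3 0 isT)) (v0 (@Ordinal 3 1 isT)) (v0 (@Ordinal 3 2 isT)).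
  by rewrite !mxE /= => -> /eqP; rewrite oppr_eq0 => /eqP -> ->; rewrite eqxx.
apply/colP => i; rewrite !mxE !big_ord_recl big_ord0 !mxE /=.
have /eqP := E i; rewrite -subr_eq0 addr0 => /eqP <-; ring.
Qed.

End Rank.

Section StandardLocus.
Variable K : numFieldType.
Local Notation S := {mpoly K[2 * 4]}.
Local Notation D := (degeneracy_locus 2 (std_matrix K)).

Definition acoord (r : 'I_2 -> 'cV[K]_4) (j : 'I_4) : K := r 0 j 0.
Definition bcoord (r : 'I_2 -> 'cV[K]_4) (j : 'I_4) : K := r 1 j 0.

Lemma std_matrix_eval r : map_mx (meval (evalvec r)) (std_matrix K) =
  triple_matrix (acoord r) (bcoord r).
Proof.
rewrite std_matrixE map_triple_matrix; apply/matrixP => i j; rewrite !mxE /=.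
by rewrite !mevalXU !evalvecE.
Qed.

Lemma triple_rank_scale (a b : 'I_4 -> K) (c d : K) : c != 0 -> d != 0 ->
  (\rank (triple_matrix a b) < 3)%N ->
  (\rank (triple_matrix (fun i => c * a i)%R (fun i => d * b i)%R) < 3)%N.
Proof.
move=> c0 d0 /triple_rankP [x [y [z [xyz E]]]]; apply/triple_rankP.
exists (d * x), y, (c * z); split.
  by rewrite !mulf_eq0 (negPf c0) (negPf d0).
move=> i; transitivity (c * d * ((x + y * b i) * a i)); first by ring.
by rewrite E; ring.
Qed.

Lemma degeneracyP r p : hcoords r p ->
  D p <-> (\rank (triple_matrix (acoord r) (bcoord r)) < 3)%N.
Proof.
move=> rp; split=> [/(_ r rp)|rk s sp]; first by rewrite std_matrix_eval.
have [c cE] := hcoords_unique rp sp.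
rewrite std_matrix_eval; have := triple_rank_scale (cE 0).1 (cE 1).1 rk.
congr (\rank _ < 3)%N; apply/matrixP => i j; rewrite !mxE /acoord /bcoord.
by rewrite (cE 0).2 (cE 1).2 !mxE.
Qed.

Lemma multihomog_triple_minor k :
  multihomog (fun=> 2%N) (\det (row' k (std_matrix K))).
Proof.
rewrite std_matrixE det_triple_minor /triple_minor.
have dX i : multihomog (fun l : 'I_2 => (l == 0 : nat)) (avar K i) by apply: multihomogX.
have dY i : multihomog (fun l : 'I_2 => (l == 1 : nat)) (bvar K i) by apply: multihomogX.
have dE (d e f : 'I_2 -> nat) (p q : S) : multihomog d p -> multihomog e q ->
    (forall l, d l + e l = f l)%N -> multihomog f (p * q).
  by move=> dp eq E; apply: multihomog_ext (multihomogM dp eq).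
have dXY i : multihomog (fun=> 1%N) (avar K i * bvar K i).
  by apply: (dE _ _ _ _ _ (dX i) (dY i)) => -[[|[|//]] ?].
apply: multihomogD; first apply: multihomogB.
- apply: (dE _ (fun l : 'I_2 => if l == 0 then 1%N else 2%N) _ _ _ (dX _)); last by move=> -[[|[|//]] ?].
  by apply: multihomogB; apply: (dE _ _ _ _ _ (dY _) (dXY _)) => -[[|[|//]] ?].
- apply: (dE _ (fun l : 'I_2 => if l == 0 then 2%N else 1%N) _ _ _ (dY _)); last by move=> -[[|[|//]] ?].
  by apply: multihomogB; apply: (dE _ _ _ _ _ (dX _) (dXY _)) => -[[|[|//]] ?].
- apply: (dE _ (fun=> 1%N) _ _ _ (dXY _)); last by [].
  by apply: multihomogB; apply: (dE _ _ _ _ _ (dX _) (dY _)) => -[[|[|//]] ?].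
Qed.

(** Closedness of the degeneracy locus follows from this description. *)
Lemma degeneracy_minors p :
  D p <-> forall k, vanishes_at (\det (row' k (std_matrix K))) p.
Proof.
have E r k : (\det (row' k (std_matrix K))).@[evalvec r] =
    \det (row' k (triple_matrix (acoord r) (bcoord r))).
  by rewrite -std_matrix_eval -det_map_mx; congr (\det _); apply/matrixP => ? ?; rewrite !mxE.
split=> [Dp k r rp|V r rp]; last first.
  by rewrite std_matrix_eval -ltnS; apply/rank_minorsP => k; rewrite -E V.
by rewrite E; move: k; apply/rank_minorsP/(degeneracyP rp).
Qed.

Lemma degeneracy_closed : zariski_closed D.
Proof.
exists (fun f => exists k, f = \det (row' k (std_matrix K))); split=> [f [k ->]|p].
  by exists (fun=> 2%N); apply: multihomog_triple_minor.
rewrite degeneracy_minors; split=> [V f [k ->]|V k]; first exact: V.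
by apply: V; exists k.
Qed.

Lemma minor_ideal_vanish f p :
  maximal_minor_ideal (std_matrix K) f -> D p -> vanishes_at f p.
Proof.
move=> [g ->] /degeneracy_minors V r rp; rewrite raddf_sum big1 // => k _ /=.
by rewrite mevalM V ?mulr0.
Qed.

Lemma std_bundle_map : bundle_map summand_degrees (std_matrix K).
Proof.
move=> i [[|[|[|//]]] h]; rewrite !mxE /=.
- by apply: multihomog_ext (@multihomogX K 2 3 0 i) => -[[|[|//]] ?].
- by apply: multihomog_ext (@multihomogX K 2 3 1 i) => -[[|[|//]] ?].
- apply: multihomog_ext (multihomogM (@multihomogX K 2 3 0 i) (@multihomogX K 2 3 1 i)).
  by move=> -[[|[|//]] ?].
Qed.

End StandardLocus.

(** * Cameras and their centers *)

Section Cameras.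
Variable K : numFieldType.
Implicit Types (A B : 'M[K]_(3, 4)).

Lemma camera_image_line A (x : pspace K 3) v : x = <[v]>%VS :> {vspace _} ->
  camera_image A x = <[A *m v]>%VS.
Proof. by move=> xv; rewrite /camera_image xv lin_image_line. Qed.

Lemma vline_eq0 (n : nat) (v : 'cV[K]_n) : (<[v]>%VS = 0%VS) <-> (v = 0).
Proof.
split=> [v0|->]; last first.
  by apply/eqP; rewrite -subv0 -memvE mem0v.
by apply/eqP; rewrite -memv0 -v0 memv_line.
Qed.

Lemma center_line A (x : pspace K 3) v : x = <[v]>%VS :> {vspace _} ->
  center A x <-> A *m v = 0.
Proof. by move=> xv; rewrite /center (camera_image_line _ xv) vline_eq0. Qed.

Lemma camera_kernel A (a w : 'cV[K]_4) : camera A -> a != 0 -> A *m a = 0 ->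
  A *m w = 0 -> exists c, w = c *: a.
Proof.
move=> rA a0 Aa Aw; have ak : (a^T <= kermx A^T)%MS.
  by apply/sub_kermxP; rewrite -trmx_mul Aa trmx0.
have wk : (w^T <= kermx A^T)%MS by apply/sub_kermxP; rewrite -trmx_mul Aw trmx0.
have : (w^T <= a^T)%MS.
  apply: submx_trans wk _; rewrite -(mxrank_leqif_sup ak).2 mxrank_ker !mxrank_tr rA.
  by rewrite -mxrank_tr rank_rV -trmx_eq0 trmxK a0.
case/sub_rVP => c wE; exists c; apply: trmx_inj; rewrite wE.
by apply/matrixP => i j; rewrite !mxE.
Qed.

Lemma std_point_line i : std_points K i = <[std_vec K i]>%VS :> {vspace _}.
Proof. by []. Qed.

Lemma std_vec_sum (v : 'cV[K]_4) :
  v = \sum_(i < 4) v i 0 *: std_vec K (widen_ord (leqnSn 4) i).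
Proof.
apply/colP => k; rewrite summxE (bigD1 k) //= big1 => [|l /negPf lk].
  by rewrite !mxE /= ltn_ord eqxx mulr1 addr0.
rewrite !mxE /= ltn_ord (_ : (k == l :> nat) = false) ?mulr0 //.
by rewrite eq_sym; apply: lk.
Qed.

Lemma std_vec_max : std_vec K ord_max = const_mx 1.
Proof. by apply/colP => k; rewrite !mxE. Qed.

(** If A e_i = c_i H B e_i for the five standard vectors, then subtracting the
fifth relation from the sum of the others shows that (c_i - c_5) is a multiple
of b, and A a = 0 that (c_i a_i) is one. *)
Lemma std_locus_relation p r : hcoords r p ->
  centers_locus (std_points K) (std_points K) p ->
  (\rank (triple_matrix (acoord r) (bcoord r)) < 3)%N.
Proof.
move=> rp [_ _ [A [B [[cA Aa] [cB Bb] [nA nB [H [dH AB]]]]]]].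
have uH : H \in unitmx by rewrite unitmxE dH unitr1.
have E i : exists c : K, c != 0 /\ A *m std_vec K i = c *: (H *m B *m std_vec K i).
  have := AB i; rewrite !(camera_image_line _ (std_point_line i)) => E.
  have HB0 : H *m B *m std_vec K i != 0.
    apply/eqP => HB0; apply: (nA i); apply/(center_line _ (std_point_line i)).
    by apply/vline_eq0; rewrite E HB0; apply/vline_eq0.
  by have [c c0 cE] := eq_vlineP HB0 E; exists c.
have [c cE] := fin_all_exists E.
have Bk w : H *m B *m w = 0 -> exists s, w = s *: r 1.
  move=> HBw; apply: (camera_kernel cB (hcoords_neq0 1 rp)).
    by apply/(center_line _ (rp 1)).
  by rewrite -(mulKmx uH (B *m w)) [H *m _]mulmxA HBw mulmx0.
have Asum v : A *m v = H *m B *m \col_i (c (widen_ord (leqnSn 4) i) * v i 0).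
  rewrite [in LHS](std_vec_sum v) [\col_i _]std_vec_sum !mulmx_sumr.
  by apply: eq_bigr => i _; rewrite -!scalemxAr (cE _).2 scalerA mxE mulrC.
pose w : 'cV_4 := \col_i (c (widen_ord (leqnSn 4) i) - c ord_max).
have [t tE] : exists t, w = t *: r 1.
  apply: Bk; have := (cE ord_max).2; rewrite std_vec_max Asum => /eqP.
  rewrite scalemxAr -subr_eq0 -mulmxBr => /eqP <-; congr (_ *m _).
  by apply/colP => i; rewrite !mxE !mulr1.
have [s sE] : exists s, \col_i (c (widen_ord (leqnSn 4) i) * r 0 i 0) = s *: r 1.
  by apply: Bk; rewrite -Asum; apply/(center_line _ (rp 0)).
apply/triple_rankP; exists (c ord_max), t, s; rewrite (cE _).1; split=> // i.
move/colP/(_ i): tE; move/colP/(_ i): sE; rewrite !mxE /acoord /bcoord => <- <-.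
by congr (_ * _); rewrite addrC subrK.
Qed.

(** The two coordinates avoiding i and j agree on the line joining the standard
points i and j, which is how points off the secants are recognized. *)
Lemma avoid2 (i j : 'I_5) : exists k l : 'I_4, k != l /\
  [/\ std_vec K i k 0 = std_vec K i l 0 & std_vec K j k 0 = std_vec K j l 0].
Proof.
have [k [l]] : exists k l : 'I_4, [&& k != l, k != i :> nat, k != j :> nat,
    l != i :> nat & l != j :> nat].
  case: i => -[|[|[|[|[|//]]]]] ?; case: j => -[|[|[|[|[|//]]]]] ?;
  first [by exists o0, o1 | by exists o0, o2 | by exists o0, o3
        | by exists o1, o2 | by exists o1, o3 | by exists o2, o3].
case/and5P=> kl /negPf ki /negPf kj /negPf li /negPf lj; exists k, l.
by rewrite !mxE ki kj li lj.
Qed.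

Lemma std_secants_coords (a : pspace K 3) v : a = <[v]>%VS :> {vspace _} ->
  secants (std_points K) a -> exists k l, k != l /\ v k 0 = v l 0.
Proof.
move=> av [i [j [_]]]; rewrite av /= -memvE => /memv_addP [u1 /vlineP [c1 ->]].
case=> u2 /vlineP [c2 ->] ->; have [k [l [kl [ik jk]]]] := avoid2 i j.
exists k, l; split=> //; move: ik jk; rewrite !mxE => -> ->; by [].
Qed.

Lemma std_not_center A (a : 'cV[K]_4) i : camera A -> A *m a = 0 ->
  (forall i, a i 0 != 0) -> injective (fun i => a i 0) ->
  ~ center A (std_points K i).
Proof.
move=> cA Aa a0 ainj /(center_line A (std_point_line i)) Ai.
have [] := @camera_kernel A a (std_vec K i) cA _ Aa Ai.
  by apply: contra_neq (a0 o0) => ->; rewrite mxE.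
move=> c iE; have [k [l [kl [E _]]]] := avoid2 i i.
move: E; rewrite iE !mxE => /mulfI; move=> H; move/eqP: kl; case; apply: ainj; apply: H.
by apply: contra_neq (std_vec_neq0 K i) => c0; rewrite iE c0 scale0r.
Qed.

(** If a_i = a_j with b_i <> b_j, then y a_i = z, hence x a_i = 0. *)
Lemma moebius_pair_inj (a b : 'I_4 -> K) : moebius_pair a b -> injective a.
Proof.
move=> [a0 b0 binj [x [y [z [x0 E]]]]] i j aij; apply: binj.
apply/eqP; rewrite -subr_eq0; apply/negPn/negP => bij.
have : (y * a i - z) * (b i - b j) = 0.
  have := (E i).2; have := (E j).2; rewrite -aij => Ej Ei.
  transitivity ((x + y * b i) * a i - z * b i - ((x + y * b j) * a i - z * b j)).
    by ring.
  by rewrite Ei Ej !subrr.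
move/eqP; rewrite mulf_eq0 (negPf bij) orbF subr_eq0 => /eqP yz.
have : x * a i = 0.
  have := (E i).2; rewrite -yz => Ei; transitivity ((x + y * b i) * a i - y * a i * b i).
    by ring.
  by rewrite Ei subrr.
by move/eqP; rewrite mulf_eq0 (negPf x0) (negPf (a0 i)).
Qed.

Lemma camera_with_center (b : 'cV[K]_4) : b o0 0 != 0 ->
  exists2 B, camera B & B *m b = 0.
Proof.
move=> b0; pose v := \col_(i < 3) (- b (lift ord0 i) 0 / b o0 0).
pose B : 'M[K]_(3, 1 + 3) := row_mx v 1%:M; exists B.
  apply/eqP; rewrite eqn_leq rank_leq_row /=.
  have E : B *m col_mx 0 1%:M = 1%:M :> 'M[K]_3.
    by rewrite mul_row_col mulmx0 mul1mx add0r.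
  by rewrite -[X in (X <= _)%N](mxrank1 K 3) -E mxrankM_maxl.
have B0 i : B i ord0 = - b (lift ord0 i) 0 / b o0 0.
  have -> : B i ord0 = B i (lshift 3 0) by congr (B _ _); apply: val_inj.
  by rewrite row_mxEl mxE.
have B1 i j : B i (lift ord0 j) = (i == j)%:R.
  have -> : B i (lift ord0 j) = B i (rshift 1 j) by congr (B _ _); apply: val_inj.
  by rewrite row_mxEr mxE.
apply/colP => i; rewrite mxE big_ord_recl B0 (bigD1 i) //= big1 => [|j /negPf ji].
  rewrite B1 eqxx mul1r addr0.
  have -> : b ord0 0 = b o0 0 by congr (b _ _); apply: val_inj.
  by rewrite divfK ?addNr ?mxE.
by rewrite B1 eq_sym ji mul0r.
Qed.

(** With B any camera centered at b, the camera B diag(x + y b_i) is centered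
at a and has the same five image points. *)
Lemma moebius_std_locus (a b : 'I_4 -> K) p : moebius_pair a b ->
  hcoords (pair_point a b) p -> centers_locus (std_points K) (std_points K) p.
Proof.
move=> ab rp; have ainj := moebius_pair_inj ab.
case: ab => a0 b0 binj [x [y [z [x0 E]]]].
have [pa pb] : (pair_point a b 0 = \col_i a i) /\ (pair_point a b 1 = \col_i b i).
  by split; apply/colP => i; rewrite !mxE.
have := rp 0; have := rp 1; rewrite pa pb => p1 p0.
split.
- move/(std_secants_coords p0) => [k [l [/eqP kl]]].
  by rewrite !mxE => /ainj.
- move/(std_secants_coords p1) => [k [l [/eqP kl]]].
  by rewrite !mxE => /binj.
have [|B cB Bb] := @camera_with_center (\col_i b i); first by rewrite mxE.
pose L := diag_mx (\row_i (x + y * b i)).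
have LE (v : 'cV_4) : L *m v = \col_i ((x + y * b i) * v i 0).
  by apply/matrixP => i j; rewrite mul_diag_mx !mxE ord1.
have uL : L \in unitmx.
  rewrite unitmxE det_diag unitfE; apply/prodf_neq0 => i _.
  by rewrite mxE; case: (E i).
have cA : camera (B *m L) by rewrite /camera mxrankMfree // row_free_unit.
have Aa : B *m L *m (\col_i a i) = 0.
  rewrite -mulmxA LE (_ : \col_i _ = z *: \col_i b i) -?scalemxAr ?Bb ?scaler0 //.
  by apply/colP => i; rewrite !mxE (E i).2.
exists (B *m L), B; split.
- by split=> //; apply/(center_line _ p0).
- by split=> //; apply/(center_line _ p1).
split.
- move=> i; apply: (std_not_center cA Aa) => [j|j k]; rewrite !mxE //; exact: ainj.
- move=> i; apply: (std_not_center cB Bb) => [j|j k]; rewrite !mxE //; exact: binj.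
exists 1%:M; rewrite det1; split=> // i.
rewrite !(camera_image_line _ (std_point_line i)) mul1mx.
suff [c c0 ->] : exists2 c, c != 0 & B *m L *m std_vec K i = c *: (B *m std_vec K i).
  by apply/eqP; rewrite eqEsubv -!memvE memvZ ?memv_line //=; apply/vlineP;
    exists c^-1; rewrite scalerA mulVf ?scale1r.
rewrite -mulmxA LE; have [i4|i4] := ltnP i 4.
  exists (x + y * b (Ordinal i4)); first by case: (E (Ordinal i4)).
  rewrite scalemxAr; congr (_ *m _); apply/colP => k; rewrite !mxE i4.
  case: eqP => [ki|_]; last by rewrite !mulr0.
  by rewrite !mulr1; congr (_ + _ * b _); apply: val_inj.
exists x => //.
rewrite (_ : \col_k _ = x *: std_vec K i + y *: \col_k b k).
  by rewrite mulmxDr -!scalemxAr Bb scaler0 addr0.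
by apply/colP => k; rewrite !mxE ltnNge i4 /= !mulr1.
Qed.

End Cameras.

(** * The centers-variety of the standard points *)

Section StandardVariety.
Variable K : numFieldType.
Local Notation X := (std_points K).
Local Notation D := (degeneracy_locus 2 (std_matrix K)).
Local Notation I := (maximal_minor_ideal (std_matrix K)).

Lemma moebius_point (a b : 'I_4 -> K) : moebius_pair a b ->
  exists2 p, centers_locus X X p & hcoords (pair_point a b) p.
Proof.
move=> ab; have r0 i : pair_point a b i != 0.
  case: ab => a0 b0 _ _; apply/eqP => /colP/(_ o0); rewrite !mxE => /eqP.
  by case: ifP => _; rewrite ?(negPf (a0 _)) ?(negPf (b0 _)).
exists (mpoint r0); last exact: hcoords_mpoint.
exact: moebius_std_locus ab (hcoords_mpoint r0).
Qed.

Lemma locus_ideal f : (forall p, centers_locus X X p -> vanishes_at f p) -> I f.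
Proof.
move=> f0; apply: moebius_ideal => a b /moebius_point [p Lp rp].
exact: f0 Lp _ rp.
Qed.

(** The degeneracy locus is closed and contains the locus of centers; conversely
a form vanishing on the locus of centers is in the ideal of minors, so it
vanishes on the degeneracy locus. *)
Theorem std_centers_variety p : centers_variety X X p <-> D p.
Proof.
split=> [|Dp Z [F [dF ZF]] LZ].
  apply; first exact: degeneracy_closed.
  move=> q Lq; have [r rq] := hcoords_exist q.
  by apply/(degeneracyP rq); apply: std_locus_relation Lq.
apply/ZF => f Ff; apply: minor_ideal_vanish Dp; apply: locus_ideal => q /LZ /ZF.
exact.
Qed.

Theorem std_vanishing_ideal f : vanishing_ideal (centers_variety X X) f <-> I f.
Proof.
split=> [V|If p /std_centers_variety]; last exact: minor_ideal_vanish.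
by apply: locus_ideal => p Lp; apply: (V p); apply: closureS.
Qed.

(** Two closed sets not containing the locus are separated from it by two forms
outside the ideal of minors, which is prime. *)
Lemma degeneracy_irreducible : irreducible D.
Proof.
split.
  have [a [b [ab _]]] : exists a b : 'I_4 -> K, moebius_pair a b /\ True.
    exists (fun i => i.+1%:R), (fun i => i.+1%:R); split => //.
    split=> [i|i|i j /eqP|]; rewrite ?Num.Theory.pnatr_eq0 //.
      by rewrite Num.Theory.eqr_nat => /eqP [] /ord_inj.
    by exists 1, 0, 1; split=> [|i]; rewrite ?oner_eq0 // mul0r addr0 oner_eq0.
  have [p Lp _] := moebius_point ab; exists p.
  by apply/std_centers_variety; apply: closureS.
move=> Z1 Z2 [F1 [dF1 ZF1]] [F2 [dF2 ZF2]] cover.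
have witness Z F : (forall p, Z p <-> forall f, F f -> vanishes_at f p) ->
    ~ (forall p, D p -> Z p) -> exists2 f, F f & ~ I f.
  move=> ZF nZ; apply: contrapT => nf; apply: nZ => p Dp; apply/ZF => f Ff.
  apply: minor_ideal_vanish Dp; apply: contrapT => nIf; apply: nf.
  by exists f.
apply: contrapT => /not_orP [n1 n2].
have [f1 Ff1 nf1] := witness _ _ ZF1 n1; have [f2 Ff2 nf2] := witness _ _ ZF2 n2.
case: (@moebius_prime K f1 f2) => // a b /moebius_point [p Lp rp].
have Dp : D p by apply/std_centers_variety; apply: closureS.
rewrite mevalM; case: (cover p Dp) => [/ZF1|/ZF2] V.
  by rewrite (V _ Ff1 _ rp) mul0r.
by rewrite (V _ Ff2 _ rp) mulr0.
Qed.

End StandardVariety.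

(** * Rationality *)

(** The coordinates of the image being forms of one multidegree, one system of
homogeneous coordinates suffices. *)
Lemma ratmap_at_coords (K : fieldType) (m n m' n' : nat)
    (phi : 'I_m' -> 'cV[{mpoly K[m * n.+1]}]_n'.+1) r
    (p : multiproj K m n) (q : multiproj K m' n') :
  ratmap phi -> hcoords r p ->
  hcoords (fun i => map_mx (meval (evalvec r)) (phi i)) q -> ratmap_at phi p q.
Proof.
move=> rphi rp rq s sp; have [c cE] := hcoords_unique rp sp.
have E i : exists k : K, k != 0 /\
    map_mx (meval (evalvec s)) (phi i) = k *: map_mx (meval (evalvec r)) (phi i).
  have [d dphi] := rphi i; exists (\prod_l c l ^+ d l); split.
    by apply/prodf_neq0 => l _; rewrite expf_neq0 ?(cE l).1.
  apply/colP => j; rewrite !mxE -(multihomog_scale c r (dphi j)).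
  by apply: meval_eq; apply: eq_evalvec => l; rewrite (cE l).2.
have [k kE] := fin_all_exists E.
move=> i; rewrite (kE i).2; have := hcoords_scale (fun i => (kE i).1) rq i.
by [].
Qed.

Section Rationality.
Variable K : numFieldType.
Local Notation S2 := {mpoly K[2 * 4]}.
Local Notation S1 := {mpoly K[1 * 5]}.
Local Notation D := (degeneracy_locus 2 (std_matrix K)).
Local Notation avar := (avar K).
Local Notation bvar := (bvar K).

Definition yvar (j : 'I_4) : S1 := 'X_(mxvec_index 0 (lift ord_max j)).
Definition cvar : S1 := 'X_(mxvec_index 0 ord_max).

Definition pole_form : S2 := avar o0 * bvar o1 - avar o1 * bvar o0.
Definition shift_form : S2 := bvar o0 * bvar o1 * (avar o1 - avar o0).

(** A Moebius pair satisfies a_i = z b_i / (x + y b_i), and is determined by b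
and by x / y = shift_form / pole_form, the fifth coordinate in P^4. *)
Definition to_P4 (i : 'I_1) : 'cV[S2]_5 :=
  \col_j (if unlift ord_max j is Some k then bvar k * pole_form else shift_form).

(** The values b_i / (c + b_i) with their common denominator removed. *)
Definition of_P4 (i : 'I_2) : 'cV[S1]_4 :=
  \col_j (if i == 0 then yvar j * \prod_(l < 3) (cvar + yvar (lift j l)) else yvar j).

Local Notation deg_a := (fun l : 'I_2 => l == 0 : nat).
Local Notation deg_b := (fun l : 'I_2 => l == 1 : nat).

Lemma multihomog_avar i : multihomog deg_a (avar i).
Proof. exact: multihomogX. Qed.
Lemma multihomog_bvar i : multihomog deg_b (bvar i).
Proof. exact: multihomogX. Qed.

Arguments multihomog_avar i : clear implicits.
Arguments multihomog_bvar i : clear implicits.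

Lemma multihomog_pole : multihomog (fun=> 1%N) pole_form.
Proof.
apply: multihomogB.
  by apply: (multihomog_ext _ (multihomogM (multihomog_avar _) (multihomog_bvar _))) => -[[|[|//]] ?].
by apply: (multihomog_ext _ (multihomogM (multihomog_avar _) (multihomog_bvar _))) => -[[|[|//]] ?].
Qed.

Lemma multihomog_shift : multihomog (fun l : 'I_2 => if l == 0 then 1%N else 2%N) shift_form.
Proof.
apply: (multihomog_ext _ (multihomogM (multihomogM (multihomog_bvar _) (multihomog_bvar _))
  (multihomogB (multihomog_avar _) (multihomog_avar _)))).
by move=> -[[|[|//]] ?].
Qed.

Lemma ratmap_to_P4 : ratmap to_P4.
Proof.
move=> i; exists (fun l : 'I_2 => if l == 0 then 1%N else 2%N) => j; rewrite mxE.
case: unliftP => [k|] _; last exact: multihomog_shift.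
by apply: (multihomog_ext _ (multihomogM (multihomog_bvar _) multihomog_pole)) => -[[|[|//]] ?].
Qed.

Lemma multihomog_yvar j : multihomog (fun=> 1%N) (yvar j).
Proof. by apply: (multihomog_ext _ (@multihomogX K 1 4 0 (lift ord_max j))) => l; rewrite ord1. Qed.

Lemma multihomog_shifted j : multihomog (fun=> 1%N) (cvar + yvar j).
Proof.
apply: multihomogD; last exact: multihomog_yvar.
by apply: (multihomog_ext _ (@multihomogX K 1 4 0 ord_max)) => l; rewrite ord1.
Qed.

Arguments multihomog_yvar j : clear implicits.
Arguments multihomog_shifted j : clear implicits.

Lemma ratmap_of_P4 : ratmap of_P4.
Proof.
move=> i; exists (fun=> if i == 0 then 4%N else 1%N) => j; rewrite mxE.
case: ifP => _; last exact: multihomog_yvar.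
apply: (multihomog_ext _ (multihomogM (multihomog_yvar j)
  (multihomog_prod (fun l => multihomog_shifted (lift j l))))).
by move=> l; rewrite sum_nat_const card_ord.
Qed.

Definition dom_D : S2 :=
  avar o0 * avar o1 * (bvar o1 - bvar o0) * (\prod_(j < 4) bvar j) * pole_form.
Definition dom_P4 : S1 :=
  (yvar o1 - yvar o0) * (\prod_(j < 4) yvar j) * \prod_(j < 4) (cvar + yvar j).

Lemma multihomog_dom_D : exists d, multihomog d dom_D.
Proof.
eexists; apply: (multihomogM _ multihomog_pole).
apply: (multihomogM _ (multihomog_prod multihomog_bvar)).
apply: (multihomogM _ (multihomogB (multihomog_bvar _) (multihomog_bvar _))).
exact: multihomogM (multihomog_avar _) (multihomog_avar _).
Qed.

Lemma multihomog_dom_P4 : exists d, multihomog d dom_P4.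
Proof.
eexists; apply: (multihomogM _ (multihomog_prod multihomog_shifted)).
apply: (multihomogM _ (multihomog_prod multihomog_yvar)).
exact: multihomogB (multihomog_yvar _) (multihomog_yvar _).
Qed.

Lemma neq0_all (I : finType) (F : I -> K) : \prod_i F i != 0 <-> forall i, F i != 0.
Proof.
split=> [/prodf_neq0 H i|H]; first exact: H.
by apply/prodf_neq0 => i _.
Qed.

Lemma to_P4_point p r : hcoords r p -> D p -> dom_D.@[evalvec r] != 0 ->
  exists q, [/\ True, nonvanishing dom_P4 q, ratmap_at to_P4 p q & ratmap_at of_P4 q p].
Proof.
move=> rp Dp; pose a := acoord r; pose b := bcoord r.
have aE i : (avar i).@[evalvec r] = a i by rewrite mevalXU evalvecE.
have bE i : (bvar i).@[evalvec r] = b i by rewrite mevalXU evalvecE.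
pose S := a o0 * b o1 - a o1 * b o0; pose P := b o0 * b o1 * (a o1 - a o0).
have SE : pole_form.@[evalvec r] = S by rewrite mevalB !mevalM !aE !bE.
have PE : shift_form.@[evalvec r] = P by rewrite !mevalM mevalB !aE !bE.
rewrite /dom_D !mevalM mevalB rmorph_prod !aE !bE SE /= !mulf_eq0 !negb_or -!andbA.
under eq_bigr => j _ do rewrite bE.
case/and5P => a0 a1 b10 /neq0_all b0 S0.
pose Q := a o0 * a o1 * (b o1 - b o0).
have Q0 : Q != 0 by rewrite !mulf_neq0.
(* The minors with the rows 0, 1, k; for k = 0, 1 this is an identity. *)
have rel k : (P + b k * S) * a k = Q * b k.
  have /rank_minorsP M0 := (degeneracyP rp).1 Dp.
  have [_ _ E2 E3] := triple_minorE a b.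
  have [] : [/\ k = o0 \/ k = o1 \/ triple_minor a b o0 o1 k = 0 & True].
    split=> //; case: k => [[|[|[|[|//]]]] h]; rewrite (bool_irrelevance h isT); auto.
      by right; right; rewrite -E3 M0.
    by right; right; rewrite -E2 M0.
  case=> [->|[->|E]] _.
  - by rewrite /P /S /Q; ring.
  - by rewrite /P /S /Q; ring.
  apply/eqP; rewrite -subr_eq0 -[X in _ == X]E /triple_minor /P /S /Q; apply/eqP; ring.
have D0 k : P + b k * S != 0.
  have : (P + b k * S) * a k != 0 by rewrite rel mulf_neq0.
  by rewrite mulf_eq0 negb_or => /andP [].
pose Y := map_mx (meval (evalvec r)) (to_P4 0).
have Yl j : Y (lift ord_max j) 0 = b j * S by rewrite !mxE liftK mevalM bE SE.
have Ym : Y ord_max 0 = P by rewrite !mxE unlift_none.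
have Y0 : forall i : 'I_1, Y != 0.
  move=> _; apply/eqP => /colP/(_ (lift ord_max o0)); rewrite Yl mxE => /eqP.
  by rewrite mulf_eq0 (negPf (b0 _)) (negPf S0).
pose q := mpoint Y0; have Yq : hcoords (fun=> Y) q := hcoords_mpoint Y0.
have yE j : (yvar j).@[evalvec (fun=> Y)] = b j * S by rewrite mevalXU evalvecE Yl.
have cE : cvar.@[evalvec (fun=> Y)] = P by rewrite mevalXU evalvecE Ym.
exists q; split=> //.
- exists (fun=> Y) => //; rewrite /dom_P4 !mevalM mevalB !rmorph_prod !yE /=.
  rewrite !mulf_neq0 //.
  + by rewrite -mulrBl mulf_neq0.
  + by apply/neq0_all => j; rewrite yE mulf_neq0.
  + by apply/neq0_all => j; rewrite mevalD cE yE.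
- apply: (ratmap_at_coords ratmap_to_P4 rp) => i; rewrite ord1; exact: (Yq 0).
apply: (ratmap_at_coords ratmap_of_P4 Yq).
pose T := \prod_(j < 4) (P + b j * S).
have T0 : T != 0 by apply/neq0_all.
pose k (i : 'I_2) := if i == 0 then S * T / Q else S.
have k0 i : k i != 0 by rewrite /k; case: ifP => _; rewrite ?mulf_neq0 ?invr_eq0.
move=> i; rewrite (_ : map_mx _ _ = k i *: r i); first exact: (hcoords_scale k0 rp).
apply/colP => j; rewrite !mxE /k; have [->|i1] := eqVneq i 0; last first.
  have -> : i = 1 by case: i i1 => [[|[|//]] h] // _; apply: val_inj.
  by rewrite yE mulrC.
rewrite mevalM yE rmorph_prod /=; under eq_bigr => l _ do rewrite mevalD cE yE.
have TE : T = (P + b j * S) * \prod_(l < 3) (P + b (lift j l) * S) by rewrite /T (bigD1_ord j).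
have -> : r 0 j 0 = Q * b j / (P + b j * S).
  by rewrite -rel mulrAC divff ?mul1r.
by rewrite TE; field; rewrite Q0 D0.
Qed.

Lemma of_P4_point q r : hcoords r q -> dom_P4.@[evalvec r] != 0 ->
  exists p, [/\ D p, nonvanishing dom_D p, ratmap_at of_P4 q p & ratmap_at to_P4 p q].
Proof.
move=> rq; pose b (j : 'I_4) : K := r 0 (lift ord_max j) 0.
pose c : K := r 0 ord_max 0.
have yE j : (yvar j).@[evalvec r] = b j by rewrite mevalXU evalvecE.
have cE : cvar.@[evalvec r] = c by rewrite mevalXU evalvecE.
rewrite /dom_P4 !mevalM mevalB !rmorph_prod !yE /= !mulf_eq0 !negb_or -!andbA.
under eq_bigr => j _ do rewrite yE.
under [X in [&& _, _ & X != 0]]eq_bigr => j _ do rewrite mevalD cE yE.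
case/and3P => b10 /neq0_all b0 /neq0_all cb0.
pose O (j : 'I_4) := \prod_(l < 3) (c + b (lift j l)).
pose T := \prod_(j < 4) (c + b j).
have T0 : T != 0 by apply/neq0_all.
have OE j : O j = T / (c + b j) by rewrite /T (bigD1_ord j) //= mulrAC divff ?mul1r.
pose a (j : 'I_4) := b j * O j.
pose s i := map_mx (meval (evalvec r)) (of_P4 i).
have s0E j : s 0 j 0 = a j.
  rewrite !mxE /= mevalM yE rmorph_prod; congr (_ * _).
  by apply: eq_bigr => l _; rewrite /= mevalD cE yE.
have s1E j : s 1 j 0 = b j by rewrite !mxE /= yE.
have s0 i : s i != 0.
  apply/eqP => /colP/(_ o0); rewrite [RHS]mxE; case: i => [[|[|//]] h].
    rewrite (_ : Ordinal h = 0); last exact: val_inj.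
    rewrite s0E /a OE => /eqP; apply/negP; rewrite !mulf_neq0 ?invr_eq0 //.
  rewrite (_ : Ordinal h = 1); last exact: val_inj.
  by rewrite s1E => /eqP; apply/negP.
pose p := mpoint s0; have sp : hcoords s p := hcoords_mpoint s0.
have aE i : (avar i).@[evalvec s] = a i by rewrite mevalXU evalvecE s0E.
have bE i : (bvar i).@[evalvec s] = b i by rewrite mevalXU evalvecE s1E.
pose S := a o0 * b o1 - a o1 * b o0.
have SE : pole_form.@[evalvec s] = S by rewrite mevalB !mevalM !aE !bE.
have S_val : S = b o0 * b o1 * T * (b o1 - b o0) / ((c + b o0) * (c + b o1)).
  by rewrite /S /a !OE; field; rewrite !cb0.
have S0 : S != 0 by rewrite S_val !(mulf_neq0, invr_eq0).
have PE : shift_form.@[evalvec s] = S * c.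
  by rewrite !mevalM mevalB !aE !bE S_val /a !OE; field; rewrite !cb0.
exists p; split.
- apply/(degeneracyP sp)/triple_rankP; exists c, 1, T; rewrite oner_eq0 orbT; split=> // j.
  by rewrite /acoord /bcoord s0E s1E /a OE; field; rewrite cb0.
- exists s => //; rewrite /dom_D !mevalM mevalB rmorph_prod !aE !bE SE /=.
  rewrite !mulf_neq0 // /a ?OE ?mulf_neq0 ?invr_eq0 //.
  by apply/neq0_all => j; rewrite bE.
- exact: (ratmap_at_coords ratmap_of_P4 rq).
apply: (ratmap_at_coords ratmap_to_P4 sp) => i.
rewrite (_ : map_mx _ _ = S *: r i); first exact: (hcoords_scale (fun=> S0) rq).
rewrite ord1; apply/colP => j; rewrite !mxE; case: unliftP => [l|] ->.
  by rewrite mevalM bE SE mulrC.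
by rewrite PE.
Qed.

Theorem degeneracy_birational : birational D (fun _ : multiproj K 1 4 => True).
Proof.
have [d2 dom2] := multihomog_dom_D; have [d1 dom1] := multihomog_dom_P4.
have fromP4 q : nonvanishing dom_P4 q -> exists p,
    [/\ D p, nonvanishing dom_D p, ratmap_at of_P4 q p & ratmap_at to_P4 p q].
  by move=> [r rq w0]; apply: of_P4_point rq w0.
pose r : 'I_1 -> 'cV[K]_5 := fun=> \col_j j.+1%:R.
have r0 i : r i != 0 by apply/eqP => /colP/(_ 0); rewrite !mxE => /eqP; rewrite oner_eq0.
have Uq : nonvanishing dom_P4 (mpoint r0).
  exists r; first exact: hcoords_mpoint.
  have yE j : (yvar j).@[evalvec r] = j.+1%:R by rewrite mevalXU evalvecE mxE lift_max.
  have cE : cvar.@[evalvec r] = 5%:R by rewrite mevalXU evalvecE mxE.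
  rewrite /dom_P4 !mevalM mevalB !rmorph_prod !yE /= !mulf_neq0 //.
  - by rewrite -natrB // Num.Theory.pnatr_eq0.
  - by apply/neq0_all => j; rewrite yE Num.Theory.pnatr_eq0.
  - by apply/neq0_all => j; rewrite mevalD cE yE -natrD Num.Theory.pnatr_eq0.
exists to_P4, of_P4, (nonvanishing dom_D), (nonvanishing dom_P4); split.
- by split; [exact: ratmap_to_P4 | exact: ratmap_of_P4].
- split; first exact: nonvanishing_open dom2.
  by have [p [Dp Up _ _]] := fromP4 _ Uq; exists p.
- by split; [exact: nonvanishing_open dom1 | exists (mpoint r0)].
- by move=> p Dp [s sp w0]; apply: to_P4_point w0.
- by move=> q _ /fromP4.
Qed.

Lemma degeneracy_rational_fold : rational_fold 4 D.
Proof.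
split; [exact: degeneracy_closed | exact: degeneracy_irreducible |].
exact: degeneracy_birational.
Qed.

End Rationality.

(** * Counting points through the roots of a separable polynomial *)

Section Counting.
Variables (K : eqType) (T : eqType) (Z : T -> Prop) (Q : K -> T -> Prop).

Lemma points_of_roots (rs : seq K) : uniq rs ->
  (forall x, x \in rs -> exists2 p, Z p & Q x p) ->
  (forall p, Z p -> exists2 x, x \in rs & Q x p) ->
  (forall x y p, Z p -> Q x p -> Q y p -> x = y) ->
  (forall x p q, Q x p -> Q x q -> p = q) ->
  exists L : seq T, [/\ uniq L, size L = size rs & forall p, p \in L <-> Z p].
Proof.
move=> urs ex cov injx injp.
suff [L [uL sL LE]] : exists L : seq T, [/\ uniq L, size L = size rs &
    forall p, p \in L <-> exists2 x, x \in rs & Z p /\ Q x p].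
  exists L; split=> // p; rewrite LE; split=> [[x _ []//]|Zp].
  by have [x xrs Qx] := cov p Zp; exists x.
elim: rs urs ex {cov} => [|x rs IH] /=; first by exists [::]; split=> // p; split=> // -[].
case/andP=> xrs urs ex; have [|L [uL sL LE]] := IH urs.
  by move=> y yrs; apply: ex; rewrite inE yrs orbT.
have [|p Zp Qp] := ex x; first by rewrite inE eqxx.
exists (p :: L); split=> /=; rewrite ?sL ?uL ?andbT //.
  apply/negP => /LE [y yrs [_ Qy]]; move: xrs.
  by rewrite (injx _ _ _ Zp Qp Qy) yrs.
move=> q; rewrite inE; split=> [/orP [/eqP ->|/LE [y yrs H]]|[y]].
- by exists x; rewrite ?inE ?eqxx.
- by exists y; rewrite ?inE ?yrs ?orbT.
rewrite inE => /orP [/eqP ->|yrs] [Zq Qq]; first by rewrite (injp _ _ _ Qq Qp) eqxx.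
by apply/orP; right; apply/LE; exists y.
Qed.

End Counting.

(** The resultant commutes with specializations that keep both degrees. *)
Lemma resultant_map (aR rR : nzRingType) (f : {rmorphism aR -> rR}) (p q : {poly aR}) :
  f (lead_coef p) != 0 -> f (lead_coef q) != 0 ->
  f (resultant p q) = resultant (map_poly f p) (map_poly f q).
Proof.
move=> fp fq; rewrite /resultant /Sylvester_mx !size_map_poly_id0 //.
rewrite -det_map_mx map_col_mx; congr (\det (col_mx _ _));
  by apply: map_lin1_mx => u; rewrite /= map_poly_rV rmorphM /= map_rVpoly.
Qed.

Section SeparableRoots.
Variable K : numClosedFieldType.

Lemma separable_roots (p : {poly K}) (n : nat) : size p = n.+1 ->
  resultant p p^`() != 0 ->
  exists rs : seq K, [/\ uniq rs, size rs = n & forall x, (x \in rs) = root p x].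
Proof.
move=> sp; rewrite resultant_eq0 -leqNgt => rp.
have p0 : p != 0 by rewrite -size_poly_eq0 sp.
have sep : separable_poly p.
  by rewrite unlock /coprimep eqn_leq rp /= size_poly_gt0 gcdp_eq0 (negPf p0).
have [rs pE] := closed_field_poly_normal p.
have lc0 : lead_coef p != 0 by rewrite lead_coef_eq0.
exists rs; split.
- rewrite -separable_prod_XsubC; move: sep; rewrite pE.
  by rewrite (eqp_separable (eqp_scale _ lc0)).
- by apply: succn_inj; rewrite -sp pE size_scale // size_prod_XsubC.
by move=> x; rewrite pE rootZ // root_prod_XsubC.
Qed.

Lemma resultant_prod (c : K) (rs : seq K) : c != 0 -> uniq rs ->
  resultant (c *: \prod_(x <- rs) ('X - x%:P)) (c *: \prod_(x <- rs) ('X - x%:P))^`() != 0.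
Proof.
move=> c0 urs; rewrite resultant_eq0 -leqNgt.
have : separable_poly (c *: \prod_(x <- rs) ('X - x%:P)).
  by rewrite (eqp_separable (eqp_scale _ c0)) separable_prod_XsubC.
by rewrite unlock /coprimep => /eqP ->.
Qed.

End SeparableRoots.

Section PolyHomogeneous.
Variables (K : numClosedFieldType) (m n' : nat).
Local Notation S := {mpoly K[m * n'.+1]}.
Implicit Types (d e : 'I_m -> nat) (P Q : {poly S}).

(** Polynomials of degree at most n with coefficients that are forms of one
multidegree; their discriminants are forms as well. *)
Definition poly_homog n d P : Prop :=
  (size P <= n.+1)%N /\ forall k, multihomog d P`_k.

Lemma poly_homog_ext n d e P : d =1 e -> poly_homog n d P -> poly_homog n e P.
Proof. by move=> de [sP dP]; split=> // k; apply: multihomog_ext (dP k). Qed.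

Lemma poly_homogC d c : multihomog d c -> poly_homog 0 d (c%:P : {poly S}).
Proof.
move=> dc; split=> [|k]; first exact: size_polyC_leq1.
by rewrite coefC; case: eqP => _ //; apply: multihomog0.
Qed.

Lemma poly_homogX d c0 c1 : multihomog d c0 -> multihomog d c1 ->
  poly_homog 1 d (c0%:P + c1 *: 'X : {poly S}).
Proof.
move=> d0 d1; split=> [|k].
  rewrite (leq_trans (size_polyD _ _)) // geq_max (leq_trans (size_polyC_leq1 _)) //=.
  by rewrite (leq_trans (size_scale_leq _ _)) ?size_polyX.
rewrite coefD coefC coefZ coefX; apply: multihomogD; first by case: eqP => _ //; apply: multihomog0.
by case: eqP => _; rewrite ?mulr1 ?mulr0 //; apply: multihomog0.
Qed.

Lemma poly_homogD n d P Q : poly_homog n d P -> poly_homog n d Q -> poly_homog n d (P + Q).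
Proof.
move=> [sP dP] [sQ dQ]; split=> [|k].
  by rewrite (leq_trans (size_polyD _ _)) // geq_max sP.
by rewrite coefD; apply: multihomogD.
Qed.

Lemma poly_homogN n d P : poly_homog n d P -> poly_homog n d (- P).
Proof.
by move=> [sP dP]; split=> [|k]; rewrite ?size_polyN // coefN; apply: multihomogN.
Qed.

Lemma poly_homogB n d P Q : poly_homog n d P -> poly_homog n d Q -> poly_homog n d (P - Q).
Proof. by move=> hP /poly_homogN; apply: poly_homogD. Qed.

Lemma poly_homogM n1 n2 d e P Q : poly_homog n1 d P -> poly_homog n2 e Q ->
  poly_homog (n1 + n2) (fun l => d l + e l)%N (P * Q).
Proof.
move=> [sP dP] [sQ dQ]; split=> [|k].
  rewrite (leq_trans (size_polyMleq _ _)) //.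
  by have := leq_add sP sQ; rewrite addSn addnS; case: (_ + _)%N.
by rewrite coefM; apply: multihomog_sum => i _; apply: multihomogM.
Qed.

Lemma poly_homog_sum (I : Type) (s : seq I) n d (F : I -> {poly S}) :
  (forall i, poly_homog n d (F i)) -> poly_homog n d (\sum_(i <- s) F i).
Proof.
move=> dF; elim/big_ind: _ => // [|P Q]; last exact: poly_homogD.
by split=> [|k]; rewrite ?size_poly0 // coef0; apply: multihomog0.
Qed.

Lemma poly_homog_prod (N : nat) d (F : 'I_N -> {poly S}) :
  (forall i, poly_homog 1 d (F i)) ->
  poly_homog N (fun l => N * d l)%N (\prod_i F i).
Proof.
elim: N F => [|N IHN] F dF; first by rewrite big_ord0; apply/poly_homogC/multihomogC.
rewrite big_ord_recl; have := poly_homogM (dF ord0) (IHN _ (fun i => dF (lift ord0 i))).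
by apply: poly_homog_ext => l; rewrite mulSn.
Qed.

(** Nonvanishing says that P has degree exactly n and simple roots. *)
Definition discriminant n P : S := P`_n * resultant P P^`().

Lemma multihomog_discriminant n d P :
  poly_homog n d P -> exists e, multihomog e (discriminant n P).
Proof.
move=> [_ dP]; have dP' k : multihomog d P^`()`_k.
  by rewrite coef_deriv; apply: multihomogMn.
eexists; apply: multihomogM (dP n) _.
apply: (@multihomog_det _ _ _ _ (fun=> d)) => i j; rewrite Sylvester_mxE.
by case: split => k; apply: multihomogMn.
Qed.

Lemma discriminant_eval n d P (v : 'I_(m * n'.+1) -> K) (p := map_poly (meval v) P) :
  poly_homog n.+1 d P ->
  (discriminant n.+1 P).@[v] != 0 <-> (size p = n.+2 /\ resultant p p^`() != 0).
Proof.
move=> [sP _]; have coef_p k : p`_k = (P`_k).@[v] by rewrite coef_map.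
have sp_le : (size p <= n.+2)%N by apply: leq_trans (size_poly _ _) sP.
have res : p`_n.+1 != 0 -> (resultant P P^`()).@[v] = resultant p p^`().
  move=> pn; have Pn : P`_n.+1 != 0 by move: pn; rewrite coef_p; apply: meval_neq0.
  have sPE : size P = n.+2.
    by apply/eqP; rewrite eqn_leq sP; apply: contraNT Pn; rewrite -ltnNge ltnS => /leq_sizeP ->.
  have dn : (P^`()`_n).@[v] != 0.
    by rewrite coef_deriv mevalMn -coef_p -mulr_natr mulf_neq0 ?Num.Theory.pnatr_eq0.
  have sdE : size P^`() = n.+1.
    have sd : (size P^`() <= n.+1)%N.
      by rewrite -ltnS -sPE lt_size_deriv // -size_poly_eq0 sPE.
    apply/eqP; rewrite eqn_leq sd /=.
    by apply: contraNT (meval_neq0 dn); rewrite -ltnNge ltnS => /leq_sizeP ->.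
  rewrite /p deriv_map (resultant_map (f := meval v)) //.
    by move: pn; rewrite coef_p lead_coefE sPE.
  by rewrite lead_coefE sdE.
rewrite /discriminant mevalM -coef_p mulf_eq0 negb_or; split=> [/andP [pn rn]|[sp rn]].
  split; last by rewrite -res.
  apply/eqP; rewrite eqn_leq sp_le; apply: contraNT pn.
  by rewrite -ltnNge ltnS => /leq_sizeP ->.
have pn : p`_n.+1 != 0 by rewrite -[n.+1]/(n.+2.-1) -sp -lead_coefE lead_coef_eq0 -size_poly_eq0 sp.
by rewrite pn res.
Qed.

End PolyHomogeneous.

(** * Hyperplanes *)

Lemma on_hyperplaneP (K : fieldType) (n : nat) (h x : pspace K n) u v :
  h = <[u]>%VS :> {vspace _} -> x = <[v]>%VS :> {vspace _} ->
  on_hyperplane h x <-> \sum_k u k 0 * v k 0 = 0.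
Proof.
move=> hu xv; have E : u^T *m v = (\sum_k u k 0 * v k 0)%:M.
  by apply/matrixP => i j; rewrite !ord1 !mxE mulr1n; apply: eq_bigr => k _; rewrite mxE.
split=> [/(_ u v)|S u' v'].
  rewrite hu xv !memv_line E => /(_ isT isT) /matrixP/(_ 0 0).
  by rewrite !mxE mulr1n.
rewrite hu xv => /vlineP [c ->] /vlineP [d ->].
rewrite [(c *: u)^T]linearZ /= -scalemxAl -scalemxAr E S.
by apply/matrixP => i j; rewrite !mxE mul0rn !mulr0.
Qed.

(** * One hyperplane in the first factor, three in the second *)

Section NormalVector.

(** The generalized cross product of the rows of a matrix. *)
Definition normal_vec (R : comNzRingType) (t : nat) (H : 'M[R]_(t, t.+1))
    (k : 'I_t.+1) : R :=
  (-1) ^+ k * \det (row' k H^T).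

Lemma normal_vec_orth (R : idomainType) (t : nat) (H : 'M[R]_(t, t.+1)) i :
  \sum_k H i k * normal_vec H k = 0.
Proof.
rewrite -[RHS](laplace_mul H^T (delta_mx i 0)) /laplace; apply: eq_bigr => k _.
rewrite /normal_vec mxE (bigD1 i) //= big1 => [|j /negPf ji].
  by rewrite !mxE !eqxx mulr1 addr0.
by rewrite !mxE ji mulr0.
Qed.

Lemma normal_vec_ker (K : numFieldType) (H : 'M[K]_(3, 4)) k (w : 'I_4 -> K) :
  normal_vec H k != 0 -> (forall i, \sum_j H i j * w j = 0) ->
  exists c, forall j, w j = c * normal_vec H j.
Proof.
move=> nk Hw; have cH : camera H.
  apply/eqP; rewrite eqn_leq rank_leq_row leqNgt -mxrank_tr; apply/negP => /rank_minorsP/(_ k).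
  by move: nk => /[swap] E; rewrite /normal_vec E mulr0 eqxx.
have mulE (v : 'I_4 -> K) : (forall i, \sum_j H i j * v j = 0) -> H *m \col_j v j = 0.
  move=> Hv; apply/colP => i; rewrite !mxE -[RHS](Hv i).
  by apply: eq_bigr => j _; rewrite mxE.
have [] := camera_kernel cH _ (mulE _ (normal_vec_orth H)) (mulE _ Hw).
  by apply: contra_neq nk => /colP/(_ k); rewrite !mxE.
by move=> c /colP cE; exists c => j; have := cE j; rewrite !mxE.
Qed.

Lemma map_normal_vec (R S : comNzRingType) (f : {rmorphism R -> S}) (t : nat)
  (H : 'M[R]_(t, t.+1)) k : f (normal_vec H k) = normal_vec (map_mx f H) k.
Proof.
rewrite /normal_vec rmorphM rmorph_sign -det_map_mx; congr (_ * \det _).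
by apply/matrixP => i j; rewrite !mxE.
Qed.

End NormalVector.

Section TwistedCubic.
Variables (K : numFieldType) (b : 'I_4 -> K).
Hypotheses (b0 : forall i, b i != 0) (binj : injective b).

(** For fixed b, the points a such that (a, b) is in the degeneracy locus form
a twisted cubic through the coordinate points and b; the point b itself is the
value of this parametrization at infinity. *)
Definition cubic_point (x : K) (i : 'I_4) : K :=
  b i * \prod_(l < 3) (x * b o0 + b (lift i l)).

Let T x := \prod_(l < 4) (x * b o0 + b l).

Lemma cubic_point_rel x i : (x * b o0 + b i) * cubic_point x i = T x * b i.
Proof. by rewrite /T (bigD1_ord i) //= /cubic_point; ring. Qed.

(** At most one of the numbers x b_0 + b_l is zero, since b is injective. *)
Lemma cubic_point_pivot x : exists2 k, cubic_point x k != 0 &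
  forall l, l != k -> x * b o0 + b l != 0.
Proof.
have [k kE] : exists k, forall l, l != k -> x * b o0 + b l != 0.
  have [/existsP [k /eqP xk]|/existsPn nk] := boolP [exists k, x * b o0 + b k == 0].
    exists k => l lk; apply: contra_neq lk => xl; apply: binj.
    by apply: (addrI (x * b o0)); rewrite xl xk.
  by exists o0 => l _; apply: nk.
exists k => //; rewrite /cubic_point mulf_neq0 //; apply/prodf_neq0 => l _.
by apply: kE; rewrite eq_sym neq_lift.
Qed.

Lemma cubic_point_complete x z (a : 'I_4 -> K) :
  (forall i, (x * b o0 + b i) * a i = z * b i) ->
  exists c, forall i, a i = c * cubic_point x i.
Proof.
move=> aE; have [k ck xl] := cubic_point_pivot x.
exists (a k / cubic_point x k) => l; have [->|lk] := eqVneq l k; first by rewrite divfK.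
apply: (mulfI (xl l lk)); rewrite aE.
rewrite mulrCA cubic_point_rel; apply: (mulfI ck); apply: (mulfI (b0 k)).
rewrite [RHS](_ : _ = a k * (T x * b k) * b l); last by field.
rewrite -cubic_point_rel; transitivity ((x * b o0 + b k) * a k * cubic_point x k * b l).
  by rewrite aE; ring.
by ring.
Qed.

Lemma triple_rank_cubic (a : 'I_4 -> K) :
  (\rank (triple_matrix a b) < 3)%N ->
  (exists c, forall i, a i = c * b i) \/
  (exists x c, forall i, a i = c * cubic_point x i).
Proof.
case/triple_rankP => x [y [z [xyz E]]]; have [y0|y0] := eqVneq y 0.
  have x0 : x != 0.
    apply/eqP => x0; move: xyz; rewrite x0 y0 eqxx /= => /negP; apply.
    have := E o0; rewrite x0 y0 mul0r addr0 mul0r => /esym/eqP.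
    by rewrite mulf_eq0 (negPf (b0 _)) orbF.
  left; exists (z / x) => i; apply: (mulfI x0); have := E i; rewrite y0 mul0r addr0 => ->.
  by field.
right; exists (x / (y * b o0)); apply: (@cubic_point_complete _ (z / y)) => i.
have bo := b0 o0; apply: (mulfI y0); rewrite [RHS](_ : _ = z * b i); last by field.
by rewrite -E; field; rewrite y0 bo.
Qed.

Lemma cubic_triple_rank x : (\rank (triple_matrix (cubic_point x) b) < 3)%N.
Proof.
apply/triple_rankP; exists (x * b o0), 1, (T x); rewrite oner_eq0 orbT; split=> // i.
by rewrite mul1r cubic_point_rel.
Qed.

(** Its roots are the parameters of the points of the twisted cubic on the
hyperplane with coefficients g. *)
Definition cubic_section (g : 'I_4 -> K) : {poly K} :=
  \sum_i (g i * b i)%:P * \prod_(l < 3) ((b (lift i l))%:P + b o0 *: 'X).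

Lemma cubic_section_eval g x :
  (cubic_section g).[x] = \sum_i g i * cubic_point x i.
Proof.
rewrite horner_sum; apply: eq_bigr => i _.
rewrite hornerM hornerC horner_prod -mulrA; congr (_ * (_ * _)).
by apply: eq_bigr => l _; rewrite !hornerE /= mulrC addrC.
Qed.

(** Two parameters of a would make a proportional to b, which is not on the
hyperplane g. *)
Lemma cubic_point_inj g x y c (a : 'I_4 -> K) : \sum_i g i * b i != 0 ->
  \sum_i g i * a i = 0 -> (exists i, a i != 0) ->
  a =1 cubic_point x -> (forall i, a i = c * cubic_point y i) -> x = y.
Proof.
move=> gb ga [i0 ai0] ax ay; apply/eqP; rewrite -subr_eq0; apply/negPn/negP => xy.
have E i : a i * ((x - y) * b o0) = (T x - c * T y) * b i.
  transitivity ((x * b o0 + b i) * a i - (y * b o0 + b i) * a i); first by ring.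
  rewrite {1}ax cubic_point_rel ay mulrCA cubic_point_rel; ring.
have : (T x - c * T y) * \sum_i g i * b i = 0.
  rewrite mulr_sumr; transitivity ((x - y) * b o0 * \sum_i g i * a i); last by rewrite ga mulr0.
  by rewrite mulr_sumr; apply: eq_bigr => i _; rewrite mulrCA -E; ring.
move/eqP; rewrite mulf_eq0 (negPf gb) orbF => /eqP T0.
have /eqP := E i0; rewrite T0 mul0r mulf_eq0 (negPf ai0) /= mulf_eq0 (negPf xy).
by rewrite (negPf (b0 _)).
Qed.

End TwistedCubic.

Section Intersection13.
Variable K : numClosedFieldType.
Local Notation S := {mpoly K[(1 + 3) * 4]}.
Local Notation D := (degeneracy_locus 2 (std_matrix K)).
Local Notation hyp i := (lshift 3 (i : 'I_1)).
Local Notation hyq i := (rshift 1 (i : 'I_3)).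

Definition hvar (i : 'I_(1 + 3)) (j : 'I_4) : S := 'X_(mxvec_index i j).

Lemma multihomog_hvar i j : multihomog (fun l => l == i : nat) (hvar i j).
Proof. exact: multihomogX. Qed.
Arguments multihomog_hvar i j : clear implicits.

Definition gform j : S := hvar (hyp 0) j.
Definition bform (k : 'I_4) : S := normal_vec (\matrix_(i < 3, j < 4) hvar (hyq i) j) k.

Lemma multihomog_bform k :
  multihomog (fun l => \sum_(i < 3) (l == hyq i))%N (bform k).
Proof.
apply: multihomog_sign; rewrite -det_tr; apply: multihomog_det => i j.
rewrite !mxE; exact: multihomog_hvar.
Qed.
Arguments multihomog_bform k : clear implicits.

Definition section_form : {poly S} :=
  \sum_i (gform i * bform i)%:P *
    \prod_(l < 3) ((bform (lift i l))%:P + bform o0 *: 'X).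

Lemma poly_homog_section : exists d, poly_homog 3 d section_form.
Proof.
eexists; apply: poly_homog_sum => i; apply: (@poly_homogM K (1 + 3) 3 0 3).
  apply: poly_homogC; exact: (multihomogM (multihomog_hvar (hyp 0) i) (multihomog_bform i)).
by apply: poly_homog_prod => l; apply: poly_homogX; apply: multihomog_bform.
Qed.

(** Nonvanishing means: the point b on the three hyperplanes has distinct
nonzero coordinates and is not on the first hyperplane, and the section of
the twisted cubic is reduced and avoids the parameter at infinity. *)
Definition nondegenerate13 : S :=
  discriminant 3 section_form * (\sum_i gform i * bform i) *
  (\prod_(i < 4) bform i) * \prod_(i < 4) \prod_(l < 3) (bform i - bform (lift i l)).

Lemma multihomog_nondegenerate13 : exists d, multihomog d nondegenerate13.
Proof.
have [d0 /multihomog_discriminant [d dd]] := poly_homog_section.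
eexists; apply: multihomogM; last first.
  apply: multihomog_prod => i; apply: multihomog_prod => l.
  by apply: multihomogB; apply: multihomog_bform.
apply: (multihomogM _ (multihomog_prod multihomog_bform)).
apply: (multihomogM dd); apply: multihomog_sum => i _.
exact: (multihomogM (multihomog_hvar (hyp 0) i) (multihomog_bform i)).
Qed.

Section Evaluation.
Variable r : 'I_(1 + 3) -> 'cV[K]_4.

Definition gvec (j : 'I_4) : K := r (hyp 0) j 0.
Definition bmat : 'M[K]_(3, 4) := \matrix_(i, j) r (hyq i) j 0.
Definition bvec : 'I_4 -> K := normal_vec bmat.

Lemma bform_eval k : (bform k).@[evalvec r] = bvec k.
Proof.
rewrite map_normal_vec; congr (normal_vec _ k); apply/matrixP => i j.
by rewrite !mxE /= mevalXU evalvecE.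
Qed.

Lemma gform_eval k : (gform k).@[evalvec r] = gvec k.
Proof. by rewrite mevalXU evalvecE. Qed.

Lemma section_form_eval :
  map_poly (meval (evalvec r)) section_form = cubic_section bvec gvec.
Proof.
rewrite /section_form; move: bform gform bform_eval gform_eval => bf gf bE gE.
rewrite rmorph_sum; apply: eq_bigr => i _; rewrite rmorphM rmorph_prod /= map_polyC.
rewrite /= mevalM bE gE; congr (_ * _); apply: eq_bigr => l _.
by rewrite rmorphD /= map_polyC map_polyZ map_polyX /= !bE.
Qed.

Lemma nondegenerate13_eval : nondegenerate13.@[evalvec r] != 0 <->
  [/\ (size (cubic_section bvec gvec) = 4%N /\
       resultant (cubic_section bvec gvec) (cubic_section bvec gvec)^`() != 0),
      \sum_i gvec i * bvec i != 0, forall i, bvec i != 0 & injective bvec].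
Proof.
have [d dd] := poly_homog_section.
have E1 : (\sum_i gform i * bform i).@[evalvec r] = \sum_i gvec i * bvec i.
  by rewrite raddf_sum; apply: eq_bigr => i _; rewrite /= mevalM gform_eval bform_eval.
have E2 : (\prod_(i < 4) bform i).@[evalvec r] = \prod_i bvec i.
  by rewrite rmorph_prod; apply: eq_bigr => i _; rewrite /= bform_eval.
have E3 : (\prod_(i < 4) \prod_(l < 3) (bform i - bform (lift i l))).@[evalvec r]
    = \prod_i \prod_(l < 3) (bvec i - bvec (lift i l)).
  move: bform bform_eval => bf bE; rewrite rmorph_prod; apply: eq_bigr => i _.
  by rewrite /= rmorph_prod; apply: eq_bigr => l _; rewrite /= mevalB !bE.
have := discriminant_eval (evalvec r) dd.
rewrite /nondegenerate13; move: (discriminant _ _) => Dl DlE; rewrite !mevalM E1 E2 E3 !mulf_eq0 !negb_or -!andbA.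
rewrite -section_form_eval; split=> [/and4P [/DlE H0 H1 H2 H3]|[H0 H1 H2 H3]].
  split=> //; first by move=> i; move/prodf_neq0: H2 => /(_ i isT).
  move=> i j; have [//|ij] := eqVneq i j => bij.
  move/prodf_neq0: H3 => /(_ i isT) /prodf_neq0.
  case/unlift_some: ij => l -> _ in bij *.
  by move=> /(_ l isT); rewrite bij subrr eqxx.
apply/and4P; split=> //; first exact/DlE.
  by apply/prodf_neq0 => i _.
apply/prodf_neq0 => i _; apply/prodf_neq0 => l _; rewrite subr_eq0.
by apply/eqP => /H3 /eqP; rewrite (negPf (neq_lift i l)).
Qed.

End Evaluation.

(** The last three hyperplanes meet in (1, 2, 3, 4), and the first one is chosen
to cut the twisted cubic in the parameters 0, 1 and -5. *)
Definition example13 : 'I_(1 + 3) -> 'cV[K]_4 := fun i =>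
  \col_j ((nth 0 (nth [::] [:: [:: 8; -27; 24; -5]; [:: -2; 1; 0; 0];
                              [:: -3; 0; 1; 0]; [:: -4; 0; 0; 1]] i) j : int)%:~R).

Lemma bvec_example13 k : bvec example13 k = k.+1%:R.
Proof.
rewrite /bvec /normal_vec det_mx33 !mxE.
by case: k => [[|[|[|[|//]]]] h] /=; rewrite /bump /=; ring.
Qed.

Lemma nondegenerate13_example : nondegenerate13.@[evalvec example13] != 0.
Proof.
have bE := bvec_example13; apply/nondegenerate13_eval; split.
- have -> : cubic_section (bvec example13) (gvec example13) =
      6%:R *: \prod_(x <- [:: 0; 1; - 5%:R]) ('X - x%:P).
    move: (bvec example13) bE => bb bE.
    apply/eqP; rewrite -subr_eq0; apply/eqP/poly_fun_eq0 => t.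
    rewrite hornerD hornerN cubic_section_eval /cubic_point hornerZ !big_cons big_nil.
    rewrite !hornerE !big_ord_recl !big_ord0 !bE /gvec !mxE /= /bump /=; ring.
  split; last first.
    apply: resultant_prod; rewrite ?Num.Theory.pnatr_eq0 //=.
    rewrite !inE eq_sym oner_eq0 eq_sym oppr_eq0 Num.Theory.pnatr_eq0 /=.
    by rewrite -addr_eq0 -(natrD _ 1 5) Num.Theory.pnatr_eq0.
  by rewrite size_scale ?Num.Theory.pnatr_eq0 // size_prod_XsubC.
- rewrite [X in X != 0](_ : _ = 6%:R) ?Num.Theory.pnatr_eq0 //.
  by rewrite !big_ord_recl big_ord0 !bE /gvec !mxE /= /bump /=; ring.
- by move=> i; rewrite bE Num.Theory.pnatr_eq0.
by move=> i j; rewrite !bE => /eqP; rewrite Num.Theory.eqr_nat => /eqP [] /ord_inj.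
Qed.

(** The three hyperplanes of the second factor fix b; the points a are then those
of a twisted cubic on a plane. *)
Theorem intersection13 : intersection_number D 1 3 3.
Proof.
have [d dw] := multihomog_nondegenerate13.
apply: (generic_nonvanishing dw _ nondegenerate13_example).
  move=> i; apply/eqP => /colP E.
  suff [j] : exists j, example13 i j 0 != 0 by rewrite E mxE eqxx.
  case: i {E} => [[|[|[|[|//]]]] h]; [exists o0|exists o1|exists o2|exists o3];
    by rewrite mxE /= ?oner_eq0 // intr_eq0.
move=> h r rh /nondegenerate13_eval [[sz res] gb b0 binj].
set b := bvec r in gb b0 binj sz res *; set g := gvec r in gb sz res *.
have [rs [urs srs rsE]] := separable_roots sz res.
have hp (p : multiproj K 2 3) s : hcoords s p ->
    ((forall i, on_hyperplane (h (hyp i)) (p 0)) /\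
     (forall j, on_hyperplane (h (hyq j)) (p 1))) <->
    (\sum_k g k * s 0 k 0 = 0 /\ exists2 c, c != 0 & forall k, s 1 k 0 = c * b k).
  move=> sp; split=> [[H0 H1]|[H0 [c c0 H1]]].
    split; first by apply/(on_hyperplaneP (rh (hyp 0)) (sp 0)).
    have [|c cE] := normal_vec_ker (b0 o0) (w := fun k => s 1 k 0).
      move=> i; have /(on_hyperplaneP (rh (hyq i)) (sp 1)) E := H1 i.
      by rewrite -[RHS]E; apply: eq_bigr => k _; rewrite mxE.
    exists c => //; apply: contra_neq (hcoords_neq0 1 sp) => c0.
    by apply/colP => k; rewrite cE c0 mul0r mxE.
  split=> i; apply/(on_hyperplaneP (rh _) (sp _)); first by rewrite ord1.
  have := normal_vec_orth (bmat r) i; move/(congr1 ( *%R c)).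
  rewrite mulr0 mulr_sumr => E; rewrite -[RHS]E; apply: eq_bigr => k _.
  by rewrite H1 mxE mulrCA.
pose Q x p := hcoords (pair_point (cubic_point b x) b) p.
have [L [uL sL LE]] : exists L : seq (multiproj K 2 3), [/\ uniq L, size L = size rs &
    forall p, p \in L <-> [/\ D p, forall i, on_hyperplane (h (hyp i)) (p 0) &
      forall j, on_hyperplane (h (hyq j)) (p 1)]].
  apply: (@points_of_roots _ _ _ Q) => //.
  - move=> x; rewrite rsE => /eqP; rewrite cubic_section_eval => gx.
    have s0 i : pair_point (cubic_point b x) b i != 0.
      have [k ck _] := cubic_point_pivot b0 binj x.
      apply/eqP => /colP; case: (eqVneq i 0) => [->|i1] E.
        by move: (E k); rewrite !mxE => /eqP; rewrite (negPf ck).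
      by move: (E o0); rewrite !mxE (negPf i1) => /eqP; rewrite (negPf (b0 _)).
    have sp := hcoords_mpoint s0; exists (mpoint s0); last exact: sp.
    have [H0 H1] : (forall i, on_hyperplane (h (hyp i)) (mpoint s0 0)) /\
        (forall j, on_hyperplane (h (hyq j)) (mpoint s0 1)).
      apply/(hp _ _ sp); split.
        by rewrite -[RHS]gx; apply: eq_bigr => k _; rewrite mxE.
      by exists 1; rewrite ?oner_eq0 // => k; rewrite mxE mul1r.
    split=> //; apply/(degeneracyP sp); have := cubic_triple_rank b x.
    by congr (\rank _ < 3)%N; apply/matrixP => i j; rewrite !mxE /acoord /bcoord !mxE.
  - move=> p [Dp H0 H1]; have [s sp] := hcoords_exist p.
    have [gs [c c0 cE]] := (hp _ _ sp).1 (conj H0 H1).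
    have sb : bcoord s =1 (fun k => c * b k) by move=> k; exact: cE.
    have Dr : (\rank (triple_matrix (acoord s) b) < 3)%N.
      have c1 : c^-1 != 0 by rewrite invr_eq0.
      have := triple_rank_scale (oner_neq0 K) c1 ((degeneracyP sp).1 Dp).
      congr (\rank _ < 3)%N; apply/matrixP => i j; rewrite !mxE sb mul1r.
      by rewrite mulKf.
    have [[e ae]|[x [e ae]]] := triple_rank_cubic b0 binj Dr.
      have a0 : s 0 != 0 := hcoords_neq0 0 sp.
      case/eqP: a0; apply/colP => k; have := ae k; rewrite /acoord mxE => ->.
      suff -> : e = 0 by rewrite mul0r.
      have : e * \sum_k g k * b k = 0.
        rewrite mulr_sumr -[RHS]gs; apply: eq_bigr => l _.
        by have := ae l; rewrite /acoord => ->; rewrite mulrCA.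
      by move/eqP; rewrite mulf_eq0 (negPf gb) orbF => /eqP.
    have e0 : e != 0.
      apply: contra_neq (hcoords_neq0 0 sp) => e0.
      by apply/colP => k; have := ae k; rewrite /acoord mxE e0 mul0r.
    exists x.
      rewrite rsE; apply/eqP; rewrite cubic_section_eval; apply: (mulfI e0).
      rewrite mulr0 mulr_sumr -[RHS]gs; apply: eq_bigr => k _.
      by have := ae k; rewrite /acoord => ->; rewrite mulrCA.
    pose c' (i : 'I_2) := if i == 0 then e^-1 else c^-1.
    have c'0 i : c' i != 0 by rewrite /c'; case: ifP; rewrite invr_eq0.
    have := hcoords_scale c'0 sp; congr hcoords; apply/funext => i; apply/colP => k.
    rewrite !mxE /c'; have [->|i1] := eqVneq i 0.
      by have := ae k; rewrite /acoord => ->; rewrite mulKf.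
    have -> : i = 1 by case: i i1 => [[|[|//]] ?] // _; apply: val_inj.
    by rewrite cE mulKf.
  - move=> x y p [Dp H0 H1] Qx Qy.
    have [gx _] := (hp _ _ Qx).1 (conj H0 H1).
    have [c cE] := hcoords_unique Qy Qx.
    have [k0 ck0 _] := cubic_point_pivot b0 binj x.
    apply: (@cubic_point_inj _ b b0 g x y (c 0) (cubic_point b x) gb) => //.
    + by rewrite -[RHS]gx; apply: eq_bigr => k _; rewrite mxE.
    + by exists k0.
    by move=> k; have /colP/(_ k) := (cE 0).2; rewrite !mxE.
  by move=> x p q; apply: hcoords_inj.
by exists L; rewrite uL sL srs.
Qed.

End Intersection13.

(** * Two hyperplanes in each factor *)

Section LinePairs.
Variable R : comNzRingType.
Implicit Types (u v a : 'I_4 -> R) (l m : nat -> R).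

(** The line on the hyperplanes u and v, as a graph over the first two
coordinates scaled by the Pluecker coordinate u_2 v_3 - u_3 v_2. *)
Definition line_coef u v : nat -> R := nth 0 [:: u o2 * v o3 - u o3 * v o2;
  u o3 * v o0 - u o0 * v o3; u o3 * v o1 - u o1 * v o3;
  u o0 * v o2 - u o2 * v o0; u o1 * v o2 - u o2 * v o1].

Definition line_point l (x0 x1 : R) (i : 'I_4) : R :=
  nth 0 [:: l 0%N * x0; l 0%N * x1; l 1%N * x0 + l 2%N * x1; l 3%N * x0 + l 4%N * x1] i.

(** For a given a and a point b of the line m with parameters y, the relation
x a_i + t a_i b_i + s b_i = 0 at i = 0, 1 eliminates the products s y; what is
left is a pair of linear equations in (x, m_0 t y_0, m_0 t y_1). *)
Definition row2 m a (j : nat) : R := nth 0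
  [:: m 0%N * a o2 - m 1%N * a o0 - m 2%N * a o1; m 1%N * (a o2 - a o0); m 2%N * (a o2 - a o1)] j.
Definition row3 m a (j : nat) : R := nth 0
  [:: m 0%N * a o3 - m 3%N * a o0 - m 4%N * a o1; m 3%N * (a o3 - a o0); m 4%N * (a o3 - a o1)] j.

Definition ker0 m a := row2 m a 1 * row3 m a 2 - row2 m a 2 * row3 m a 1.
Definition ker1 m a := row2 m a 2 * row3 m a 0 - row2 m a 0 * row3 m a 2.
Definition ker2 m a := row2 m a 0 * row3 m a 1 - row2 m a 1 * row3 m a 0.

(** The solution (x, m_0 t y_0, m_0 t y_1) and the eliminated (m_0 s y_0, m_0 s y_1)
come from one y exactly when this determinant vanishes. *)
Definition quintic m a :=
  a o1 * ker1 m a * (ker0 m a + ker2 m a) - a o0 * ker2 m a * (ker0 m a + ker1 m a).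

End LinePairs.

Section MapLine.
Variables (R S : comNzRingType) (f : {rmorphism R -> S}).

Lemma eq_line_point (l l' : nat -> S) x0 x1 i : l =1 l' ->
  line_point l x0 x1 i = line_point l' x0 x1 i.
Proof. by move=> E; rewrite /line_point !E. Qed.

Lemma eq_quintic (m m' : nat -> S) a a' : m =1 m' -> a =1 a' ->
  quintic m a = quintic m' a'.
Proof. by move=> E F; rewrite /quintic /ker0 /ker1 /ker2 /row2 /row3 /= !E !F. Qed.

Lemma map_line_coef (u v : 'I_4 -> R) k :
  f (line_coef u v k) = line_coef (f \o u) (f \o v) k.
Proof.
case: k => [|[|[|[|[|k]]]]]; rewrite /line_coef /= ?rmorphB ?rmorphM //.
by rewrite !nth_nil rmorph0.
Qed.

Lemma map_line_point (l : nat -> R) x0 x1 i :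
  f (line_point l x0 x1 i) = line_point (f \o l) (f x0) (f x1) i.
Proof.
by case: i => [[|[|[|[|//]]]] ?]; rewrite /line_point /= ?rmorphD ?rmorphM.
Qed.

Lemma map_quintic m (a : 'I_4 -> R) : f (quintic m a) = quintic (f \o m) (f \o a).
Proof.
by rewrite /quintic /ker0 /ker1 /ker2 /row2 /row3 /= !(rmorphB, rmorphD, rmorphM).
Qed.

End MapLine.

Lemma quintic_scale (R : comNzRingType) (m : nat -> R) (a : 'I_4 -> R) c :
  quintic m (fun i => c * a i) = c ^+ 5 * quintic m a.
Proof. by rewrite /quintic /ker0 /ker1 /ker2 /row2 /row3 /=; ring. Qed.

Lemma sum4 (R : nmodType) (F : 'I_4 -> R) :
  \sum_i F i = F o0 + F o1 + F o2 + F o3.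
Proof.
rewrite !big_ord_recl big_ord0 addr0 !addrA.
by congr (F _ + F _ + F _ + F _); apply: val_inj.
Qed.

Lemma line_pointP (K : fieldType) (u v a : 'I_4 -> K) (l := line_coef u v) :
  l 0%N != 0 -> (\sum_i u i * a i = 0 /\ \sum_i v i * a i = 0) <->
  a =1 line_point l (a o0 / l 0%N) (a o1 / l 0%N).
Proof.
move=> l0; rewrite !sum4; split=> [[U V] i|aE].
  case: i => [[|[|[|[|//]]]] h]; rewrite (bool_irrelevance h isT) /line_point /=.
  - by rewrite mulrC divfK.
  - by rewrite mulrC divfK.
  - apply: (mulfI l0); rewrite [RHS](_ : _ = l 1%N * a o0 + l 2%N * a o1); last by field.
    apply/eqP; rewrite -subr_eq0; apply/eqP; rewrite /l /line_coef /=.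
    transitivity (v o3 * (u o0 * a o0 + u o1 * a o1 + u o2 * a o2 + u o3 * a o3)
      - u o3 * (v o0 * a o0 + v o1 * a o1 + v o2 * a o2 + v o3 * a o3)); first by ring.
    by rewrite U V; ring.
  - apply: (mulfI l0); rewrite [RHS](_ : _ = l 3%N * a o0 + l 4%N * a o1); last by field.
    apply/eqP; rewrite -subr_eq0; apply/eqP; rewrite /l /line_coef /=.
    transitivity (u o2 * (v o0 * a o0 + v o1 * a o1 + v o2 * a o2 + v o3 * a o3)
      - v o2 * (u o0 * a o0 + u o1 * a o1 + u o2 * a o2 + u o3 * a o3)); first by ring.
    by rewrite U V; ring.
have := aE o2; have := aE o3; rewrite /line_point /= => -> ->.
by split; move: l0; rewrite /l /line_coef /= => l0; field.
Qed.

Section LinePairSolve.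
Variables (K : fieldType) (m : nat -> K) (a : 'I_4 -> K).
Hypotheses (m0 : m 0%N != 0) (a01 : (a o0 != 0) || (a o1 != 0)).

Definition related (y0 y1 x t s : K) : Prop :=
  forall i, x * a i + (t * a i + s) * line_point m y0 y1 i = 0.

Lemma related_rows y0 y1 x t s :
  related y0 y1 x t s <->
  [/\ m 0%N * s * y0 = - a o0 * (x + m 0%N * t * y0),
      m 0%N * s * y1 = - a o1 * (x + m 0%N * t * y1),
      row2 m a 0 * x + row2 m a 1 * (m 0%N * t * y0) + row2 m a 2 * (m 0%N * t * y1) = 0 &
      row3 m a 0 * x + row3 m a 1 * (m 0%N * t * y0) + row3 m a 2 * (m 0%N * t * y1) = 0].
Proof.
have R2 : m 0%N * s * y0 = - a o0 * (x + m 0%N * t * y0) ->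
    m 0%N * s * y1 = - a o1 * (x + m 0%N * t * y1) ->
    row2 m a 0 * x + row2 m a 1 * (m 0%N * t * y0) + row2 m a 2 * (m 0%N * t * y1) =
    m 0%N * (x * a o2 + (t * a o2 + s) * (m 1%N * y0 + m 2%N * y1)).
  move=> E0 E1; rewrite /row2 /=.
  transitivity (m 0%N * (x * a o2 + t * a o2 * (m 1%N * y0 + m 2%N * y1))
    + m 1%N * (- a o0 * (x + m 0%N * t * y0)) + m 2%N * (- a o1 * (x + m 0%N * t * y1))).
    by ring.
  by rewrite -E0 -E1; ring.
have R3 : m 0%N * s * y0 = - a o0 * (x + m 0%N * t * y0) ->
    m 0%N * s * y1 = - a o1 * (x + m 0%N * t * y1) ->
    row3 m a 0 * x + row3 m a 1 * (m 0%N * t * y0) + row3 m a 2 * (m 0%N * t * y1) =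
    m 0%N * (x * a o3 + (t * a o3 + s) * (m 3%N * y0 + m 4%N * y1)).
  move=> E0 E1; rewrite /row3 /=.
  transitivity (m 0%N * (x * a o3 + t * a o3 * (m 3%N * y0 + m 4%N * y1))
    + m 3%N * (- a o0 * (x + m 0%N * t * y0)) + m 4%N * (- a o1 * (x + m 0%N * t * y1))).
    by ring.
  by rewrite -E0 -E1; ring.
split=> [rel|[E0 E1 E2 E3] i].
  have E0 : m 0%N * s * y0 = - a o0 * (x + m 0%N * t * y0).
    by apply/eqP; rewrite -subr_eq0 -[X in _ == X](rel o0) /line_point /=; apply/eqP; ring.
  have E1 : m 0%N * s * y1 = - a o1 * (x + m 0%N * t * y1).
    by apply/eqP; rewrite -subr_eq0 -[X in _ == X](rel o1) /line_point /=; apply/eqP; ring.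
  have := rel o2; have := rel o3; rewrite /line_point /= => r3 r2.
  by split=> //; rewrite ?R2 ?R3 // ?r2 ?r3 mulr0.
case: i => [[|[|[|[|//]]]] h]; rewrite (bool_irrelevance h isT) /line_point /=.
- by apply/eqP; rewrite -[X in _ == X](subrr (m 0%N * s * y0)) {2}E0; apply/eqP; ring.
- by apply/eqP; rewrite -[X in _ == X](subrr (m 0%N * s * y1)) {2}E1; apply/eqP; ring.
- by apply: (mulfI m0); rewrite mulr0 -R2.
- by apply: (mulfI m0); rewrite mulr0 -R3.
Qed.

Lemma related_nonzero y0 y1 x t s : related y0 y1 x t s ->
  [|| x != 0, t != 0 | s != 0] -> (t != 0) || (s != 0).
Proof.
move=> rel; case/or3P => [x0|->|->]; rewrite ?orbT //.
apply: contraNT x0; rewrite negb_or !negbK => /andP [/eqP t0 /eqP s0].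
have xa i : (x == 0) || (a i == 0).
  by rewrite -mulf_eq0; apply/eqP; rewrite -[RHS](rel i) t0 s0; ring.
by case/orP: a01 => /negPf ai; [have := xa o0 | have := xa o1]; rewrite ai orbF.
Qed.

Lemma related_ker y0 y1 x t s : related y0 y1 x t s ->
  [|| ker0 m a != 0, ker1 m a != 0 | ker2 m a != 0] ->
  exists c, [/\ x = c * ker0 m a, m 0%N * t * y0 = c * ker1 m a &
                m 0%N * t * y1 = c * ker2 m a].
Proof.
case/related_rows => _ _; rewrite /ker0 /ker1 /ker2.
move: (row2 m a 0) (row2 m a 1) (row2 m a 2) (row3 m a 0) (row3 m a 1) (row3 m a 2).
move: (m 0%N * t * y0) (m 0%N * t * y1) => z1 z2 p0 p1 p2 q0 q1 q2 E2 E3.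
have E01 : (p1 * q2 - p2 * q1) * z1 = (p2 * q0 - p0 * q2) * x.
  apply/eqP; rewrite -subr_eq0; apply/eqP.
  transitivity (q2 * (p0 * x + p1 * z1 + p2 * z2) - p2 * (q0 * x + q1 * z1 + q2 * z2)).
    by ring.
  by rewrite E2 E3; ring.
have E02 : (p1 * q2 - p2 * q1) * z2 = (p0 * q1 - p1 * q0) * x.
  apply/eqP; rewrite -subr_eq0; apply/eqP.
  transitivity (p1 * (q0 * x + q1 * z1 + q2 * z2) - q1 * (p0 * x + p1 * z1 + p2 * z2)).
    by ring.
  by rewrite E2 E3; ring.
have E12 : (p2 * q0 - p0 * q2) * z2 = (p0 * q1 - p1 * q0) * z1.
  apply/eqP; rewrite -subr_eq0; apply/eqP.
  transitivity (q0 * (p0 * x + p1 * z1 + p2 * z2) - p0 * (q0 * x + q1 * z1 + q2 * z2)).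
    by ring.
  by rewrite E2 E3; ring.
case/or3P => k0.
- exists (x / (p1 * q2 - p2 * q1)); split; first by rewrite divfK.
    by apply: (mulfI k0); rewrite E01; field.
  by apply: (mulfI k0); rewrite E02; field.
- exists (z1 / (p2 * q0 - p0 * q2)); split; last 2 first.
  + by rewrite divfK.
  + by apply: (mulfI k0); rewrite E12; field.
  by apply: (mulfI k0); rewrite -E01; field.
exists (z2 / (p0 * q1 - p1 * q0)); split; last by rewrite divfK.
  by apply: (mulfI k0); rewrite -E02; field.
by apply: (mulfI k0); rewrite -E12; field.
Qed.

Lemma related_quintic y0 y1 x t s : related y0 y1 x t s ->
  (y0 != 0) || (y1 != 0) -> [|| x != 0, t != 0 | s != 0] -> quintic m a = 0.
Proof.
move=> rel y_neq0 xts.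
have [nk|] := boolP [|| ker0 m a != 0, ker1 m a != 0 | ker2 m a != 0]; last first.
  rewrite !negb_or !negbK => /and3P [/eqP k0 /eqP k1 /eqP k2].
  by rewrite /quintic k1 k2; ring.
have [c [xc yc0 yc1]] := related_ker rel nk.
have [w0 w1 _ _] := (related_rows _ _ _ _ _).1 rel.
have c0 : c != 0.
  apply/eqP => c0; move: w0 w1; rewrite yc0 yc1 xc c0 !mul0r addr0 !mulr0.
  move/eqP; rewrite !mulf_eq0 (negPf m0) /= => s0 /eqP; rewrite !mulf_eq0 (negPf m0) /= => s1.
  move/eqP: yc0; rewrite c0 mul0r !mulf_eq0 (negPf m0) /= => t0.
  move/eqP: yc1; rewrite c0 mul0r !mulf_eq0 (negPf m0) /= => t1.
  have := related_nonzero rel xts; case/orP => /negPf nz; rewrite nz /= in s0 s1 t0 t1;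
    by move: y_neq0; rewrite ?s0 ?s1 ?t0 ?t1.
apply: (mulfI (mulf_neq0 c0 c0)); rewrite mulr0 /quintic.
rewrite xc yc0 yc1 in w0 w1.
transitivity (m 0%N * s * y0 * (c * ker2 m a) - m 0%N * s * y1 * (c * ker1 m a)).
  by rewrite w0 w1; ring.
by rewrite -yc0 -yc1; ring.
Qed.

Lemma related_exists : quintic m a = 0 ->
  [|| ker0 m a != 0, ker1 m a != 0 | ker2 m a != 0] ->
  exists y0 y1 x t s, [/\ related y0 y1 x t s, (y0 != 0) || (y1 != 0) &
    [|| x != 0, t != 0 | s != 0]].
Proof.
move=> q0 nk.
have K2 : row2 m a 0 * ker0 m a + row2 m a 1 * ker1 m a + row2 m a 2 * ker2 m a = 0.
  by rewrite /ker0 /ker1 /ker2; ring.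
have K3 : row3 m a 0 * ker0 m a + row3 m a 1 * ker1 m a + row3 m a 2 * ker2 m a = 0.
  by rewrite /ker0 /ker1 /ker2; ring.
have [k12|] := boolP ((ker1 m a != 0) || (ker2 m a != 0)).
  have [s [s0 s1]] : exists s, s * ker1 m a = - a o0 * (ker0 m a + ker1 m a) /\
      s * ker2 m a = - a o1 * (ker0 m a + ker2 m a).
    have Q : ker1 m a * (a o1 * (ker0 m a + ker2 m a)) = ker2 m a * (a o0 * (ker0 m a + ker1 m a)).
      by apply/eqP; rewrite -subr_eq0 -[X in _ == X]q0 /quintic; apply/eqP; ring.
    case/orP: k12 => k0.
      exists (- a o0 * (ker0 m a + ker1 m a) / ker1 m a); split; first by rewrite divfK.
      apply: (mulfI k0); transitivity (- (ker2 m a * (a o0 * (ker0 m a + ker1 m a)))).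
        by field.
      by rewrite -Q; ring.
    exists (- a o1 * (ker0 m a + ker2 m a) / ker2 m a); split; last by rewrite divfK.
    apply: (mulfI k0); transitivity (- (ker1 m a * (a o1 * (ker0 m a + ker2 m a)))).
      by field.
    by rewrite Q; ring.
  exists (ker1 m a), (ker2 m a), (m 0%N * ker0 m a), 1, s; split=> //; last first.
    by rewrite oner_eq0 orbT.
  apply/related_rows; split.
  + by rewrite -mulrA s0; ring.
  + by rewrite -mulrA s1; ring.
  + transitivity (m 0%N * (row2 m a 0 * ker0 m a + row2 m a 1 * ker1 m a + row2 m a 2 * ker2 m a)).
      by ring.
    by rewrite K2 mulr0.
  transitivity (m 0%N * (row3 m a 0 * ker0 m a + row3 m a 1 * ker1 m a + row3 m a 2 * ker2 m a)).
    by ring.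
  by rewrite K3 mulr0.
rewrite negb_or !negbK => /andP [/eqP k1 /eqP k2].
have k0 : ker0 m a != 0 by move: nk; rewrite k1 k2 eqxx /= orbF.
exists (a o0), (a o1), (ker0 m a), 0, (- ker0 m a / m 0%N).
split; rewrite ?a01 ?k0 //; apply/related_rows; split.
- by field.
- by field.
- by rewrite -[RHS]K2 k1 k2; ring.
by rewrite -[RHS]K3 k1 k2; ring.
Qed.

Lemma related_unique y0 y1 x t s y0' y1' x' t' s' : quintic m a = 0 ->
  [|| ker0 m a != 0, ker1 m a != 0 | ker2 m a != 0] ->
  related y0 y1 x t s -> related y0' y1' x' t' s' ->
  [|| x != 0, t != 0 | s != 0] -> [|| x' != 0, t' != 0 | s' != 0] ->
  y0 * y1' = y1 * y0'.
Proof.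
move=> q0 nk rel rel' /(related_nonzero rel) ts /(related_nonzero rel') ts'.
have [c [xc yc0 yc1]] := related_ker rel nk; have [c' [xc' yc0' yc1']] := related_ker rel' nk.
have [w0 w1 _ _] := (related_rows _ _ _ _ _).1 rel.
have [w0' w1' _ _] := (related_rows _ _ _ _ _).1 rel'.
rewrite xc yc0 yc1 in w0 w1; rewrite xc' yc0' yc1' in w0' w1'.
apply/eqP; rewrite -subr_eq0; set d := _ - _.
have dE p q u0 u1 v0 v1 : m 0%N * p * y0 = u0 -> m 0%N * p * y1 = u1 ->
    m 0%N * q * y0' = v0 -> m 0%N * q * y1' = v1 -> u0 * v1 = u1 * v0 ->
    p != 0 -> q != 0 -> d = 0.
  move=> <- <- <- <- E pn qn; apply: (mulfI (mulf_neq0 (mulf_neq0 m0 pn) (mulf_neq0 m0 qn))).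
  rewrite mulr0 -(subrr (m 0%N * p * y1 * (m 0%N * q * y0'))) -{1}E /d; ring.
have Q : ker1 m a * (a o1 * (ker0 m a + ker2 m a)) = ker2 m a * (a o0 * (ker0 m a + ker1 m a)).
  by apply/eqP; rewrite -subr_eq0 -[X in _ == X]q0 /quintic; apply/eqP; ring.
apply/eqP; case/orP: ts => nz; case/orP: ts' => nz'.
- by apply: (dE _ _ _ _ _ _ yc0 yc1 yc0' yc1' _ nz nz'); ring.
- apply: (dE _ _ _ _ _ _ yc0 yc1 w0' w1' _ nz nz').
  transitivity (- (c * c') * (ker1 m a * (a o1 * (ker0 m a + ker2 m a)))); first by ring.
  by rewrite Q; ring.
- apply: (dE _ _ _ _ _ _ w0 w1 yc0' yc1' _ nz nz').
  transitivity (- (c * c') * (ker2 m a * (a o0 * (ker0 m a + ker1 m a)))); first by ring.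
  by rewrite -Q; ring.
by apply: (dE _ _ _ _ _ _ w0 w1 w0' w1' _ nz nz'); ring.
Qed.

End LinePairSolve.

Lemma resultant_double_root (K : numClosedFieldType) (p : {poly K}) x : p != 0 ->
  resultant p p^`() != 0 -> root p x -> p^`().[x] != 0.
Proof.
move=> p0; rewrite resultant_eq0 -leqNgt => cop px; apply/negP => dx.
have : 'X - x%:P %| gcdp p p^`() by rewrite dvdp_gcd !dvdp_XsubCl px.
move/dvdp_leq; rewrite gcdp_eq0 (negPf p0) size_XsubC => /(_ isT).
by rewrite leqNgt ltnS cop.
Qed.

Section QuinticPoly.
Variables (K : numClosedFieldType) (l m : nat -> K).

Let line (j : 'I_4) : {poly K} := line_point (polyC \o l) 1 'X j.

(** The quintic of the point with parameter x on the line l. *)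
Definition quintic_poly : {poly K} := quintic (polyC \o m) line.

Lemma line_eval x j : (line j).[x] = line_point l 1 x j.
Proof.
rewrite -[LHS]/(horner_eval x (line j)) map_line_point; congr line_point => //=.
- by apply/funext => k; rewrite /= /horner_eval hornerC.
- by rewrite rmorph1.
- by rewrite /horner_eval hornerX.
Qed.

Lemma quintic_poly_eval x : quintic_poly.[x] = quintic m (line_point l 1 x).
Proof.
rewrite -[LHS]/(horner_eval x quintic_poly) map_quintic; apply: eq_quintic => k.
  by rewrite /= /horner_eval hornerC.
exact: line_eval.
Qed.

(** The quintic is a quadratic form in the three minors ker0, ker1 and ker2, so
at a simple root they do not all vanish. *)
Lemma simple_root_ker x : quintic_poly^`().[x] != 0 ->
  [|| ker0 m (line_point l 1 x) != 0, ker1 m (line_point l 1 x) != 0 |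
      ker2 m (line_point l 1 x) != 0].
Proof.
apply: contraNT; rewrite !negb_or !negbK => /and3P [/eqP k0 /eqP k1 /eqP k2].
have kE (F : forall R : comNzRingType, (nat -> R) -> ('I_4 -> R) -> R) :
    (forall (R S : comNzRingType) (f : {rmorphism R -> S}) n a,
      f (F R n a) = F S (f \o n) (f \o a)) ->
    (F _ (polyC \o m) line).[x] = F _ m (line_point l 1 x).
  move=> Ff; rewrite -[LHS]/(horner_eval x _) Ff; congr (F _ _ _); apply/funext => k.
    by rewrite /= /horner_eval hornerC.
  exact: line_eval.
have e0 : (ker0 (polyC \o m) line).[x] = 0.
  rewrite (kE (fun R => @ker0 R)) // => R S f n a.
  by rewrite /ker0 /row2 /row3 /= !(rmorphB, rmorphD, rmorphM).
have e1 : (ker1 (polyC \o m) line).[x] = 0.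
  rewrite (kE (fun R => @ker1 R)) // => R S f n a.
  by rewrite /ker1 /row2 /row3 /= !(rmorphB, rmorphD, rmorphM).
have e2 : (ker2 (polyC \o m) line).[x] = 0.
  rewrite (kE (fun R => @ker2 R)) // => R S f n a.
  by rewrite /ker2 /row2 /row3 /= !(rmorphB, rmorphD, rmorphM).
rewrite /quintic_poly /quintic.
move: (ker0 _ _) (ker1 _ _) (ker2 _ _) e0 e1 e2 => p0 p1 p2 e0 e1 e2.
rewrite !(derivB, derivD, derivM) !(hornerD, hornerN, hornerM) e0 e1 e2.
by apply/eqP; ring.
Qed.

End QuinticPoly.

Section Intersection22.
Variable K : numClosedFieldType.
Local Notation S := {mpoly K[(2 + 2) * 4]}.
Local Notation D := (degeneracy_locus 2 (std_matrix K)).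
Local Notation hyp i := (lshift 2 (i : 'I_2)).
Local Notation hyq i := (rshift 2 (i : 'I_2)).

Definition hvar22 (i : 'I_(2 + 2)) (j : 'I_4) : S := 'X_(mxvec_index i j).

Definition lform : nat -> S := line_coef (hvar22 (hyp 0)) (hvar22 (hyp 1)).
Definition mform : nat -> S := line_coef (hvar22 (hyq 0)) (hvar22 (hyq 1)).

Definition lform_deg (k : 'I_(2 + 2)) : nat := ((k == hyp 0%R) + (k == hyp 1%R))%N.
Definition mform_deg (k : 'I_(2 + 2)) : nat := ((k == hyq 0%R) + (k == hyq 1%R))%N.

Lemma multihomog_line_coef i j k :
  multihomog (fun l => (l == i) + (l == j))%N (line_coef (hvar22 i) (hvar22 j) k).
Proof.
have dX a b : multihomog (fun l => l == a : nat) (hvar22 a b) by apply: multihomogX.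
case: k => [|[|[|[|[|k]]]]]; rewrite /line_coef /= ?nth_nil; try exact: multihomog0.
all: apply: multihomogB; first [exact: multihomogM (dX i _) (dX j _) |
  exact: (multihomogM (dX i _) (dX j _)) | idtac].
all: by rewrite mulrC; exact: (multihomogM (dX i _) (dX j _)).
Qed.

Definition bihomog n i j (P : {poly S}) : Prop :=
  poly_homog n (fun k => i * lform_deg k + j * mform_deg k)%N P.

Lemma bihomogM n1 n2 i1 i2 j1 j2 P Q : bihomog n1 i1 j1 P -> bihomog n2 i2 j2 Q ->
  bihomog (n1 + n2) (i1 + i2) (j1 + j2) (P * Q).
Proof.
move=> hP hQ; apply: (poly_homog_ext _ (poly_homogM hP hQ)) => k.
by rewrite !mulnDl addnACA.
Qed.

Definition quintic_form : {poly S} :=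
  quintic (polyC \o mform) (line_point (polyC \o lform) 1 'X).

Lemma multihomog_mform k :
  multihomog (fun l => 0 * lform_deg l + 1 * mform_deg l)%N (mform k).
Proof.
apply: (multihomog_ext _ (@multihomog_line_coef (hyq 0) (hyq 1) k)) => l.
by rewrite mul0n mul1n.
Qed.

Lemma multihomog_lform k :
  multihomog (fun l => 1 * lform_deg l + 0 * mform_deg l)%N (lform k).
Proof.
apply: (multihomog_ext _ (@multihomog_line_coef (hyp 0) (hyp 1) k)) => l.
by rewrite mul0n mul1n addn0.
Qed.

Lemma bihomog_line j : bihomog 1 1 0 (line_point (polyC \o lform) 1 'X j).
Proof.
have dl := multihomog_lform.
have l0 : multihomog (fun k => 1 * lform_deg k + 0 * mform_deg k)%N (0 : S).
  exact: multihomog0.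
case: j => [[|[|[|[|//]]]] h]; rewrite /line_point /= ?mulr1 ?mul_polyC.
- by rewrite -[_%:P]addr0 -(scale0r 'X); apply: poly_homogX.
- by rewrite -[_ *: _]add0r -polyC0; apply: poly_homogX.
- by apply: poly_homogX.
- by apply: poly_homogX.
Qed.

Lemma bihomog_quintic (a : 'I_4 -> {poly S}) : (forall j, bihomog 1 1 0 (a j)) ->
  bihomog 5 5 4 (quintic (polyC \o mform) a).
Proof.
move=> la; have hm k : bihomog 0 0 1 (mform k)%:P by exact: poly_homogC (@multihomog_mform k).
have h2 j : (j < 3)%N -> bihomog 1 1 1 (row2 (polyC \o mform) a j).
  case: j => [|[|[|//]]] _; rewrite /row2 /=.
  - by apply: poly_homogB; [apply: poly_homogB|]; apply: (bihomogM (hm _) (la _)).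
  - by apply: (bihomogM (hm _)); apply: poly_homogB; apply: la.
  - by apply: (bihomogM (hm _)); apply: poly_homogB; apply: la.
have h3 j : (j < 3)%N -> bihomog 1 1 1 (row3 (polyC \o mform) a j).
  case: j => [|[|[|//]]] _; rewrite /row3 /=.
  - by apply: poly_homogB; [apply: poly_homogB|]; apply: (bihomogM (hm _) (la _)).
  - by apply: (bihomogM (hm _)); apply: poly_homogB; apply: la.
  - by apply: (bihomogM (hm _)); apply: poly_homogB; apply: la.
have k0 : bihomog 2 2 2 (ker0 (polyC \o mform) a).
  by apply: poly_homogB; apply: (bihomogM (h2 _ _) (h3 _ _)).
have k1 : bihomog 2 2 2 (ker1 (polyC \o mform) a).
  by apply: poly_homogB; apply: (bihomogM (h2 _ _) (h3 _ _)).
have k2 : bihomog 2 2 2 (ker2 (polyC \o mform) a).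
  by apply: poly_homogB; apply: (bihomogM (h2 _ _) (h3 _ _)).
apply: poly_homogB.
  by apply: (@bihomogM 3 2 3 2 2 2); [exact: (bihomogM (la _) k1) | exact: poly_homogD].
by apply: (@bihomogM 3 2 3 2 2 2); [exact: (bihomogM (la _) k2) | exact: poly_homogD].
Qed.

(** The last factor excludes the value infinity of the parameter. *)
Definition nondegenerate22 : S :=
  discriminant 5 quintic_form * lform 0 * mform 0 * quintic mform (line_point lform 0 1).

Lemma multihomog_nondegenerate22 : exists d, multihomog d nondegenerate22.
Proof.
have [d dd] := multihomog_discriminant (bihomog_quintic bihomog_line).
have la j : bihomog 1 1 0 (line_point lform 0 1 j)%:P.
  split=> [|k]; first exact: leq_trans (size_polyC_leq1 _) _.
  rewrite coefC; case: eqP => _; last exact: multihomog0.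
  case: j => [[|[|[|[|//]]]] h]; rewrite /line_point /= ?mulr0 ?mulr1 ?add0r;
    by [exact: multihomog0 | exact: multihomog_lform].
have [_ /(_ 0%N)] := bihomog_quintic la.
rewrite -(map_quintic polyC) coefC /= => d4.
eexists; apply: (multihomogM _ d4); apply: (multihomogM _ (@multihomog_mform 0%N)).
exact: (multihomogM dd (@multihomog_lform 0%N)).
Qed.

Section Evaluation.
Variable r : 'I_(2 + 2) -> 'cV[K]_4.

Definition lvec : nat -> K := line_coef (fun j => r (hyp 0) j 0) (fun j => r (hyp 1) j 0).
Definition mvec : nat -> K := line_coef (fun j => r (hyq 0) j 0) (fun j => r (hyq 1) j 0).

Lemma lform_eval k : (lform k).@[evalvec r] = lvec k.
Proof.
rewrite (map_line_coef (meval (evalvec r))); congr line_coef; apply/funext => j;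
  by rewrite /= mevalXU evalvecE.
Qed.

Lemma mform_eval k : (mform k).@[evalvec r] = mvec k.
Proof.
rewrite (map_line_coef (meval (evalvec r))); congr line_coef; apply/funext => j;
  by rewrite /= mevalXU evalvecE.
Qed.

Lemma quintic_form_eval :
  map_poly (meval (evalvec r)) quintic_form = quintic_poly lvec mvec.
Proof.
rewrite map_quintic; apply: eq_quintic => k /=.
  by rewrite map_polyC /= mform_eval.
rewrite map_line_point /= map_polyX rmorph1; apply: eq_line_point => j /=.
by rewrite map_polyC /= lform_eval.
Qed.

Lemma nondegenerate22_eval : nondegenerate22.@[evalvec r] != 0 <->
  [/\ (size (quintic_poly lvec mvec) = 6%N /\
        resultant (quintic_poly lvec mvec) (quintic_poly lvec mvec)^`() != 0),
      lvec 0 != 0, mvec 0 != 0 & quintic mvec (line_point lvec 0 1) != 0].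
Proof.
have := discriminant_eval (evalvec r) (bihomog_quintic bihomog_line).
rewrite /nondegenerate22 quintic_form_eval; move: (discriminant _ _) => Dl DlE.
have E : (quintic mform (line_point lform 0 1)).@[evalvec r] =
    quintic mvec (line_point lvec 0 1).
  rewrite (map_quintic (meval (evalvec r))); apply: eq_quintic => k /=.
    exact: mform_eval.
  rewrite (map_line_point (meval (evalvec r))) rmorph0 rmorph1.
  by apply: eq_line_point => j /=; rewrite lform_eval.
rewrite !mevalM E lform_eval mform_eval !mulf_eq0 !negb_or -!andbA.
by split=> [/and4P [/DlE ? ? ? ?]|[/DlE -> -> -> ->]].
Qed.

End Evaluation.

(** Two lines for which the quintic has the rational roots 1, 2, 3, 1/3, 1/4. *)
Definition example22 : 'I_(2 + 2) -> 'cV[K]_4 := fun i =>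
  \col_j ((nth 0 (nth [::] [:: [:: 4; -3; 1; 0]; [:: -2; 4; 0; 1];
                              [:: 0; 1; 1; 0]; [:: 2; 0; 0; 1]] i) j : int)%:~R).

Lemma nondegenerate22_example : nondegenerate22.@[evalvec example22] != 0.
Proof.
have lE : lvec example22 = nth 0 [:: 1; -4%:R; 3%:R; 2%:R; -4%:R].
  apply/funext => k; rewrite /lvec /line_coef !mxE /=.
  by case: k => [|[|[|[|[|k]]]]] //=; ring.
have mE : mvec example22 = nth 0 [:: 1; 0; -1; -2%:R; 0].
  apply/funext => k; rewrite /mvec /line_coef !mxE /=.
  by case: k => [|[|[|[|[|k]]]]] //=; ring.
pose rs : seq K := map ratr [:: 1; 2%:R; 3%:R; 3%:R^-1; 4%:R^-1].
apply/nondegenerate22_eval; rewrite lE mE; split.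
- have -> : quintic_poly (nth 0 [:: 1; -4%:R; 3%:R; 2%:R; -4%:R])
      (nth 0 [:: 1; 0; -1; -2%:R; 0]) = 384%:R *: \prod_(x <- rs) ('X - x%:P).
    apply/eqP; rewrite -subr_eq0; apply/eqP/poly_fun_eq0 => t.
    rewrite hornerD hornerN quintic_poly_eval hornerZ /rs /= !big_cons big_nil.
    rewrite !hornerE !fmorphV !rmorph_nat rmorph1.
    rewrite /quintic /ker0 /ker1 /ker2 /row2 /row3 /line_point /=.
    by field.
  split.
    by rewrite size_scale ?Num.Theory.pnatr_eq0 // size_prod_XsubC.
  apply: resultant_prod; rewrite ?Num.Theory.pnatr_eq0 //.
  by rewrite map_inj_uniq //; apply: fmorph_inj.
- by rewrite /= oner_eq0.
- by rewrite /= oner_eq0.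
rewrite [X in X != 0](_ : _ = 384%:R) ?Num.Theory.pnatr_eq0 //.
by rewrite /quintic /ker0 /ker1 /ker2 /row2 /row3 /line_point /=; ring.
Qed.

End Intersection22.

Lemma related_rank (K : fieldType) (m : nat -> K) (a b : 'I_4 -> K) y0 y1 :
  b =1 line_point m y0 y1 ->
  (\rank (triple_matrix a b) < 3)%N <->
  exists x t s, related m a y0 y1 x t s /\ [|| x != 0, t != 0 | s != 0].
Proof.
move=> bE; rewrite triple_rankP; split=> [[x [t [s [xts E]]]]|[x [t [s [E xts]]]]].
  exists x, t, (- s); rewrite oppr_eq0; split=> // i.
  by rewrite -bE; have /eqP := E i; rewrite -subr_eq0 => /eqP <-; ring.
exists x, t, (- s); rewrite oppr_eq0; split=> // i.
by apply/eqP; rewrite -subr_eq0 -[X in _ == X](E i) -bE; apply/eqP; ring.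
Qed.

Lemma proportional_pair (K : fieldType) (y0 y1 z0 z1 : K) :
  (y0 != 0) || (y1 != 0) -> (z0 != 0) || (z1 != 0) -> y0 * z1 = y1 * z0 ->
  exists c, [/\ c != 0, y0 = c * z0 & y1 = c * z1].
Proof.
move=> y z E; have [z00|z00] := eqVneq z0 0.
  have z1n : z1 != 0 by move: z; rewrite z00 eqxx.
  have y00 : y0 = 0.
    by move/eqP: E; rewrite z00 mulr0 mulf_eq0 (negPf z1n) orbF => /eqP.
  exists (y1 / z1); rewrite z00 y00 mulr0 divfK //; split=> //.
  by rewrite mulf_neq0 ?invr_eq0 //; move: y; rewrite y00 eqxx.
have y1E : y1 = y0 / z0 * z1.
  by apply: (mulfI z00); rewrite mulrC -E; field.
exists (y0 / z0); rewrite divfK //; split=> //.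
rewrite mulf_neq0 ?invr_eq0 //; apply: contraTneq y => y00.
by rewrite y1E y00 !mul0r eqxx.
Qed.

Section Count22.
Variable K : numClosedFieldType.
Local Notation D := (degeneracy_locus 2 (std_matrix K)).
Local Notation hyp i := (lshift 2 (i : 'I_2)).
Local Notation hyq i := (rshift 2 (i : 'I_2)).

Lemma line_point_neq0 (l : nat -> K) x0 x1 (v : 'cV[K]_4) : l 0%N != 0 ->
  (forall i, v i 0 = line_point l x0 x1 i) -> v != 0 <-> (x0 != 0) || (x1 != 0).
Proof.
move=> l0 vE; split=> [|x].
  apply: contraNT; rewrite negb_or !negbK => /andP [/eqP x00 /eqP x10].
  apply/eqP/colP => i; rewrite vE mxE x00 x10.
  by case: i => [[|[|[|[|//]]]] h]; rewrite /line_point /=; ring.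
apply/eqP => /colP v0; have := v0 o0; have := v0 o1; rewrite !vE !mxE /line_point /=.
move/eqP; rewrite mulf_eq0 (negPf l0) /= => x1' /eqP; rewrite mulf_eq0 (negPf l0) /= => x0'.
by move: x; rewrite x1' x0'.
Qed.

Lemma ord2_cases (i : 'I_2) : i = 0 \/ i = 1.
Proof. by case: i => [[|[|//]] h]; [left|right]; apply: val_inj. Qed.

(** On each of the two lines the point is given by one parameter; eliminating the
second parameter leaves a quintic for the first. *)
Theorem intersection22 : intersection_number D 2 2 5.
Proof.
have [d dw] := multihomog_nondegenerate22 K.
apply: (generic_nonvanishing dw _ (nondegenerate22_example K)).
  move=> i; apply/eqP => /colP E.
  suff [j] : exists j, example22 K i j 0 != 0 by rewrite E mxE eqxx.
  case: i {E} => [[|[|[|[|//]]]] h]; [exists o2|exists o3|exists o2|exists o3];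
    by rewrite mxE /= ?oner_eq0.
move=> h r rh /nondegenerate22_eval; set l := lvec r; set m := mvec r.
case=> -[sz res] l0 m0 inf0; set P := quintic_poly l m in sz res.
have P0 : P != 0 by rewrite -size_poly_eq0 sz.
have [rs [urs srs rsE]] := separable_roots sz res.
have hp (p : multiproj K 2 3) s : hcoords s p ->
    ((forall i, on_hyperplane (h (hyp i)) (p 0)) /\
     (forall j, on_hyperplane (h (hyq j)) (p 1))) <->
    ((forall k, s 0 k 0 = line_point l (s 0 o0 0 / l 0%N) (s 0 o1 0 / l 0%N) k) /\
     (forall k, s 1 k 0 = line_point m (s 1 o0 0 / m 0%N) (s 1 o1 0 / m 0%N) k)).
  move=> sp.
  have L := @line_pointP K _ _ (fun k => s 0 k 0) l0.
  have M := @line_pointP K _ _ (fun k => s 1 k 0) m0.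
  split=> [[H0 H1]|[/L [L0 L1] /M [M0 M1]]].
    split; [apply/L | apply/M]; split.
    - by apply/(on_hyperplaneP (rh (hyp 0)) (sp 0)).
    - by apply/(on_hyperplaneP (rh (hyp 1)) (sp 0)).
    - by apply/(on_hyperplaneP (rh (hyq 0)) (sp 1)).
    - by apply/(on_hyperplaneP (rh (hyq 1)) (sp 1)).
  by split=> i; apply/(on_hyperplaneP (rh _) (sp _)); case: (ord2_cases i) => ->.
have kerP x : x \in rs -> [/\ quintic m (line_point l 1 x) = 0,
    (line_point l 1 x o0 != 0) || (line_point l 1 x o1 != 0) &
    [|| ker0 m (line_point l 1 x) != 0, ker1 m (line_point l 1 x) != 0 |
        ker2 m (line_point l 1 x) != 0]].
  rewrite rsE => xr; split; first by rewrite -quintic_poly_eval; apply/eqP.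
    by rewrite /line_point /= mulr1 l0.
  exact/simple_root_ker/resultant_double_root.
pose Z (p : multiproj K 2 3) := [/\ D p, forall i, on_hyperplane (h (hyp i)) (p 0) &
  forall j, on_hyperplane (h (hyq j)) (p 1)].
pose Q x p := [/\ Z p, x \in rs & exists2 s, hcoords s p & forall k, s 0 k 0 = line_point l 1 x k].
have [L [uL sL LE]] : exists L : seq (multiproj K 2 3), [/\ uniq L, size L = size rs &
    forall p, p \in L <-> Z p].
  apply: (@points_of_roots _ _ _ Q) => //.
  - move=> x xrs; have [q0 a01 nk] := kerP x xrs.
    have [y0 [y1 [x' [t [s [rel ynz xts]]]]]] := related_exists m0 a01 q0 nk.
    pose b := line_point m y0 y1.
    have s0 i : pair_point (line_point l 1 x) b i != 0.
      case: (ord2_cases i) => ->.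
        apply/(@line_point_neq0 l 1 x); rewrite ?oner_eq0 // => k; by rewrite mxE.
      by apply/(@line_point_neq0 m y0 y1) => // k; rewrite mxE.
    have sp := hcoords_mpoint s0.
    have a_coord : acoord (pair_point (line_point l 1 x) b) =1 line_point l 1 x.
      by move=> k; rewrite /acoord mxE.
    have b_coord : bcoord (pair_point (line_point l 1 x) b) =1 b.
      by move=> k; rewrite /bcoord mxE.
    have Zp : Z (mpoint s0).
      have [|H0 H1] := (hp _ _ sp).2; last first.
        split=> //; apply/(degeneracyP sp).
        rewrite (funext a_coord) (funext b_coord).
        by apply/(@related_rank _ m _ b y0 y1) => //; exists x', t, s.
      have lp (n : nat -> K) u0 u1 : n 0%N != 0 ->
          line_point n u0 u1 o0 / n 0%N = u0 /\ line_point n u0 u1 o1 / n 0%N = u1.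
        by move=> n0; rewrite /line_point /= ![n 0%N * _]mulrC !mulfK.
      have [ax0 ax1] := lp l 1 x l0; have [by0 by1] := lp m y0 y1 m0.
      by split=> k; rewrite !mxE /= ?ax0 ?ax1 ?by0 ?by1.
    exists (mpoint s0) => //; split=> //.
    by exists (pair_point (line_point l 1 x) b) => // k; rewrite mxE.
  - move=> p Zp; have [Dp H0 H1] := Zp; have [s sp] := hcoords_exist p.
    have [aE bE] := (hp _ _ sp).1 (conj H0 H1).
    move: (s 0 o0 0 / _) (s 0 o1 0 / _) aE => x0 x1 aE.
    move: (s 1 o0 0 / _) (s 1 o1 0 / _) bE => y0 y1 bE.
    have xnz := (line_point_neq0 l0 aE).1 (hcoords_neq0 0 sp).
    have ynz := (line_point_neq0 m0 bE).1 (hcoords_neq0 1 sp).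
    have a01 : (acoord s o0 != 0) || (acoord s o1 != 0).
      by rewrite /acoord !aE /line_point /= !mulf_eq0 (negPf l0).
    have [x' [t [s' [rel xts]]]] := (related_rank (acoord s) bE).1 ((degeneracyP sp).1 Dp).
    have q0 := related_quintic m0 a01 rel ynz xts.
    have [x00|x00] := eqVneq x0 0.
      case/eqP: inf0; have x1n : x1 != 0 by move: xnz; rewrite x00 eqxx.
      apply: (mulfI (expf_neq0 5 x1n)); rewrite mulr0 -quintic_scale -[RHS]q0.
      apply: eq_quintic => // k; rewrite /acoord aE x00 /line_point.
      by case: k => [[|[|[|[|//]]]] hk] /=; ring.
    have aE' k : line_point l 1 (x1 / x0) k = x0^-1 * s 0 k 0.
      rewrite aE /line_point; case: k => [[|[|[|[|//]]]] hk] /=; by field.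
    have qx : quintic m (line_point l 1 (x1 / x0)) = 0.
      by rewrite (eq_quintic (fun=> erefl) aE') quintic_scale q0 mulr0.
    have xrs : x1 / x0 \in rs by rewrite rsE; apply/eqP; rewrite quintic_poly_eval.
    exists (x1 / x0) => //; split=> //.
    pose c (i : 'I_2) := if i == 0 then x0^-1 else 1.
    have c0 i : c i != 0 by rewrite /c; case: ifP; rewrite ?invr_eq0 ?oner_eq0.
    exists (fun i => c i *: s i); first exact: hcoords_scale.
    by move=> k; rewrite mxE aE'.
  - move=> x y p Zp [_ _ [s sp sE]] [_ _ [s' sp' sE']].
    have [c cE] := hcoords_unique sp sp'; have /colP c0 := (cE 0).2.
    have := c0 o0; have := c0 o1; rewrite !mxE !sE !sE' /line_point /= !mulr1.
    move=> E /eqP; rewrite -subr_eq0 -{1}[l 0%N]mul1r -mulrBl mulf_eq0 (negPf l0) orbF.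
    rewrite subr_eq0 => /eqP c1; rewrite -c1 mul1r in E.
    by rewrite (mulfI l0 E).
  move=> x p q [[Dp H0 H1] xrs [s sp sE]] [[Dq H0' H1'] _ [s' sq sE']].
  have [q0 a01 nk] := kerP x xrs.
  have [_ bE] := (hp _ _ sp).1 (conj H0 H1); have [_ bE'] := (hp _ _ sq).1 (conj H0' H1').
  move: (s 1 o0 0 / _) (s 1 o1 0 / _) bE => y0 y1 bE.
  move: (s' 1 o0 0 / _) (s' 1 o1 0 / _) bE' => z0 z1 bE'.
  have ynz := (line_point_neq0 m0 bE).1 (hcoords_neq0 1 sp).
  have znz := (line_point_neq0 m0 bE').1 (hcoords_neq0 1 sq).
  have a_coord : acoord s = line_point l 1 x by apply/funext => k; rewrite /acoord sE.
  have a_coord' : acoord s' = line_point l 1 x by apply/funext => k; rewrite /acoord sE'.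
  have [x1 [t1 [s1 [rel1 n1]]]] := (related_rank (acoord s) bE).1 ((degeneracyP sp).1 Dp).
  have [x2 [t2 [s2 [rel2 n2]]]] := (related_rank (acoord s') bE').1 ((degeneracyP sq).1 Dq).
  rewrite a_coord in rel1; rewrite a_coord' in rel2.
  have E := related_unique m0 a01 q0 nk rel1 rel2 n1 n2.
  have [c [c0 cy0 cy1]] := proportional_pair ynz znz E.
  pose c' (i : 'I_2) := if i == 0 then 1 else c.
  have c'0 i : c' i != 0 by rewrite /c'; case: ifP; rewrite ?oner_eq0.
  apply: (hcoords_inj sp); have := hcoords_scale c'0 sq; congr hcoords; apply/funext => i.
  apply/colP => k; rewrite mxE /c'; case: (ord2_cases i) => -> /=.
    by rewrite mul1r sE sE'.
  rewrite bE bE' cy0 cy1 /line_point; case: k => [[|[|[|[|//]]]] hk] /=; by ring.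
by exists L; rewrite uL sL srs.
Qed.

End Count22.

(** * Change of coordinates in both factors *)

Section LocusTransport.
Variables (K : fieldType) (G : 'I_2 -> 'M[K]_4).
Hypothesis uG : forall i, G i \in unitmx.
Implicit Types (X Y : 'I_5 -> pspace K 3) (A B : 'M[K]_(3, 4)).

Lemma camera_image_pmap A H (x : pspace K 3) : H \in unitmx ->
  camera_image (A *m invmx H) (pmap H x) = camera_image A x.
Proof.
move=> uH; have [v xE] : exists v, x = <[v]>%VS :> {vspace _}.
  by exists (vpick x); case: (pspace_line x).
rewrite /camera_image (pmap_line uH xE) xE !lin_image_line.
by rewrite -mulmxA mulKmx.
Qed.

Lemma camera_mul A H : H \in unitmx -> camera A -> camera (A *m invmx H).
Proof. by move=> uH; rewrite /camera mxrankMfree // row_free_unit unitmx_inv. Qed.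

Lemma secants_pmap X a H : H \in unitmx ->
  secants (fun i => pmap H (X i)) (pmap H a) -> secants X a.
Proof.
move=> uH [i [j [ij sub]]]; exists i, j; split.
  by move=> E; apply: ij; rewrite E.
move: sub; rewrite !pmapE // -limgD limg_ker0 //; apply/lker0P => u v.
by rewrite !lfunE => /(congr1 (mulmx (invmx H))); rewrite /= !mulKmx.
Qed.

Lemma locus_transport X Y p : centers_locus X Y p ->
  centers_locus (fun i => pmap (G 0) (X i)) (fun i => pmap (G 1) (Y i)) (transport id G p).
Proof.
case=> [nX nY [A [B [[cA Aa] [cB Bb] [nA nB [H [dH AB]]]]]]].
split; rewrite ?ffunE.
- by move=> /(secants_pmap (uG 0)).
- by move=> /(secants_pmap (uG 1)).
exists (A *m invmx (G 0)), (B *m invmx (G 1)).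
split; first by split; [exact: camera_mul | rewrite /center camera_image_pmap].
  by split; [exact: camera_mul | rewrite /center camera_image_pmap].
split=> [i|i|]; rewrite /center ?camera_image_pmap //; [exact: nA | exact: nB |].
by exists H; split=> // i; rewrite mulmxA !camera_image_pmap.
Qed.

End LocusTransport.

Section VarietyTransport.
Variables (K : fieldType) (G : 'I_2 -> 'M[K]_4).
Hypothesis uG : forall i, G i \in unitmx.
Implicit Types (X Y : 'I_5 -> pspace K 3).
Local Notation T := (transport id G).
Local Notation T' := (transport id (fun i => invmx (G i))).

Lemma uG' i : invmx (G i) \in unitmx. Proof. by rewrite unitmx_inv. Qed.

Lemma transport_idK p : T' (T p) = p.
Proof. exact: (@transportK _ _ _ _ id id). Qed.

Lemma transport_idVK p : T (T' p) = p.
Proof. exact: (@transportVK _ _ _ _ id id). Qed.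

Lemma variety_transport X Y p :
  centers_variety X Y p <->
  centers_variety (fun i => pmap (G 0) (X i)) (fun i => pmap (G 1) (Y i)) (T p).
Proof.
split=> V Z cZ LZ.
  apply: (V _ (closed_preimage id uG cZ)) => q Lq; exact/LZ/locus_transport.
rewrite -(transport_idK p).
apply: (V _ (closed_preimage id uG' cZ)) => q /(locus_transport uG') Lq; apply: LZ.
move: Lq; congr (centers_locus _ _ _); apply/funext => i; exact: pmapK.
Qed.

Lemma irreducible_transport (Z : multiproj K 2 3 -> Prop) :
  irreducible Z -> irreducible (fun p => Z (T p)).
Proof.
move=> [[p0 Zp0] irr]; split; first by exists (T' p0); rewrite transport_idVK.
move=> Z1 Z2 c1 c2 cov.
case: (irr _ _ (closed_preimage id uG' c1) (closed_preimage id uG' c2)) => [p Zp|H|H].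
- by apply: cov; rewrite transport_idVK.
- by left=> p /H; rewrite transport_idK.
by right=> p /H; rewrite transport_idK.
Qed.

Lemma birational_transport (m' n' : nat) (Z : multiproj K 2 3 -> Prop)
    (W : multiproj K m' n' -> Prop) :
  birational Z W -> birational (fun p => Z (T p)) W.
Proof.
case=> phi [psi [U [U' [[rphi rpsi] [oU [p0 [Zp0 Up0]]] oU' fwd bwd]]]].
pose phi' i : 'cV_n'.+1 := map_mx (pullback id G) (phi i).
pose psi' i : 'cV[{mpoly K[m' * n'.+1]}]_4 :=
  \col_j \sum_k invmx (G i) j k *: psi i k 0.
have phi'P p q : ratmap_at phi (T p) q -> ratmap_at phi' p q.
  move=> H r /(transport_coords id uG) /H; congr hcoords; apply/funext => i.
  by apply/colP => j; rewrite !mxE pullback_eval.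
have psi'P p q : ratmap_at psi q (T p) -> ratmap_at psi' q p.
  move=> H r /H /(transport_coords id uG'); rewrite transport_idK.
  congr hcoords; apply/funext => i; apply/colP => j; rewrite !mxE raddf_sum.
  by apply: eq_bigr => k _; rewrite mxE /= mevalZ.
exists phi', psi', (fun p => U (T p)), U'; split=> //.
- split=> i.
    have [d dphi] := rphi i; eexists => j; rewrite mxE.
    exact: (@multihomog_pullback _ _ _ _ id G d _ (dphi j)).
  have [d dpsi] := rpsi i; exists d => j; rewrite mxE; apply: multihomog_sum => k _.
  by rewrite -mul_mpolyC; apply: (multihomog_ext _ (multihomogM (@multihomogC _ _ _ _) (dpsi k))).
- split; first exact: (closed_preimage id uG oU).
  by exists (T' p0); rewrite transport_idVK.
- by move=> p Zp /(fwd _ Zp) [q [Wq Uq /phi'P ? /psi'P ?]]; exists q.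
move=> q Wq /(bwd _ Wq) [p [Zp Up H1 H2]]; exists (T' p).
by split; rewrite ?transport_idVK //; [apply: psi'P | apply: phi'P]; rewrite transport_idVK.
Qed.

Lemma rational_fold_transport (n' : nat) (Z : multiproj K 2 3 -> Prop) :
  rational_fold n' Z -> rational_fold n' (fun p => Z (T p)).
Proof.
case=> cZ irr bir; split; first exact: (closed_preimage id uG).
  exact: irreducible_transport.
exact: birational_transport.
Qed.

End VarietyTransport.

(** * Intersection numbers *)

Section IntersectionTransport.
Variable K : numFieldType.
Implicit Types (Z : multiproj K 2 3 -> Prop).

Lemma on_hyperplane_pmap (G : 'M[K]_4) (h x : pspace K 3) : G \in unitmx ->
  on_hyperplane (pmap (invmx G)^T h) (pmap G x) <-> on_hyperplane h x.
Proof.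
move=> uG; have uGt : (invmx G)^T \in unitmx by rewrite unitmx_tr unitmx_inv.
have [u hE] : exists u, h = <[u]>%VS :> {vspace _}.
  by exists (vpick h); case: (pspace_line h).
have [v xE] : exists v, x = <[v]>%VS :> {vspace _}.
  by exists (vpick x); case: (pspace_line x).
rewrite (on_hyperplaneP (pmap_line uGt hE) (pmap_line uG xE)) (on_hyperplaneP hE xE).
have E (a b : 'cV[K]_4) : \sum_k a k 0 * b k 0 = (a^T *m b) 0 0.
  by rewrite mxE; apply: eq_bigr => k _; rewrite mxE.
by rewrite !E trmx_mul trmxK -mulmxA mulKmx.
Qed.

(** Hyperplanes are transformed by the inverse transpose. *)
Lemma intersection_transport (G : 'I_2 -> 'M[K]_4) Z r s N :
  (forall i, G i \in unitmx) -> intersection_number Z r s N ->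
  intersection_number (fun p => Z (transport id G p)) r s N.
Proof.
move=> uG; pose H (i : 'I_(r + s)) : 'M[K]_4 :=
  (invmx (G (if split i is inl _ then 0 else 1)))^T.
have uH i : H i \in unitmx by rewrite unitmx_tr unitmx_inv.
have Hl i : H (lshift s i) = (invmx (G 0))^T by rewrite /H (unsplitK (inl i)).
have Hr j : H (rshift r j) = (invmx (G 1))^T by rewrite /H (unsplitK (inr j)).
move=> /(generically_preimage (sigma := id) uH) gen.
have {gen} [|U [oU [neU UP]]] := gen.
  by move=> q; exists (transport id (fun i => invmx (H i)) q); apply: (@transportVK _ _ _ _ id id).
exists U; split=> //; split=> // h /UP [L [uL sL LE]].
pose T' := transport id (fun i => invmx (G i)).
have T'K p : transport id G (T' p) = p by apply: (@transportVK _ _ _ _ id id).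
have TK p : T' (transport id G p) = p by apply: (@transportK _ _ _ _ id id).
exists (map T' L); split.
- by rewrite map_inj_uniq // => p q E; rewrite -(T'K p) E T'K.
- by rewrite size_map.
move=> p; rewrite -{1}(TK p) mem_map; last by move=> q q' E; rewrite -(T'K q) E T'K.
rewrite LE; split=> -[Zp H0 H1]; split=> // i.
- by have := H0 i; rewrite !ffunE Hl on_hyperplane_pmap.
- by have := H1 i; rewrite !ffunE Hr on_hyperplane_pmap.
- by rewrite !ffunE Hl on_hyperplane_pmap.
- by rewrite !ffunE Hr on_hyperplane_pmap.
Qed.

Lemma intersection_iff Z Z' r s N : (forall p, Z p <-> Z' p) ->
  intersection_number Z r s N -> intersection_number Z' r s N.
Proof.
move=> ZZ; have -> // : Z = Z' by apply/funext => p; apply/propext.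
Qed.

Definition swap_factors (p : multiproj K 2 3) : multiproj K 2 3 :=
  [ffun i => p (if i == 0 then 1 else 0)].

Lemma swap_factorsK : involutive swap_factors.
Proof. by move=> p; apply/ffunP => i; rewrite !ffunE; case: (ord2_cases i) => ->. Qed.

Lemma intersection_swap Z r s N : intersection_number Z r s N ->
  intersection_number (fun p => Z (swap_factors p)) s r N.
Proof.
pose swap (a b : nat) (i : 'I_(a + b)) : 'I_(b + a) :=
  match split i with inl k => rshift b k | inr k => lshift a k end.
have swapK a b : cancel (swap a b) (swap b a).
  move=> i; rewrite -(splitK i); case: (split i) => k.
    by rewrite /swap unsplitK (unsplitK (inr k)).
  by rewrite /swap unsplitK (unsplitK (inl k)).
pose H (i : 'I_(r + s)) : 'M[K]_4 := 1%:M.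
have uH i : H i \in unitmx by rewrite unitmx1.
move=> /(generically_preimage (sigma := swap r s) uH) gen.
have {gen} [|U [oU [neU UP]]] := gen.
  by move=> q; exists (transport (swap s r) (fun i => invmx (H (swap s r i))) q);
    apply: transportVK.
exists U; split=> //; split=> // h /UP [L [uL sL LE]].
exists (map swap_factors L); split.
- by rewrite map_inj_uniq //; apply: inv_inj; exact: swap_factorsK.
- by rewrite size_map.
move=> p; rewrite -{1}(swap_factorsK p) mem_map; last by apply: inv_inj; exact: swap_factorsK.
have tl i : transport (swap r s) H h (lshift s i) = h (rshift s i).
  by rewrite ffunE pmap1 /swap (unsplitK (inl i)).
have tr j : transport (swap r s) H h (rshift r j) = h (lshift r j).
  by rewrite ffunE pmap1 /swap (unsplitK (inr j)).
rewrite LE; split=> -[Zp H0 H1]; split=> // i.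
- by have := H1 i; rewrite tr ffunE.
- by have := H0 i; rewrite tl ffunE.
- by rewrite tl ffunE.
by rewrite tr ffunE.
Qed.

End IntersectionTransport.

Section StandardMultidegree.
Variable K : numClosedFieldType.
Local Notation D := (degeneracy_locus 2 (std_matrix K)).

(** The relation (x + y b_i) a_i = z b_i is also (- z + y a_i) b_i = - x a_i. *)
Lemma degeneracy_swap p : D (swap_factors p) <-> D p.
Proof.
suff sw q : D q -> D (swap_factors q) by split=> [/sw|/sw //]; rewrite swap_factorsK.
move=> Dq; have [r rq] := hcoords_exist q.
have rq' : hcoords (fun i : 'I_2 => r (if i == 0 then 1 else 0)) (swap_factors q).
  by move=> i; rewrite ffunE; apply: rq.
apply/(degeneracyP rq'); apply/triple_rankP.
have /triple_rankP [x [y [z [xyz E]]]] := (degeneracyP rq).1 Dq.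
exists (- z), y, (- x); rewrite !oppr_eq0; split.
  by case/or3P: xyz => ->; rewrite ?orbT.
move=> i; set a' := acoord _ i; set b' := bcoord _ i.
have -> : a' = bcoord r i by [].
have -> : b' = acoord r i by [].
have /eqP := E i; rewrite -subr_eq0 => /eqP {}E.
by apply/eqP; rewrite -subr_eq0 -[X in _ == X]E; apply/eqP; ring.
Qed.

Lemma intersection31 : intersection_number D 3 1 3.
Proof.
apply: intersection_iff (intersection_swap (intersection13 K)) => p.
exact: degeneracy_swap.
Qed.

(** The classes i + j = 2 are paired with 3 - i and 3 - j hyperplanes. *)
Lemma multidegree_of_intersections (Z : multiproj K 2 3 -> Prop) :
  intersection_number Z 1 3 3 -> intersection_number Z 2 2 5 ->
  intersection_number Z 3 1 3 ->
  multidegree Z 2 ('X_0 ^+ 2 *+ 3 + 'X_0 * 'X_1 *+ 5 + 'X_1 ^+ 2 *+ 3).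
Proof.
move=> h13 h22 h31.
exists (fun i j => if (i == 1%N :> nat) then 5 else 3)%N; split.
  move=> [[|[|[|[|//]]]] hi] [[|[|[|[|//]]]] hj] //=.
exists 0, 0; rewrite !mul0r addr0; apply/eqP; rewrite subr_eq0; apply/eqP.
have mk i (F : 'I_4 -> {mpoly int[2]}) : \sum_(j < 4 | (i + j)%N == 2%N) F j =
    \sum_(j < 4) (if (i + j)%N == 2%N then F j else 0) by rewrite big_mkcond.
rewrite !big_ord_recl !big_ord0 !mk !big_ord_recl !big_ord0 /= /bump /=.
by ring.
Qed.

End StandardMultidegree.

(** * Five points in general position *)

Section GeneralPosition.
Variable K : numFieldType.

(** By Cramer's rule the sum of the c_i v_i is a multiple of v_5, so the inverse of
the transformation e_i |-> c_i v_i is the required one. *)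
Lemma general_position_frame (x : 'I_5 -> pspace K 3) (v : 'I_5 -> 'cV[K]_4)
    (N := \matrix_(i < 4, j < 4) v (widen_ord (leqnSn 4) i) j 0)
    (c := fun i => \sum_j v ord_max j 0 * cofactor N i j) :
  (forall i, x i = <[v i]>%VS :> {vspace _}) -> \det N != 0 -> (forall i, c i != 0) ->
  exists2 G : 'M[K]_4, G \in unitmx & forall i, pmap G (x i) = std_points K i.
Proof.
move=> xE dN cn; pose L := diag_mx (\row_i c i).
have uN : N^T \in unitmx by rewrite unitmx_tr unitmxE unitfE.
have uL : L \in unitmx.
  by rewrite unitmxE det_diag unitfE; apply/prodf_neq0 => i _; rewrite mxE.
pose M := N^T *m L; have uM : M \in unitmx by rewrite unitmx_mul uN.
exists (invmx M); first by rewrite unitmx_inv.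
have Mstd i : pmap M (std_points K i) = x i.
  apply: pspace_inj; rewrite (pmap_line uM (std_point_line K i)) xE.
  suff [d d0 ->] : exists2 d, d != 0 & M *m std_vec K i = d *: v i.
    apply/eqP; rewrite eqEsubv -!memvE memvZ ?memv_line //=; apply/vlineP.
    by exists d^-1; rewrite scalerA mulVf ?scale1r.
  have ME w k : (M *m w) k 0 = \sum_l v (widen_ord (leqnSn 4) l) k 0 * (c l * w l 0) :> K.
    rewrite /M -mulmxA mxE; apply: eq_bigr => l _.
    by rewrite mul_diag_mx !mxE.
  have [i4|i4] := ltnP i 4.
    exists (c (Ordinal i4)) => //; apply/colP => k; rewrite ME (bigD1 (Ordinal i4)) //=.
    rewrite big1 => [|l li].
      rewrite addr0 !mxE i4 eqxx mulr1 mulrC; congr (_ * v _ _ _); exact: val_inj.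
    rewrite !mxE i4 (_ : (l == i :> nat) = false) ?mulr0 //.
    by apply: contra_neqF li => /eqP li; apply: val_inj.
  have -> : i = ord_max by apply: val_inj => /=; apply/eqP; rewrite eqn_leq i4 -ltnS ltn_ord.
  exists (\det N) => //; apply/colP => k; rewrite ME mxE std_vec_max.
  transitivity (\sum_j v ord_max j 0 * (\adj N *m N) j k).
    under eq_bigr => l _ do rewrite mxE mulr1 /c mulr_sumr.
    rewrite exchange_big /=; apply: eq_bigr => j _; rewrite mxE mulr_sumr.
    by apply: eq_bigr => l _; rewrite !mxE; ring.
  rewrite mul_adj_mx (bigD1 k) //= big1 => [|j /negPf jk]; last by rewrite mxE jk mulr0n mulr0.
  by rewrite mxE eqxx mulr1n addr0 mulrC.
by move=> i; rewrite -Mstd pmapK.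
Qed.

Section Form.
Variable s : 'I_5 -> 'I_(5 + 5).
Local Notation S := {mpoly K[(5 + 5) * 4]}.

Let Nform : 'M[S]_4 :=
  \matrix_(i < 4, j < 4) 'X_(mxvec_index (s (widen_ord (leqnSn 4) i)) j).
Let cform i : S := \sum_j 'X_(mxvec_index (s ord_max) j) * cofactor Nform i j.

(** Nonvanishing means that the points with indices in s are in general
position. *)
Definition frame_form : S := \det Nform * \prod_i cform i.

Lemma multihomog_frame_form : exists d, multihomog d frame_form.
Proof.
have dX i j : multihomog (fun l => l == i : nat) ('X_(mxvec_index i j) : S).
  exact: multihomogX.
eexists; apply: multihomogM.
  by apply: multihomog_det => i j; rewrite mxE; apply: dX.
apply: multihomog_prod => i; apply: multihomog_sum => j _.
apply: (multihomogM (dX _ _)); apply: multihomog_sign.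
by apply: multihomog_det => k l; rewrite !mxE; apply: dX.
Qed.

Lemma frame_form_eval (r : 'I_(5 + 5) -> 'cV[K]_4) (v := fun i => r (s i))
    (N := \matrix_(i < 4, j < 4) v (widen_ord (leqnSn 4) i) j 0) :
  frame_form.@[evalvec r] =
  \det N * \prod_i \sum_j v ord_max j 0 * cofactor N i j.
Proof.
have NE : map_mx (meval (evalvec r)) Nform = N.
  by apply/matrixP => i j; rewrite !mxE /= mevalXU evalvecE.
rewrite /frame_form mevalM -NE -det_map_mx rmorph_prod; congr (_ * _).
apply: eq_bigr => i _; rewrite /= raddf_sum; apply: eq_bigr => j _.
rewrite /= mevalM mevalXU evalvecE; congr (_ * _).
by rewrite -cofactor_map_mx.
Qed.

Lemma frame_form_std (r : 'I_(5 + 5) -> 'cV[K]_4) : (forall i, r (s i) = std_vec K i) ->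
  frame_form.@[evalvec r] != 0.
Proof.
move=> rE; rewrite frame_form_eval.
set N := \matrix_(i, j) _; have NE : N = 1%:M.
  apply/matrixP => i j; rewrite !mxE rE !mxE /= ltn_ord.
  by rewrite (inj_eq val_inj) eq_sym.
have adj1 : \adj N = 1%:M by rewrite -[\adj N]mul1mx -NE mul_mx_adj NE det1.
rewrite NE det1 mul1r; apply/prodf_neq0 => i _.
rewrite (bigD1 i) //= big1 => [|j /negPf ji].
  rewrite rE std_vec_max mxE mul1r addr0 -NE.
  have /matrixP/(_ i i) := adj1; rewrite !mxE eqxx => ->; exact: oner_neq0.
rewrite -NE; have /matrixP/(_ j i) := adj1; rewrite !mxE ji => ->.
by rewrite mulr0n mulr0.
Qed.

Lemma frame_form_frame (xy : multiproj K (5 + 5) 3) r : hcoords r xy ->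
  frame_form.@[evalvec r] != 0 ->
  exists2 G : 'M[K]_4, G \in unitmx & forall i, pmap G (xy (s i)) = std_points K i.
Proof.
move=> rxy; rewrite frame_form_eval mulf_eq0 negb_or => /andP [dN /prodf_neq0 cN].
exact: (@general_position_frame (fun i => xy (s i)) (fun i => r (s i)) (fun i => rxy (s i))
  dN (fun i => cN i isT)).
Qed.

End Form.
Lemma generic_frames (P : multiproj K (5 + 5) 3 -> Prop) :
  (forall (xy : multiproj K (5 + 5) 3) (G0 G1 : 'M[K]_4), G0 \in unitmx -> G1 \in unitmx ->
     (forall i, pmap G0 (xy (lshift 5 i)) = std_points K i) ->
     (forall i, pmap G1 (xy (rshift 5 i)) = std_points K i) -> P xy) ->
  generically P.
Proof.
move=> PG; have [dx wx] := multihomog_frame_form (@lshift 5 5).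
have [dy wy] := multihomog_frame_form (@rshift 5 5).
pose r0 (i : 'I_(5 + 5)) := std_vec K (match split i with inl k => k | inr k => k end).
apply: (generic_nonvanishing (r := r0) (multihomogM wx wy)).
- by move=> i; apply: std_vec_neq0.
- rewrite mevalM mulf_neq0 //; apply: frame_form_std => i.
    by rewrite /r0 (unsplitK (inl i)).
  by rewrite /r0 (unsplitK (inr i)).
move=> xy r rxy; rewrite mevalM mulf_eq0 negb_or => /andP [w0 w1].
have [G0 uG0 GX] := frame_form_frame rxy w0; have [G1 uG1 GY] := frame_form_frame rxy w1.
exact: PG uG0 uG1 GX GY.
Qed.

End GeneralPosition.

Section Main.
Variable K : numClosedFieldType.
Local Notation D := (degeneracy_locus 2 (std_matrix K)).

(** The bundle map for general points is the standard one in the coordinates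
adapted to the two sets of points. *)
Lemma transported_locus (G : 'I_2 -> 'M[K]_4) : (forall i, G i \in unitmx) ->
  exists M : 'M[{mpoly K[2 * 4]}]_(4, 3), bundle_map summand_degrees M /\
    forall p, D (transport id G p) <-> degeneracy_locus 2 M p.
Proof.
move=> uG; exists (map_mx (pullback id G) (std_matrix K)); split.
  move=> i j; have H := @multihomog_pullback _ _ _ _ id G _ _ (@std_bundle_map K i j).
  have -> : map_mx (pullback id G) (std_matrix K) i j = pullback id G (std_matrix K i j).
    by rewrite mxE.
  apply: (multihomog_ext _ H) => l.
  rewrite (bigD1 l) //= eqxx muln1 big1 ?addn0 // => k /negPf.
  by rewrite eq_sym => ->; rewrite muln0.
move=> p; have E r : map_mx (meval (evalvec r)) (map_mx (pullback id G) (std_matrix K)) =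
    map_mx (meval (evalvec (fun i => G i *m r i))) (std_matrix K).
  by apply/matrixP => i j; rewrite !mxE pullback_eval.
split=> [Dp r rp|Dp].
  by rewrite E; apply: Dp; apply: (transport_coords id uG rp).
have [r rp] := hcoords_exist p; apply/(degeneracyP (transport_coords id uG rp)).
by rewrite -std_matrix_eval -E; apply: Dp.
Qed.

Theorem generic_centers_variety :
  generically (fun xy : multiproj K (5 + 5) 3 =>
    let X (i : 'I_5) := xy (lshift 5 i) in
    let Y (i : 'I_5) := xy (rshift 5 i) in
    (exists M : 'M[{mpoly K[2 * 4]}]_(4, 3),
       bundle_map summand_degrees M /\
       forall p, centers_variety X Y p <-> degeneracy_locus 2 M p) /\
    (multidegree (centers_variety X Y) 2
       ('X_0 ^+ 2 *+ 3 + 'X_0 * 'X_1 *+ 5 + 'X_1 ^+ 2 *+ 3) /\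
     rational_fold 4 (centers_variety X Y))).
Proof.
apply: generic_frames => xy G0 G1 uG0 uG1 GX GY X Y.
pose G (i : 'I_2) := if i == 0 then G0 else G1.
have uG i : G i \in unitmx by rewrite /G; case: ifP.
have VE p : centers_variety X Y p <-> D (transport id G p).
  rewrite (variety_transport uG) -std_centers_variety.
  have -> : (fun i => pmap (G 0) (X i)) = std_points K by apply/funext => i; apply: GX.
  by have -> : (fun i => pmap (G 1) (Y i)) = std_points K by apply/funext => i; apply: GY.
have VE' : centers_variety X Y = (fun p => D (transport id G p)).
  by apply/funext => p; apply/propext.
have [M [bM ME]] := transported_locus uG.
split; first by exists M; split=> // p; rewrite VE.
rewrite VE'; split; last exact: rational_fold_transport (degeneracy_rational_fold K).
apply: multidegree_of_intersections; apply: intersection_transport => //.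
- exact: intersection13.
- exact: intersection22.
exact: intersection31.
Qed.

End Main.

Theorem corollary13 (R : realType) :
  generically (fun xy : multiproj R[i] (5 + 5) 3 =>
    let X (i : 'I_5) := xy (lshift 5 i) in
    let Y (i : 'I_5) := xy (rshift 5 i) in
    (exists M : 'M[{mpoly R[i][2 * 4]}]_(4, 3),
       bundle_map summand_degrees M /\
       forall p, centers_variety X Y p <-> degeneracy_locus 2 M p) /\
    (multidegree (centers_variety X Y) 2
       ('X_0 ^+ 2 *+ 3 + 'X_0 * 'X_1 *+ 5 + 'X_1 ^+ 2 *+ 3) /\
     rational_fold 4 (centers_variety X Y))) /\
  (let V := centers_variety (std_points R[i]) (std_points R[i]) in
   let M := std_matrix R[i] in
   bundle_map summand_degrees M /\
   (forall p, V p <-> degeneracy_locus 2 M p) /\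
   (forall f, vanishing_ideal V f <-> maximal_minor_ideal M f)).
Proof.
split; first exact: (generic_centers_variety R[i]).
move=> V M; split; first by move=> i j; apply: (@std_bundle_map R[i] i j).
split; first exact: (@std_centers_variety R[i]).
exact: (@std_vanishing_ideal R[i]).
Qed.
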